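(* Let $L\ge 1$. There exist constants $c,c_0,c_1,c_2>0$ that depend only on $L$ for which the following holds. Let $\sigma>0$, let $X$ be distributed according to $\mu$ on $\mathcal{X}$, let $\mathcal{F}\subset L_2(\mu)$ be a locally compact, convex class of functions and let $Y\in L_2$ be a real random variable. Assume that (i) $\|f-h\|_{L_4}\le L\|f-h\|_{L_2}$ for every $f,h\in\mathcal{F}$; (ii) $\|f-Y\|_{L_4}\le L\|f-Y\|_{L_2}$ for every $f\in\mathcal{F}$; (iii) $\|f^*-Y\|_{L_2}\le\sigma$, where $\sigma$ is known. Let $$r^*(f^* )=\max\{\lambda_{\mathbb{Q}}(c_1,c_2,f^* ),\ \lambda_{\mathbb{M}}(c_1/\sigma,c_2,f^* ),\ r_E(c_1,f^* ),\ \overline{r}_{\mathbb{M}}(c_1,f^* )\}$$ and fix $r\ge 2r^*(f^* )$. Then there exists a procedure that, based on the data $\mathcal{D}_N=(X_i,Y_i)_{i=1}^N$ and the values of $L$, $\sigma$ and $r$ (and not on the unknown distribution of $(X,Y)$), selects a function $\widehat{f}\in\mathcal{F}$ such that, with probability at least $$1-\exp\bigl(-c_0N\min\{1,\sigma^{-2}r^2\}\bigr),$$ one has $$\|\widehat{f}-f^*\|_{L_2}\le c\,r\quad\text{and}\quad \mathbb{E}\bigl((\widehat{f}(X)-Y)^2\,\big|\,\mathcal{D}_N\bigr)\le \mathbb{E}(f^*(X)-Y)^2+(c\,r)^2 .$$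
   Context: Setting. $X$ takes values in a measurable space $\mathcal{X}$ and has law $\mu$; $Y$ is a real square-integrable random variable; $(X_i,Y_i)_{i=1}^N$ are independent copies of $(X,Y)$, and $(X,Y)$ is independent of $\mathcal{D}_N=(X_i,Y_i)_{i=1}^N$. The law of $(X,Y)$ is unknown. $\mathcal{F}$ is a class of real functions on $\mathcal{X}$. A procedure is a map $(\mathcal{X}\times\mathbb{R})^N\to\mathcal{F}$; it may depend on $\mathcal{F}$, $N$ and the listed parameters only. Standing assumption: the minimizer $f^*=\mathrm{argmin}_{f\in\mathcal{F}}\mathbb{E}(f(X)-Y)^2$ exists in $\mathcal{F}$ and is unique. Norms: $\|f-g\|_{L_q}=(\mathbb{E}|f(X)-g(X)|^q)^{1/q}$ and $\|f-Y\|_{L_q}=(\mathbb{E}|f(X)-Y|^q)^{1/q}$; conditional on the data, $\|\widehat f-f^*\|_{L_2}^2=\mathbb{E}((\widehat f(X)-f^*(X))^2|\mathcal{D}_N)$. Complexity parameters. $D=\{f:\|f\|_{L_2(\mu)}\le1\}$. For a class $V$ and a function $h$, $\mathrm{star}(V,h)=\{\lambda v+(1-\lambda)h: 0\le\lambda\le1,\ v\in V\}$. For $h\in\mathcal{F}$, $r>0$, $\mathcal{F}_{h,r}=\mathrm{star}(\mathcal{F}-h,0)\cap rD$. For $H\subset L_2(\mu)$ and $\varepsilon>0$, $\mathcal{M}(H,\varepsilon D)$ is the maximal cardinality of a subset of $H$ whose distinct points are at $L_2(\mu)$ distance at least $\varepsilon$. $(\varepsilon_i)_{i=1}^N$ are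 independent symmetric $\{-1,1\}$-valued random variables independent of $(X_i,Y_i)_{i=1}^N$. For $\kappa,\eta>0$ and $h\in\mathcal{F}$: $$\lambda_{\mathbb{Q}}(\kappa,\eta,h)=\inf\{r:\log\mathcal{M}(\mathcal{F}_{h,r},\eta rD)\le\kappa^2N\},$$ $$\lambda_{\mathbb{M}}(\kappa,\eta,h)=\inf\{r:\log\mathcal{M}(\mathcal{F}_{h,r},\eta rD)\le\kappa^2Nr^2\},$$ $$r_E(\kappa,h)=\inf\Bigl\{r:\mathbb{E}\sup_{u\in\mathcal{F}_{h,r}}\Bigl|\tfrac1{\sqrt N}\sum_{i=1}^N\varepsilon_iu(X_i)\Bigr|\le\kappa\sqrt N\,r\Bigr\},$$ $$\overline{r}_{\mathbb{M}}(\kappa,h)=\inf\Bigl\{r:\mathbb{E}\sup_{u\in\mathcal{F}_{h,r}}\Bigl|\tfrac1{\sqrt N}\sum_{i=1}^N\varepsilon_iu(X_i)(h(X_i)-Y_i)\Bigr|\le\kappa\sqrt N\,r^2\Bigr\}.$$ *)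

(* Defs.v *)
From HB Require Import structures.
From mathcomp Require Import all_boot all_order all_algebra.
From mathcomp Require Import all_classical all_reals all_analysis.
From mathcomp Require Import measurable_realfun.

Set Implicit Arguments.
Unset Strict Implicit.
Unset Printing Implicit Defensive.

Import Order.TTheory GRing.Theory Num.Theory.
Import numFieldNormedType.Exports.

Local Open Scope classical_set_scope.
Local Open Scope card_scope.
Local Open Scope ring_scope.

Section product_law.
Context d (T : measurableType d) (R : realType).

Definition tcons n (z : T * n.-tuple T) : n.+1.-tuple T :=
  [tuple of z.1 :: z.2].

Lemma measurable_tcons n : measurable_fun [set: T * n.-tuple T] (@tcons n).
Proof.
apply: (@measurable_cons _ _ (T * n.-tuple T)%type T fst n snd).
  exact: measurable_fst.
exact: measurable_snd.
Qed.

HB.instance Definition _ n :=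
  isMeasurableFun.Build _ _ _ _ (@tcons n) (@measurable_tcons n).

(* The n-fold product P \x ... \x P, i.e. the law of n independent copies of a
   random element with law P. *)
Fixpoint iid (P : probability T R) n : probability (n.-tuple T) R :=
  if n is m.+1 then distribution (P \x iid P m)%E (@tcons m)
  else \d_([tuple] : 0.-tuple T).

(* E^* Z, the infimum of E g over the measurable g >= Z.  It is E Z as soon as
   Z >= 0 is measurable; suprema over an uncountable class need not be. *)
Definition outer_expectation (P : probability T R) (Z : T -> \bar R) : \bar R :=
  ereal_inf [set (\int[P]_w g w)%E | g in
    [set g : T -> \bar R | measurable_fun [set: T] g /\ forall w, (Z w <= g w)%E]].

End product_law.

Section fst_mfun.
Context d1 d2 (T1 : measurableType d1) (T2 : measurableType d2).
HB.instance Definition _ :=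
  isMeasurableFun.Build _ _ _ _ (@fst T1 T2) (@measurable_fst _ _ T1 T2).
End fst_mfun.

Definition Lqnorm d (T : measurableType d) (R : realType)
    (mu : {measure set T -> \bar R}) (q : R) (f : T -> R) : \bar R :=
  'N[mu]_q%:E[EFin \o f]%E.

(* Square-integrable functions with the topology of the L_2(mu) pseudo-distance
   (functions are not identified when equal mu-almost everywhere). *)
Section L2_topology.
Context d (T : measurableType d) (R : realType).
Variable mu : {measure set T -> \bar R}.

Definition L2fun : Type := LfunType mu (lee1n 2).

HB.instance Definition _ := Choice.on L2fun.

Let funL2 (f : L2fun) : T -> R := (f : LfunType mu (lee1n 2)).

Definition L2ball (f : L2fun) (e : R) (g : L2fun) : Prop :=
  (Lqnorm mu 2 (funL2 f \- funL2 g)%R < e%:E)%E.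

Let mf (f : L2fun) : measurable_fun setT (funL2 f).
Proof. exact: (@measurable_funPT _ _ _ _ (f : LfunType mu (lee1n 2))). Qed.

Let L2ball_center f (e : R) : 0 < e -> L2ball f e f.
Proof.
move=> e0; rewrite /L2ball /Lqnorm (_ : EFin \o _ = cst 0%E); last first.
  by apply/funext => x /=; rewrite subrr.
by rewrite Lnorm0 ?lte_fin// eqe pnatr_eq0.
Qed.

Let L2ball_sym f g (e : R) : L2ball f e g -> L2ball g e f.
Proof.
rewrite /L2ball /Lqnorm => /(le_lt_trans _); apply.
rewrite -(oppe_Lnorm mu (EFin \o (funL2 f \- funL2 g))) le_eqVlt; apply/orP.
by left; apply/eqP/eq_Lnorm => x /=; rewrite opprB.
Qed.

Let L2ball_triangle f g h (e1 e2 : R) :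
  L2ball f e1 g -> L2ball g e2 h -> L2ball f (e1 + e2) h.
Proof.
rewrite /L2ball /Lqnorm => fg gh; rewrite EFinD; apply: le_lt_trans (lteD fg gh).
have -> : (funL2 f \- funL2 h) =
    ((funL2 f \- funL2 g) \+ (funL2 g \- funL2 h)).
  by apply/funext => x /=; rewrite addrA subrK.
apply: minkowski_EFin; first exact: measurable_funB.
  exact: measurable_funB.
by rewrite (@ler1n R 2).
Qed.

HB.instance Definition _ := hasNbhs.Build L2fun (nbhs_ (entourage_ L2ball)).

HB.instance Definition _ := @Nbhs_isPseudoMetric.Build R L2fun
  (entourage_ L2ball) erefl L2ball L2ball_center L2ball_sym L2ball_triangle
  erefl.

End L2_topology.

Section setting.
Context d (T : measurableType d) (R : realType).

(* Every point of F has a neighbourhood whose trace on F is compact, F carrying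
   the topology of L_2(mu). *)
Definition L2_locally_compact (mu : {measure set T -> \bar R})
    (F : set (T -> R)) : Prop :=
  forall f : L2fun mu, F f ->
    exists2 U, nbhs f U & compact (U `&` [set g : L2fun mu | F g]).

Definition convex_class (F : set (T -> R)) : Prop :=
  convex_set (F : set (convex_lmodType (T -> R^o))).

Definition star (V : set (T -> R)) (h : T -> R) : set (T -> R) :=
  [set f | exists2 v, V v & exists2 l : R, 0 <= l <= 1 &
    f = (fun x => l * v x + (1 - l) * h x)].

Definition localized (mu : {measure set T -> \bar R}) (F : set (T -> R))
    (h : T -> R) (r : R) : set (T -> R) :=
  star [set f \- h | f in F] (cst 0) `&`
  [set u | (Lqnorm mu 2 u <= r%:E)%E].

(* Maximal cardinality, +oo when unbounded, of an eps-separated subset of H. *)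
Definition packing (mu : {measure set T -> \bar R}) (H : set (T -> R))
    (eps : R) : \bar R :=
  ereal_sup [set n%:R%:E | n in [set n : nat |
    exists A : set (T -> R), [/\ A `<=` H, A #= `I_n &
      forall u v, A u -> A v -> u <> v ->
        (eps%:E <= Lqnorm mu 2 (u \- v)%R)%E]]].

Variable rho : probability (T * R)%type R.

(* [rho] is the law of (X, Y), on the canonical space where X = fst and
   Y = snd.  For f chosen from a sample independent of (X, Y), [risk f] is the
   conditional expectation of (f(X) - Y)^2 given the sample. *)
Definition lawX : probability T R := distribution rho (@fst T R).

Definition residual (f : T -> R) (z : T * R) : R := f z.1 - z.2.

Definition risk (f : T -> R) : \bar R :=
  'E_rho[(fun z => residual f z ^+ 2)%R]%E.

(* Uniqueness is meant in L_2(mu), that is, up to mu-almost sure equality. *)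
Definition unique_minimizer (F : set (T -> R)) (fstar : T -> R) : Prop :=
  [/\ F fstar,
      forall f, F f -> (risk fstar <= risk f)%E &
      forall g, F g -> (forall f, F f -> (risk g <= risk f)%E) ->
        g = fstar %[ae lawX]].

Section complexity.
Variables (F : set (T -> R)) (N : nat).

(* The infima below are in \bar R: they are +oo when no r > 0 qualifies. *)
Definition lambdaQ (kappa eta : R) (h : T -> R) : \bar R :=
  ereal_inf [set r%:E | r in [set r : R | 0 < r /\
    (lne (packing lawX (localized lawX F h r) (eta * r))
      <= (kappa ^+ 2 * N%:R)%:E)%E]].

Definition lambdaM (kappa eta : R) (h : T -> R) : \bar R :=
  ereal_inf [set r%:E | r in [set r : R | 0 < r /\
    (lne (packing lawX (localized lawX F h r) (eta * r))
      <= (kappa ^+ 2 * N%:R * r ^+ 2)%:E)%E]].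

(* N independent triples ((X_i, Y_i), b_i) with b_i a fair coin independent of
   (X_i, Y_i): the random sign is eps_i = (-1) ^ b_i. *)
Definition signed_sample :
    probability (N.-tuple ((T * R) * bool)%type) R :=
  iid (rho \x bernoulli_prob (2^-1 : R))%E N.

(* E sup_{u in H} | N^(-1/2) \sum_i eps_i u(X_i) w(X_i, Y_i) | *)
Definition rademacher (H : set (T -> R)) (w : T * R -> R) : \bar R :=
  outer_expectation signed_sample (fun s =>
    ereal_sup [set `| (Num.sqrt N%:R)^-1 * \sum_(i < N)
        (-1) ^+ (tnth s i).2 * u (tnth s i).1.1 * w (tnth s i).1 |%:E
      | u in H]).

Definition rE (kappa : R) (h : T -> R) : \bar R :=
  ereal_inf [set r%:E | r in [set r : R | 0 < r /\
    (rademacher (localized lawX F h r) (cst 1%R)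
      <= (kappa * Num.sqrt N%:R * r)%:E)%E]].

Definition rM (kappa : R) (h : T -> R) : \bar R :=
  ereal_inf [set r%:E | r in [set r : R | 0 < r /\
    (rademacher (localized lawX F h r) (residual h)
      <= (kappa * Num.sqrt N%:R * r ^+ 2)%:E)%E]].

Definition rstar (c1 c2 sigma : R) (h : T -> R) : \bar R :=
  Order.max (lambdaQ c1 c2 h)
    (Order.max (lambdaM (c1 / sigma) c2 h)
      (Order.max (rE c1 h) (rM c1 h))).

End complexity.
End setting.

(* Main.v *)
(* Median-of-means tournament.  Split the sample into blocks of length of order
   max(1, (sigma / r)^2) and let f beat g when, on a strict majority of the
   blocks, the empirical squared loss of f exceeds that of g by at most r^2; the
   procedure returns any f that beats the whole class.  With u = f - f* and
   xi = f* - Y, the excess loss of f over a block is the block sum of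
   u^2 + 2 u xi, where E(u xi) >= 0 by convexity.  Rescale u to a function v of
   norm at most r.  On the good event, for all such v simultaneously, the sums of
   v xi and of min(|v| / r, 1) are close to their means on more than three
   quarters of the blocks.  The small-ball estimate E min(|v| / r, 1) >= 1/(2 L^4)
   for ||v|| = r, a consequence of the L_4-L_2 equivalence, then makes the
   quadratic term win as soon as E u^2 + 2 E(u xi) exceeds a multiple of r^2, so
   f* beats the class and nobody with a larger excess risk beats f*.
   The good event has exponentially small complement because the number of
   deviating blocks has bounded differences, and its mean is controlled through
   symmetrization and contraction by r_E and r_M.  The suprema over the class
   need not be measurable, so each of these steps is carried out on measurable
   majorants.  When the sample is too short for many blocks, the exponent is
   bounded and a single block with Markov's inequality suffices. *)

(* Outer expectations do not obey Fubini, while symmetrization and bounded differences integrate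
   coordinate by coordinate. Each tool is therefore stated for measurable upper bounds: given
   majorants of the input process it builds majorants of the output process and compares the
   integrals. Two obstacles follow. Contraction acts sample by sample and its new bounds come from a
   choice that need not be measurable, so the majorants are first rounded to countably many values.
   A majorant of the count of deviating blocks need not inherit its bounded differences, so it is
   clamped afresh for each block.

   The constants come from [t = 1/(4 L^4)], half of the small-ball bound. Let [a = E u^2 > r^2]. On
   a block without deviation the mean of [v^2] is at least [r^2 t^2], so that of [u^2] is at least
   [a t^2]; half of it absorbs the fluctuation of the linear term. What is left, [a t^2 / 2],
   reaches [2 r^2] once [a >= 64 L^8 r^2], which is the origin of [c = 8 L^4]. In the theorem [fhat]
   is fixed before [rho], so it cannot depend on the unknown law. *)
From HB Require Import structures.
Require Import Defs.
From mathcomp Require Import all_boot all_order all_algebra.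
From mathcomp Require Import all_classical all_reals all_analysis.
From mathcomp Require Import measurable_realfun.
From mathcomp Require Import ring lra zify.

Set Implicit Arguments.
Unset Strict Implicit.
Unset Printing Implicit Defensive.
Import Order.TTheory GRing.Theory Num.Theory.
Import numFieldNormedType.Exports.

Local Open Scope classical_set_scope.
Local Open Scope ring_scope.

(** * Independent samples and random signs *)

Section product.
Context d (T : measurableType d) (R : realType) (P : probability T R).

Local Open Scope ereal_scope.

Lemma integral_iidS n (f : n.+1.-tuple T -> \bar R) :
  measurable_fun setT f -> (forall x, 0 <= f x) ->
  \int[iid P n.+1]_x f x = \int[P]_z \int[iid P n]_w f (tcons (z, w)).
Proof.
move=> mf f0 /=.
rewrite ge0_integral_pushforward//.
rewrite (@fubini_tonelli1 _ _ _ _ _ P (iid P n) (fun x => f (tcons x)))//.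
by apply: measurableT_comp => //; exact: measurable_tcons.
Qed.

(** Used in two ways: with a ghost sample [D'] it exchanges blocks for symmetrization, and with [D]
    integrated out it gives the conditional expectation given the coordinates outside [tau]. *)
Definition mix n (tau : 'I_n -> bool) (D D' : n.-tuple T) : n.-tuple T :=
  [tuple if tau i then tnth D i else tnth D' i | i < n].

Lemma tnth_mix n (tau : 'I_n -> bool) D D' i :
  tnth (mix tau D D') i = if tau i then tnth D i else tnth D' i.
Proof. by rewrite tnth_mktuple. Qed.

Lemma measurable_mix d' (W : measurableType d') n (tau : 'I_n -> bool)
    (f g : W -> n.-tuple T) :
  measurable_fun setT f -> measurable_fun setT g ->
  measurable_fun setT (fun w => mix tau (f w) (g w)).
Proof.
move=> mf mg; apply/measurable_fun_tnthP => i.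
rewrite (_ : _ \o _ = fun w => if tau i then tnth (f w) i else tnth (g w) i).
  by case: (tau i); apply: (measurableT_comp (@measurable_tnth _ _ _ i)).
by apply/funext => w; rewrite /= tnth_mix.
Qed.

Lemma mix_tcons n (tau : 'I_n.+1 -> bool) z w z' w' :
  mix tau (tcons (z, w)) (tcons (z', w')) =
  tcons (if tau ord0 then z else z', mix (tau \o lift ord0) w w').
Proof.
apply: eq_from_tnth => i; rewrite tnth_mix.
case: (unliftP ord0 i) => [j ->|->]; last by rewrite !tnth0.
by rewrite !tnthS tnth_mix.
Qed.

Lemma integral_cst1 d' (W : measurableType d') (Q : probability W R) (c : \bar R) :
  \int[Q]_x c = c.
Proof. by rewrite integral_cst// [X in _ * X]probability_setT mule1. Qed.

Section comp_meas.
Context d1 d2 (A : measurableType d1) (B : measurableType d2).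
Variables (Q : probability B R).

Lemma measurable_partial_integral (h : A * B -> \bar R) :
  measurable_fun setT h -> (forall x, 0 <= h x) ->
  measurable_fun setT (fun a => \int[Q]_b h (a, b)).
Proof. by move=> mh h0; exact: measurable_fun_fubini_tonelli_F. Qed.

Lemma measurable_pairl (h : A * B -> \bar R) a :
  measurable_fun setT h -> measurable_fun setT (fun b => h (a, b)).
Proof. by move=> mh; exact: measurableT_comp. Qed.

Lemma integralC (P' : probability A R) (h : A * B -> \bar R) :
  measurable_fun setT h -> (forall x, 0 <= h x) ->
  \int[P']_a \int[Q]_b h (a, b) = \int[Q]_b \int[P']_a h (a, b).
Proof. by move=> mh h0; exact: fubini_tonelli. Qed.
End comp_meas.

Lemma measurable_tcons2 d' (W : measurableType d') n (f : W -> T)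
    (g : W -> n.-tuple T) :
  measurable_fun setT f -> measurable_fun setT g ->
  measurable_fun setT (fun w => tcons (f w, g w)).
Proof. by move=> mf mg; apply: measurable_cons. Qed.

(** By independence, coordinates picked from two independent samples along a fixed mask form again
    an i.i.d. sample. *)
Lemma integral_mix n (tau : 'I_n -> bool) (f : n.-tuple T -> \bar R) :
  measurable_fun setT f -> (forall x, 0 <= f x) ->
  \int[iid P n]_D \int[iid P n]_D' f (mix tau D D') = \int[iid P n]_D f D.
Proof.
elim: n tau f => [|n IH] tau f mf f0.
  have e (D : 0.-tuple T) : D = [tuple] by apply: val_inj; rewrite /= tuple0.
  have e2 g : (fun D : 0.-tuple T => g D) = cst (g [tuple]) :> (_ -> \bar R).
    by apply/funext => D; rewrite (e D).
  rewrite [in LHS](e2 (fun D => _)) [in RHS](e2 f) !integral_cst1.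
  rewrite [in LHS](e2 (fun D => _)) integral_cst1.
  by rewrite (e (mix _ _ _)).
have mF : measurable_fun setT
    (fun p : (n.+1.-tuple T * n.+1.-tuple T)%type => f (mix tau p.1 p.2)).
  by apply: measurableT_comp => //; exact: measurable_mix.
have := @measurable_partial_integral _ _ _ _ (iid P n.+1) _ mF (fun=> f0 _) => /= mG.
rewrite [LHS]integral_iidS//; last by move=> x; apply: integral_ge0.
transitivity (\int[P]_z \int[iid P n]_w \int[P]_z' \int[iid P n]_w'
  f (tcons (if tau ord0 then z else z', mix (tau \o lift ord0) w w'))).
  apply: eq_integral => z _; apply: eq_integral => w _.
  rewrite integral_iidS//; last first.
    exact: (@measurable_pairl _ _ _ _ (fun p => f (mix tau p.1 p.2))).
  by apply: eq_integral => z' _; apply: eq_integral => w' _; rewrite mix_tcons.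
pose g z z' w := f (tcons (if tau ord0 then z else z' : T, w : n.-tuple T)).
(* Fubini moves the first tail past [z']; the two tails are then integrated consecutively, and the
   induction hypothesis merges them while both heads stay fixed. *)
transitivity (\int[P]_z \int[P]_z' \int[iid P n]_w g z z' w).
  apply: eq_integral => z _; rewrite (@integralC _ _ _ _ P (iid P n) (fun p =>
    \int[iid P n]_w' f (tcons (if tau ord0 then z else p.2,
       mix (tau \o lift ord0) p.1 w')))); last 2 first.
  - apply: (@measurable_partial_integral _ _ _ _ (iid P n) (fun q => f (tcons
     (if tau ord0 then z else q.1.2, mix (tau \o lift ord0) q.1.1 q.2)))) => //.
    apply: measurableT_comp => //; apply: measurable_tcons2.
      case: (tau ord0); first exact: measurable_cst.
      exact: (measurableT_comp (@measurable_snd _ _ _ _)).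
    apply: measurable_mix => //.
    exact: (measurableT_comp (@measurable_fst _ _ _ _)).
  - by move=> p; apply: integral_ge0.
  apply: eq_integral => z' _; rewrite /= (IH (tau \o lift ord0) (g z z'))//.
    by apply: measurableT_comp => //; apply: measurable_tcons2.
  by move=> x; exact: f0.
rewrite [RHS](integral_iidS mf f0) /g; case: (tau ord0).
  by apply: eq_integral => z _; rewrite integral_cst1.
by rewrite integral_cst1.
Qed.

End product.

Lemma big_tupleS (V : nmodType) (n : nat) (f : n.+1.-tuple bool -> V) :
  \sum_(e : n.+1.-tuple bool) f e =
  \sum_(b : bool) \sum_(e : n.-tuple bool) f [tuple of b :: e].
Proof.
rewrite pair_big/= (reindex (fun p : bool * n.-tuple bool =>
  [tuple of p.1 :: p.2]))//=.
exists (fun e : n.+1.-tuple bool => (thead e, [tuple of behead e])).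
  by move=> [b e] _; congr pair; apply: val_inj.
by move=> e _; apply: val_inj; case/tupleP: e.
Qed.

Section signs.
Context d (T : measurableType d) (R : realType) (P : probability T R).
Local Open Scope ereal_scope.

Definition zsign n (D : n.-tuple T) (e : n.-tuple bool) :
  n.-tuple (T * bool)%type := [tuple (tnth D i, tnth e i) | i < n].

Lemma zsign_tcons n z (D : n.-tuple T) b (e : n.-tuple bool) :
  zsign (tcons (z, D)) [tuple of b :: e] = tcons ((z, b), zsign D e).
Proof.
apply: eq_from_tnth => i; rewrite tnth_mktuple.
case: (unliftP ord0 i) => [j ->|->]; last by rewrite !tnth0.
by rewrite !tnthS tnth_mktuple.
Qed.

Lemma measurable_zsign n (e : n.-tuple bool) :
  measurable_fun setT (fun D : n.-tuple T => zsign D e).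
Proof.
apply/measurable_fun_tnthP => i.
rewrite (_ : _ \o _ = fun D => (tnth D i, tnth e i)); last first.
  by apply/funext => D /=; rewrite tnth_mktuple.
by apply: measurable_fun_pair => //; exact: measurable_tnth.
Qed.

(** The signs take finitely many values, so their expectation is a finite average. Contraction and
    symmetrization can then work with one measurable function of the data per sign pattern. *)
Lemma integral_signed n (f : n.-tuple (T * bool)%type -> \bar R) :
  measurable_fun setT f -> (forall x, 0 <= f x) ->
  \int[iid (P \x bernoulli_prob (2^-1 : R)) n]_s f s =
  ((2^-1) ^+ n)%:E *
    \sum_(e : n.-tuple bool) \int[iid P n]_D f (zsign D e).
Proof.
have half01 : (0 <= (2^-1 : R) <= 1)%R by lra.
elim: n f => [|n IH] f mf f0.
  have e (U : Type) (D : 0.-tuple U) : D = [tuple].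
    by apply: val_inj; rewrite /= tuple0.
  have e2 (U : Type) g : (fun D : 0.-tuple U => g D) = cst (g [tuple])
      :> (_ -> \bar R).
    by apply/funext => D; rewrite (e _ D).
  rewrite [in LHS](e2 _ f) integral_cst1 expr0 mul1e (big_pred1 [tuple]).
    rewrite (eq_integral (cst (f [tuple]))) ?integral_cst1//.
    by move=> D _; rewrite (e _ (zsign _ _)).
  by move=> t; rewrite (e _ t) /= eqxx.
rewrite integral_iidS//.
pose F b z := \int[iid P n]_D
  \sum_(e : n.-tuple bool) f (tcons ((z, b), zsign D e)).
have mt b z e : measurable_fun setT
    (fun D : n.-tuple T => f (tcons ((z, b), zsign D e))).
  apply: measurableT_comp => //; apply: measurable_tcons2 => //.
  exact: measurable_zsign.
have mt2 b e : measurable_fun setT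
    (fun p : T * n.-tuple T => f (tcons ((p.1, b), zsign p.2 e))).
  apply: measurableT_comp => //; apply: measurable_tcons2.
    by apply: measurable_fun_pair.
  exact: (measurableT_comp (measurable_zsign e) measurable_snd).
have mF b : measurable_fun setT (F b).
  apply: (@measurable_partial_integral _ _ _ _ _ (iid P n)
    (fun p => \sum_(e : n.-tuple bool) f (tcons ((p.1, b), zsign p.2 e)))).
    by apply: emeasurable_sum => e; exact: mt2.
  by move=> x; apply: sume_ge0.
have F0 b z : 0 <= F b z.
  by apply: integral_ge0 => D _; apply: sume_ge0.
have half0 m : 0 <= (((2^-1) ^+ m)%R : R)%:E by rewrite lee_fin exprn_ge0.
rewrite (eq_integral (fun p => ((2^-1) ^+ n)%:E * F p.2 p.1)); last first.
  move=> -[z b] _ /=; rewrite IH//.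
    congr (_ * _); rewrite /F ge0_integral_sum//.
  by apply: measurableT_comp => //; apply: measurable_tcons2.
have mFF : measurable_fun setT (fun p : T * bool => F p.2 p.1).
  rewrite (_ : (fun p => _) = fun p => if p.2 then F true p.1 else F false p.1).
    exact: (measurable_fun_if_pair (mF true) (mF false)).
  by apply/funext => -[z []].
rewrite ge0_integralZl//.
rewrite exprS mulrC EFinM -muleA; congr (_ * _).
rewrite (@fubini_tonelli1 _ _ _ _ _ P (bernoulli_prob (2^-1 : R))
  (fun p : T * bool => F p.2 p.1))//.
transitivity (\int[P]_z (2^-1%:E * (F true z + F false z))).
  apply: eq_integral => z _; rewrite /fubini_F/=.
  rewrite integral_bernoulli_prob//.
  have -> : unstable.onem (2^-1 : R) = (2^-1 : R)%R by rewrite /unstable.onem; lra.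
  by rewrite [RHS](ge0_muleDr _ (F0 true z) (F0 false z)).
rewrite ge0_integralZl//; last 2 first.
- by apply: emeasurable_funD.
- by move=> z _; apply: adde_ge0.
congr (_ * _).
rewrite big_tupleS big_bool ge0_integralD//.
have h b : \int[P]_z F b z =
    \sum_(e : n.-tuple bool) \int[iid P n.+1]_D f (zsign D [tuple of b :: e]).
  transitivity (\int[P]_z \sum_(e : n.-tuple bool)
      \int[iid P n]_D f (tcons ((z, b), zsign D e))).
    by apply: eq_integral => z _; rewrite /F ge0_integral_sum.
  rewrite ge0_integral_sum//; first last.
    by move=> e z _; apply: integral_ge0.
    move=> e; apply: (@measurable_partial_integral _ _ _ _ _ (iid P n)
      (fun p => f (tcons ((p.1, b), zsign p.2 e)))).
      exact: mt2.
    by move=> x; exact: f0.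
  apply: eq_bigr => e _; rewrite integral_iidS//; last first.
    by apply: measurableT_comp => //; exact: measurable_zsign.
  apply: eq_integral => z _; apply: eq_integral => D _.
  by rewrite zsign_tcons.
by rewrite !h.
Qed.

End signs.

(** * Contraction, symmetrization and bounded differences *)

Section contraction.
Variable R : realType.

(** One coordinate of the Ledoux-Talagrand contraction. Arbitrary upper bounds [k0], [k1] stand for
    the suprema under the two signs; one of them may grow, only their sum is preserved. *)
Lemma contraction1 (I : Type) (h s : I -> R) (phi : R -> R) (k0 k1 : R) :
  (forall x y, `|phi x - phi y| <= `|x - y|) ->
  (forall i, h i + s i <= k0) -> (forall i, h i - s i <= k1) ->
  exists k0' k1', [/\ forall i, h i + phi (s i) <= k0',
    forall i, h i - phi (s i) <= k1' & k0' + k1' <= k0 + k1].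
Proof.
move=> lip H0 H1.
have [[i0 _]|I0] := pselect (exists i : I, True); last first.
  by exists k0, k1; split=> // i; exfalso; apply: I0; exists i.
(* The Lipschitz bound replaces the difference of the [phi] values by [|s i - s j|], whose sign
   decides which of [i], [j] is paired with [k0]. *)
have key i j : (h i + phi (s i)) + (h j - phi (s j)) <= k0 + k1.
  have := lip (s i) (s j); have := H0 i; have := H0 j; have := H1 i.
  have := H1 j; rewrite !ler_norml.
  by case: (lerP 0 (s i - s j)) => [/ger0_norm ->|/ltr0_norm ->];
    move=> ? ? ? ? /andP[]; lra.
pose A := [set h i + phi (s i) | i in [set: I]].
have A0 : A !=set0 by exists (h i0 + phi (s i0)); exists i0.
have ubA i : ubound A (k0 + k1 - (h i - phi (s i))).
  by move=> _ [j _ <-]; have := key j i; lra.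
(* The supremum is the least bound for the first family; by [key], what remains of [k0 + k1] bounds
   the second. *)
exists (sup A), (k0 + k1 - sup A); split=> [i|i|]; last by lra.
- by apply: ub_le_sup; [exists (k0 + k1 - (h i0 - phi (s i0)))|exists i].
- by have := ge_sup A0 (ubA i); lra.
Qed.

(** Induction on the number of signs. For each pattern of the remaining signs the first coordinate
    is contracted, which redistributes the bounds between the two patterns extending it; hence only
    the total over patterns is controlled. *)
Lemma contraction (I : Type) n (h : I -> R) (t : I -> 'I_n -> R)
    (phi : 'I_n -> R -> R) (k : n.-tuple bool -> R) :
  (forall j x y, `|phi j x - phi j y| <= `|x - y|) ->
  (forall i (e : n.-tuple bool), h i + \sum_(j < n) (-1) ^+ tnth e j * t i j <= k e) ->
  exists2 k', (forall i (e : n.-tuple bool),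
    h i + \sum_(j < n) (-1) ^+ tnth e j * phi j (t i j) <= k' e) &
    \sum_e k' e <= \sum_e k e.
Proof.
elim: n h t phi k => [|n IH] h t phi k lip H.
  by exists k => // i e; have := H i e; rewrite !big_ord0.
have step (e : n.-tuple bool) : exists q : R * R,
  [/\ forall i, h i + \sum_(j < n) (-1) ^+ tnth e j * t i (lift ord0 j)
        + phi ord0 (t i ord0) <= q.1,
      forall i, h i + \sum_(j < n) (-1) ^+ tnth e j * t i (lift ord0 j)
        - phi ord0 (t i ord0) <= q.2 &
      q.1 + q.2 <= k [tuple of false :: e] + k [tuple of true :: e]].
  have [||k0 [k1 [? ? ?]]] := @contraction1 I
    (fun i => h i + \sum_(j < n) (-1) ^+ tnth e j * t i (lift ord0 j))
    (fun i => t i ord0) (phi ord0) (k [tuple of false :: e])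
    (k [tuple of true :: e]) (lip ord0).
  - move=> i; have := H i [tuple of false :: e].
    rewrite big_ord_recl tnth0 expr0 mul1r.
    by under eq_bigr do rewrite tnthS; lra.
  - move=> i; have := H i [tuple of true :: e].
    rewrite big_ord_recl tnth0 expr1 mulN1r.
    by under eq_bigr do rewrite tnthS; lra.
  by exists (k0, k1).
have {step}/choice[q Hq] := step.
pose kb (b : bool) e := if b then (q e).2 else (q e).1.
have step2 (b : bool) : exists kb' : n.-tuple bool -> R, (forall i (e : n.-tuple bool),
    (h i + (-1) ^+ b * phi ord0 (t i ord0)) +
    \sum_(j < n) (-1) ^+ tnth e j * phi (lift ord0 j) (t i (lift ord0 j))
      <= kb' e) /\ \sum_e kb' e <= \sum_e kb b e.
  have [|k' ? ?] := IH (fun i => h i + (-1) ^+ b * phi ord0 (t i ord0))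
    (fun i j => t i (lift ord0 j)) (fun j => phi (lift ord0 j)) (kb b)
    (fun j => lip _).
    move=> i e; have [h0 h1 _] := Hq e; have := h0 i; have := h1 i.
    by rewrite /kb; case: b => /=; rewrite ?expr0 ?expr1 ?mulN1r ?mul1r; lra.
  by exists k'.
have {step2}/choice[k' Hk'] := step2.
exists (fun e => k' (thead e) [tuple of behead e]).
  move=> i; case/tupleP => b e; rewrite theadE.
  have [+ _] := Hk' b => /(_ i e).
  rewrite big_ord_recl tnth0.
  under [in X in _ -> X]eq_bigr do rewrite tnthS.
  have -> : [tuple of behead [tuple of b :: e]] = e by exact: val_inj.
  by rewrite addrA.
rewrite !big_tupleS !big_bool.
have E b : \sum_(e : n.-tuple bool)
    k' (thead [tuple of b :: e]) [tuple of behead [tuple of b :: e]]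
    = \sum_e k' b e.
  apply: eq_bigr => e _; rewrite theadE; congr (k' b _); exact: val_inj.
rewrite !E; have [_ h1] := Hk' true; have [_ h0] := Hk' false.
apply: (le_trans (lerD h1 h0)); rewrite -!big_split/=.
by apply: ler_sum => e _; have [_ _] := Hq e; rewrite /kb; lra.
Qed.

(** A two-sided bound is the sum of the one-sided bounds of a pattern and of its negation, whence
    the factor 2. *)
Lemma contraction_norm (I : Type) n (t : I -> 'I_n -> R)
    (phi : 'I_n -> R -> R) (l : R) (k : n.-tuple bool -> R) : 0 < l ->
  (forall j x y, `|phi j x - phi j y| <= l * `|x - y|) ->
  (forall j, phi j 0 = 0) -> (forall e, 0 <= k e) ->
  (forall i (e : n.-tuple bool), `|\sum_(j < n) (-1) ^+ tnth e j * t i j| <= k e) ->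
  exists k', [/\ forall i (e : n.-tuple bool),
    `|\sum_(j < n) (-1) ^+ tnth e j * phi j (t i j)| <= k' e,
    forall e, 0 <= k' e & \sum_e k' e <= 2 * l * \sum_e k e].
Proof.
move=> l0 lip phi0 k0 H.
(* [None] indexes the zero vector. It forces [k' e] to be nonnegative, so that the sum of the bounds
   for [e] and for its negation dominates each of them. *)
have [|i e|k' Hk' sk] := @contraction (option I) n (fun=> 0)
  (fun o j => if o is Some i then l * t i j else 0)
  (fun j x => phi j (l^-1 * x)) (fun e => l * k e).
- move=> j x y; apply: (le_trans (lip _ _ _)).
  rewrite -mulrBr normrM gtr0_norm ?invr_gt0//.
  by rewrite mulrA divff ?mul1r// gt_eqF.
- rewrite add0r; case: i => [i|]; last first.
    by rewrite big1 ?mulr_ge0// ?ltW// => j _; rewrite mulr0.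
  under eq_bigr do rewrite mulrCA.
  rewrite -mulr_sumr ler_pM2l//.
  exact: (le_trans (ler_norm _)).
have E i (e : n.-tuple bool) : \sum_(j < n) (-1) ^+ tnth e j * phi j (l^-1 * (l * t i j)) =
    \sum_(j < n) (-1) ^+ tnth e j * phi j (t i j).
  by apply: eq_bigr => j _; rewrite mulrA mulVf ?mul1r// gt_eqF.
have k'0 e : 0 <= k' e.
  have := Hk' None e; rewrite add0r big1// => j _.
  by rewrite mulr0 phi0 mulr0.
pose neg (e : n.-tuple bool) := [tuple of [seq ~~ b | b <- e]].
have negK : involutive neg.
  by move=> e; apply: eq_from_tnth => j; rewrite !tnth_map negbK.
exists (fun e => k' e + k' (neg e)); split => [i e|e|].
- have := Hk' (Some i) e; have := Hk' (Some i) (neg e).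
  rewrite /= !add0r !E.
  have -> : \sum_(j < n) (-1) ^+ tnth (neg e) j * phi j (t i j) =
      - \sum_(j < n) (-1) ^+ tnth e j * phi j (t i j).
    by rewrite -sumrN; apply: eq_bigr => j _; rewrite tnth_map signrN mulNr.
  by have := k'0 e; have := k'0 (neg e); rewrite ler_norml; lra.
- exact: addr_ge0.
- rewrite big_split/= [X in _ + X](reindex_inj (inv_inj negK))/=.
  under [X in _ + X]eq_bigr do rewrite negK.
  by move: sk; rewrite -mulr_sumr; lra.
Qed.

End contraction.

Section contraction_majorant.
Context d (W : measurableType d) (R : realType).

Lemma measurable_countcode d' (Z : measurableType d') (C : countType)
    (g : W -> C) (h : C -> Z) :
  (forall c, measurable [set w | g w = c]) ->
  measurable_fun setT (fun w => h (g w)).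
Proof.
move=> mg _ Y mY; rewrite setTI.
rewrite (_ : _ @^-1` _ = \bigcup_(c : C)
    (if h c \in Y then [set w | g w = c] else set0)); last first.
  apply/seteqP; split=> [w /= Yw|w [c _]].
    by exists (g w) => //; rewrite mem_set.
  by case: ifPn => // /set_mem Yc /= gwc; rewrite gwc.
apply: countable_bigcupT_measurable => // c.
by case: ifP.
Qed.

Local Open Scope ereal_scope.

Lemma ereal_cell (dl : R) (x : \bar R) k : (0 < dl)%R -> 0 <= x ->
  ((if x is r%:E then Some (Num.truncn (r / dl)) else None) = Some k) <->
  ((k%:R * dl)%:E <= x) && (x < (k.+1%:R * dl)%:E).
Proof.
move=> dl0; case: x => [r|_|//]; last by split => //=; rewrite andbF.
rewrite lee_fin => r0; rewrite lee_fin lte_fin -ler_pdivlMr// -ltr_pdivrMr//.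
rewrite -truncn_eq; last exact: divr_ge0 r0 (ltW dl0).
by split => [[/eqP]|/eqP ->].
Qed.

Variable P : probability W R.

(* The supremum over [V] of a signed sum need not be measurable, but it may be
   replaced by the supremum over [V] and over the level set of the majorants
   through [w], which is a function of countably many cells.  The contraction
   principle applies to the union of the vectors over a cell. *)
Lemma contraction_majorant (V : Type) n (t : V -> W -> 'I_n -> R)
    (phi : 'I_n -> R -> R) (l dl : R) (U : n.-tuple bool -> W -> \bar R) :
  (0 < l)%R -> (0 < dl)%R ->
  (forall j x y, `|phi j x - phi j y| <= l * `|x - y|)%R ->
  (forall j, phi j 0 = 0)%R ->
  (forall e, measurable_fun setT (U e)) -> (forall e w, 0 <= U e w) ->
  (forall v w (e : n.-tuple bool), `|\sum_(j < n) (-1) ^+ tnth e j * t v w j|%:E <= U e w) ->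
  exists U' : n.-tuple bool -> W -> \bar R, [/\
    forall e, measurable_fun setT (U' e), forall e w, 0 <= U' e w,
    forall v w (e : n.-tuple bool),
      `|\sum_(j < n) (-1) ^+ tnth e j * phi j (t v w j)|%:E <= U' e w &
    \sum_e \int[P]_w U' e w <= (2 * l)%:E * \sum_e (\int[P]_w U e w + dl%:E)].
Proof.
move=> l0 dl0 lip phi0 mU U0 HU.
pose cell (x : \bar R) := if x is r%:E then Some (Num.truncn (r / dl)) else None.
pose code w := [ffun e => cell (U e w)].
(* The right end of the cell: rounding up dominates [U] and costs at most [dl]. [None] is the cell
   of [+oo]; comparisons of [k] with [U] always assume [finc]. *)
pose k (c : {ffun n.-tuple bool -> option nat}) e : R :=
  ((odflt 0%N (c e)).+1%:R * dl)%R.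
pose finc (c : {ffun n.-tuple bool -> option nat}) := forall e, c e <> None.
have kU w e : finc (code w) -> U e w <= (k (code w) e)%:E /\
    (k (code w) e)%:E <= U e w + dl%:E.
  move=> /(_ e); rewrite /k ffunE; case E : (cell _) => [m|]// _.
  have /(ereal_cell m dl0 (U0 e w))/andP[h1 h2] := E.
  split; first exact: ltW.
  by rewrite /= -natr1 mulrDl mul1r EFinD leeD2r.
have step (c : {ffun n.-tuple bool -> option nat}) :
    exists k' : n.-tuple bool -> R, [/\
      forall v w (e : n.-tuple bool), finc c -> code w = c ->
       (`|\sum_(j < n) (-1) ^+ tnth e j * phi j (t v w j)| <= k' e)%R,
      forall e, (0 <= k' e)%R & (\sum_e k' e <= 2 * l * \sum_e k c e)%R].
  have [|[[v w] [fc cw]] e|k' [k1 k2 k3]] := @contraction_norm R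
    {p : V * W | finc c /\ code p.2 = c} n (fun p => t (sval p).1 (sval p).2)
    phi l (k c) l0 lip phi0.
  - by move=> e; rewrite mulr_ge0// ltW.
  - rewrite /= -lee_fin (le_trans (HU _ _ _))//.
    by have [] := kU w e; rewrite /= in cw; rewrite cw.
  - exists k'; split => // v w e fc cw.
    exact: (k1 (exist _ (v, w) (conj fc cw)) e).
have {step}/choice[K HK] := step.
(* If one pattern has an infinite bound, all patterns get [+oo]; the right-hand side of the integral
   comparison is infinite there too. *)
pose H e c := if `[< finc c >] then (K c e)%:E else +oo.
have H0 e c : 0 <= H e c.
  by rewrite /H; case: ifP => // _; rewrite lee_fin; have [_ ->] := HK c.
exists (fun e w => H e (code w)).
have mH e : measurable_fun setT (fun w => H e (code w)).
  apply: measurable_countcode => c.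
  rewrite (_ : mkset _ = \bigcap_(e in [set: n.-tuple bool])
      [set w | cell (U e w) = c e]); last first.
    apply/seteqP; split=> [w <- e' _ /=|w cw /=]; first by rewrite ffunE.
    by apply/ffunP => e'; rewrite ffunE cw.
  apply: fin_bigcap_measurable => // e' _; case: (c e') => [m|].
    rewrite (_ : mkset _ = [set w | (m%:R * dl)%:E <= U e' w] `&`
        [set w | U e' w < (m.+1%:R * dl)%:E]); last first.
      apply/seteqP; split => w /=.
        by move/(ereal_cell m dl0 (U0 e' w))/andP.
      by move/andP/(ereal_cell m dl0 (U0 e' w)).
    apply: measurableI.
      by rewrite -[X in measurable X]setTI; apply: measurable_lee.
    by rewrite -[X in measurable X]setTI; apply: measurable_lte.
  rewrite (_ : mkset _ = [set w | +oo <= U e' w]); last first.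
    apply/seteqP; split => w /=; have := U0 e' w.
      by rewrite /cell; case: (U e' w).
    by rewrite leye_eq => _ /eqP ->.
  by rewrite -[X in measurable X]setTI; apply: measurable_lee.
split=> //.
- move=> v w e; rewrite /H; case: asboolP => [fc|_]; last by rewrite leey.
  by rewrite lee_fin; have [+ _ _] := HK (code w); exact.
have dlE : \sum_e (\int[P]_w U e w + dl%:E) =
    \int[P]_w \sum_e (U e w + dl%:E).
  rewrite ge0_integral_sum//.
  - apply: eq_bigr => e _; rewrite ge0_integralD//.
      by rewrite integral_cst1.
    by rewrite lee_fin ltW.
  - by move=> e; apply: emeasurable_funD.
  - by move=> e w _; rewrite adde_ge0// lee_fin ltW.
rewrite dlE -ge0_integral_sum// -ge0_integralZl//; last 3 first.
- by apply: emeasurable_sum => e; apply: emeasurable_funD.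
- by move=> w _; apply: sume_ge0 => e _; rewrite adde_ge0// lee_fin ltW.
- by rewrite lee_fin mulr_ge0// ltW.
apply: ge0_le_integral => //.
- by move=> w _; apply: sume_ge0.
- by apply: emeasurable_sum.
- apply: measurable_funeM.
  by apply: emeasurable_sum => e; apply: emeasurable_funD.
move=> w _; have [fc|] := pselect (finc (code w)).
  rewrite /H; under eq_bigr do rewrite asboolT//.
  rewrite sumEFin; have [_ _ h] := HK (code w).
  apply: (@le_trans _ _ (2 * l * \sum_e k (code w) e)%:E); first by rewrite lee_fin.
  rewrite EFinM lee_pmul2l//; last by rewrite lte_fin mulr_gt0.
  by rewrite -sumEFin; apply: lee_sum => e _; have [] := kU w e fc.
move=> /existsNP[e /contrapT]; rewrite ffunE => Ue.
have {}Ue : U e w = +oo.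
  by have := U0 e w; move: Ue; rewrite /cell; case: (U e w).
rewrite [X in _ * X](bigD1 e)//= Ue addye ?addye ?gt0_muley ?leey//.
  by rewrite lte_fin mulr_gt0.
rewrite gt_eqF// (lt_le_trans ltNy0)//.
by apply: sume_ge0 => i _; rewrite adde_ge0// lee_fin ltW.
Qed.

End contraction_majorant.

Section Rintegral_prob.
Context d (W : measurableType d) (R : realType) (Q : probability W R).
Implicit Type f : W -> R.

Lemma prob_integrable_cst (c : R) : Q.-integrable setT (EFin \o cst c).
Proof.
apply/integrableP; split; first exact/measurable_EFinP.
by rewrite (eq_integral (cst `|c|%:E))// integral_cst1 ltry.
Qed.

Lemma Rintegral_cst1 (c : R) : \int[Q]_w c = c.
Proof. by rewrite Rintegral_cst// [X in fine X]probability_setT mulr1. Qed.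

Lemma integrable_lin (I : Type) (s : seq I) (a : I -> R) (f : I -> W -> R) :
  (forall i, Q.-integrable setT (EFin \o f i)) ->
  Q.-integrable setT (EFin \o (fun w => \sum_(i <- s) a i * f i w)).
Proof.
move=> fi; rewrite (_ : _ \o _ = fun w => (\sum_(i <- s) (a i)%:E * (f i w)%:E)%E).
  by apply: integrable_sum => // i _; apply: integrableZl => //; exact: fi.
by apply/funext => w /=; rewrite sumEFin.
Qed.

Lemma Rintegral_lin (I : Type) (s : seq I) (a : I -> R) (f : I -> W -> R) :
  (forall i, Q.-integrable setT (EFin \o f i)) ->
  \int[Q]_w (\sum_(i <- s) a i * f i w) = \sum_(i <- s) a i * \int[Q]_w f i w.
Proof.
move=> fi; elim: s => [|i s IH].
  by under eq_Rintegral do rewrite big_nil; rewrite Rintegral_cst1 big_nil.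
under eq_Rintegral do rewrite big_cons.
rewrite RintegralD//.
- by rewrite big_cons RintegralZl// ?IH//; exact: fi.
- rewrite (_ : _ \o _ = fun w => ((a i)%:E * (f i w)%:E)%E)//.
  by apply: integrableZl => //; exact: fi.
- exact: integrable_lin.
Qed.

Lemma EFin_norm_Rintegral_le f : Q.-integrable setT (EFin \o f) ->
  (`|\int[Q]_w f w|%:E <= \int[Q]_w `|f w|%:E)%E.
Proof.
move=> fi; rewrite EFin_normr_Rintegral//.
have /integrableP[mf _] := fi.
exact: (@le_abse_integral _ _ _ Q setT (EFin \o f)).
Qed.

End Rintegral_prob.

(** * Symmetrization by a ghost sample, block by block *)

Section symmetrization.
Context d (T : measurableType d) (R : realType) (P : probability T R).
Variables (N n : nat) (blk : 'I_N -> 'I_n) (V : Type).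
Variable q : V -> 'I_n -> N.-tuple T -> R.
Variable U : n.-tuple bool -> N.-tuple T -> \bar R.
Hypothesis loc_q : forall v j D D',
  (forall i, blk i = j -> tnth D i = tnth D' i) -> q v j D = q v j D'.
Hypothesis int_q : forall v j, (iid P N).-integrable setT (EFin \o q v j).
Hypothesis mU : forall e, measurable_fun setT (U e).
Hypothesis U0 : forall e D, (0 <= U e D)%E.
Hypothesis HU : forall v D (e : n.-tuple bool),
  (`|\sum_(j < n) (-1) ^+ tnth e j * q v j D|%:E <= U e D)%E.

Let Q := iid P N.

(* For every sign pattern, swapping the blocks of the sample and of a ghost
   sample along a uniformly random mask produces uniformly random signs. *)
Lemma symmetrization_majorant (s : n.-tuple bool) :
  exists G : N.-tuple T -> \bar R, [/\ measurable_fun setT G,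
    forall D, (0 <= G D)%E,
    forall v D, (`|\sum_(j < n) (-1) ^+ tnth s j *
       (q v j D - \int[Q]_w q v j w)|%:E <= G D)%E &
    (\int[Q]_D G D <=
       (2 * 2^-1 ^+ n)%:E * \sum_(e : n.-tuple bool) \int[Q]_D U e D)%E].
Proof.
pose mk (tau : n.-tuple bool) (i : 'I_N) := tnth tau (blk i).
(* For fixed [s], swapping along [tau] changes the signs into [st tau]. As [st] is an involution,
   averaging over masks is averaging over all sign patterns. *)
pose st (tau : n.-tuple bool) : n.-tuple bool :=
  [tuple tnth s j (+) ~~ tnth tau j | j < n].
have stK : involutive st.
  move=> tau; apply: eq_from_tnth => j; rewrite !tnth_mktuple.
  by case: (tnth s j); case: (tnth tau j).
pose S tau D D' := (U (st tau) (mix (mk tau) D D') +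
                    U (st tau) (mix (mk tau) D' D))%E.
have S0 tau D D' : (0 <= S tau D D')%E by rewrite adde_ge0.
have mS tau : measurable_fun setT (fun p => S tau p.1 p.2).
  apply: emeasurable_funD; apply: measurableT_comp => //;
    exact: measurable_mix.
have qd v tau D D' : (`|\sum_(j < n) (-1) ^+ tnth s j *
    (q v j D - q v j D')|%:E <= S tau D D')%E.
  set x := \sum_(j < n) _.
  pose y (E : N.-tuple T) := \sum_(j < n) (-1) ^+ tnth (st tau) j * q v j E.
  have -> : x = y (mix (mk tau) D D') - y (mix (mk tau) D' D).
    rewrite /y -sumrB; apply: eq_bigr => j _; rewrite tnth_mktuple -mulrBr.
    case tj : (tnth tau j).
      rewrite addbF; congr (_ * (_ - _)); apply: loc_q => i bij;
        by rewrite tnth_mix /mk bij tj.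
    rewrite addbT signrN mulNr -mulrN opprB.
    congr (_ * (_ - _)); apply: loc_q => i bij; by rewrite tnth_mix /mk bij tj.
  apply: (le_trans _ (leeD (HU v _ _) (HU v _ _))).
  by rewrite -EFinD lee_fin ler_normB.
pose G D := ((2^-1 ^+ n)%:E * \sum_(tau : n.-tuple bool) \int[Q]_D' S tau D D')%E.
have h0 : 0 <= (2^-1 ^+ n : R) by rewrite exprn_ge0.
have mI tau : measurable_fun setT (fun D => \int[Q]_D' S tau D D')%E.
  exact: (@measurable_partial_integral _ _ _ _ _ Q (fun p => S tau p.1 p.2)).
exists G; split.
- by apply: measurable_funeM; apply: emeasurable_sum.
- move=> D; rewrite mule_ge0 ?lee_fin// sume_ge0// => tau _.
  exact: integral_ge0.
- move=> v D.
  set x := \sum_(j < n) _.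
  have xS tau : (`|x|%:E <= \int[Q]_D' S tau D D')%E.
    pose X D' := \sum_(j < n) (-1) ^+ tnth s j * (q v j D - q v j D').
    have XE : X = fun D' => \sum_(j < n) (-1) ^+ tnth s j * q v j D -
        \sum_(j < n) (-1) ^+ tnth s j * q v j D'.
      apply/funext => D'; rewrite /X -sumrB.
      by apply: eq_bigr => j _; rewrite mulrBr.
    have il : Q.-integrable setT
        (EFin \o fun D' => \sum_(j < n) (-1) ^+ tnth s j * q v j D').
      by apply: integrable_lin.
    have iX : Q.-integrable setT (EFin \o X).
      rewrite XE; set c := \sum_(j < n) _.
      exact: (integrableB measurableT (prob_integrable_cst Q c) il).
    have -> : x = (\int[Q]_w X w)%R.
      rewrite XE RintegralB//; last exact: prob_integrable_cst.
      rewrite Rintegral_cst1 Rintegral_lin// /x -sumrB.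
      by apply: eq_bigr => j _; rewrite mulrBr.
    apply: (le_trans (EFin_norm_Rintegral_le iX)).
    apply: ge0_le_integral => //.
    + apply/measurable_EFinP; apply: measurableT_comp => //.
      by apply/measurable_EFinP; exact: (measurable_int Q).
    + exact: (@measurable_pairl _ _ _ _ _ (fun p => S tau p.1 p.2)).
    + by move=> D' _; exact: qd.
  apply: (@le_trans _ _ ((2^-1 ^+ n)%:E * \sum_(tau : n.-tuple bool) `|x|%:E)%E).
    rewrite sumEFin sumr_const card_tuple card_bool -EFinM lee_fin.
    rewrite -[`|x| *+ _]mulr_natl mulrA natrX -exprMn mulVf// expr1n mul1r.
    exact: lexx.
  by apply: lee_wpmul2l; [rewrite lee_fin|apply: lee_sum].
- rewrite ge0_integralZl//; last 2 first.
  + by apply: emeasurable_sum.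
  + by move=> D _; apply: sume_ge0 => tau _; exact: integral_ge0.
  rewrite ge0_integral_sum//; last first.
    by move=> tau D _; exact: integral_ge0.
  rewrite mulrC EFinM -muleA; apply: lee_wpmul2l; first by rewrite lee_fin.
  rewrite ge0_sume_distrr; last by move=> e _; exact: integral_ge0.
  rewrite [leRHS](reindex_inj (inv_inj stK))/=.
  apply: lee_sum => tau _.
  have m1 : measurable_fun setT (fun p : N.-tuple T * N.-tuple T =>
      U (st tau) (mix (mk tau) p.1 p.2)).
    by apply: measurableT_comp => //; exact: measurable_mix.
  have m2 : measurable_fun setT (fun p : N.-tuple T * N.-tuple T =>
      U (st tau) (mix (mk tau) p.2 p.1)).
    by apply: measurableT_comp => //; exact: measurable_mix.
  rewrite (_ : 2%:E = 1 + 1)%E// ge0_muleDl// !mul1e.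
  rewrite (eq_integral (fun D => \int[Q]_D' U (st tau) (mix (mk tau) D D')
      + \int[Q]_D' U (st tau) (mix (mk tau) D' D))%E); last first.
    move=> D _; rewrite ge0_integralD//.
      exact: (@measurable_pairl _ _ _ _ _ (fun p => U _ (mix _ p.1 p.2))).
    exact: (@measurable_pairl _ _ _ _ _ (fun p => U _ (mix _ p.2 p.1))).
  rewrite ge0_integralD//.
  + rewrite integral_mix//.
    rewrite (@integralC _ _ _ _ _ Q Q (fun p => U _ (mix _ p.2 p.1)))//=.
    by rewrite integral_mix.
  + by move=> D _; exact: integral_ge0.
  + exact: (@measurable_partial_integral _ _ _ _ _ Q (fun p => U _ (mix _ p.1 p.2))).
  + by move=> D _; exact: integral_ge0.
  + exact: (@measurable_partial_integral _ _ _ _ _ Q (fun p => U _ (mix _ p.2 p.1))).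
Qed.

End symmetrization.

(** * Exponential moments and concentration by bounded differences *)

Section exponential_moment.
Variable R : realType.

Lemma expR_le_quad (x : R) : `|x| <= 4^-1 -> expR x <= 1 + x + x ^+ 2.
Proof.
rewrite ler_norml => /andP[xl xu].
have inv (y : R) : y < 1 -> expR y <= (1 - y)^-1.
  move=> y1; have h := expR_ge1Dx (- y); rewrite expRN in h.
  by rewrite -[expR y]invrK lef_pV2 ?posrE ?invr_gt0 ?expR_gt0// subr_gt0.
have [x0|x0] := lerP x 0.
  apply: (le_trans (inv x _)); first by lra.
  rewrite -div1r ler_pdivrMr; last by lra.
  have : 0 <= (- x) ^+ 3 by rewrite exprn_ge0//; lra.
  by rewrite !exprS expr0; lra.
(* Halving the argument makes [expR y <= 1/(1 - y)] sharp enough: [(1 - x/2)^2 (1 + x + x^2) - 1 =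
   x^2/4 (1 - 3x + x^2)], nonnegative for [x <= 1/4]. *)
have -> : expR x = expR (x / 2) ^+ 2 by rewrite expr2 -expRD; congr expR; lra.
have h2 : x / 2 < 1 by lra.
apply: (le_trans (y := ((1 - x / 2)^-1) ^+ 2)).
  by rewrite lerXn2r ?nnegrE ?expR_ge0 ?invr_ge0 ?subr_ge0 ?(ltW h2)// inv.
rewrite exprVn -div1r ler_pdivrMr; last by rewrite exprn_gt0//; lra.
have : 0 <= x ^+ 2 / 4 * (1 - 3 * x + x ^+ 2).
  by apply: mulr_ge0; [rewrite divr_ge0 ?sqr_ge0|have := sqr_ge0 x; lra].
by rewrite !exprS !expr0; lra.
Qed.

(** A Hoeffding bound with a crude constant. Since [b] stays within 2 of its mean [a], the exponent
    [l (b - a)] is at most [1/4] in absolute value and the quadratic bound applies; the linear term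
    integrates to zero and [(b - a)^2 <= 4] yields [4 l^2]. *)
Lemma expectation_expR_le d (W : measurableType d) (Q : probability W R)
    (b : W -> R) (m l : R) :
  measurable_fun setT b -> (forall w, m <= b w <= m + 2) -> 0 <= l <= 8^-1 ->
  (\int[Q]_w (expR (l * b w))%:E <=
   (expR (l * (\int[Q]_w b w)%R + 4 * l ^+ 2))%:E)%E.
Proof.
move=> mb bm /andP[l0 l8].
have ib : Q.-integrable setT (EFin \o b).
  apply: (@le_integrable _ _ _ _ _ _ _ (EFin \o cst (`|m| + 2)%R)) => //.
  - exact/measurable_EFinP.
  - move=> w _ /=; rewrite lee_fin [leRHS]ger0_norm ?addr_ge0//.
    have := bm w; have := ler_norm m; have := ler_norm (- m).
    by rewrite normrN ler_norml; lra.
  - exact: prob_integrable_cst.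
set a := (\int[Q]_w b w)%R.
have mu_itv : m <= a <= m + 2.
  have -> : m = (\int[Q]_w (cst m w))%R by rewrite Rintegral_cst1.
  have -> : (\int[Q]_w (cst m w) + 2 = \int[Q]_w (cst (m + 2) w))%R.
    by rewrite !Rintegral_cst1.
  apply/andP; split; apply: le_Rintegral => //; try exact: prob_integrable_cst.
    by move=> w _; have /andP[] := bm w.
  by move=> w _; have /andP[] := bm w.
have key w : expR (l * b w) <=
    expR (l * a) * (1 + 4 * l ^+ 2 - l * a) + (expR (l * a) * l) * b w.
  have -> : l * b w = l * a + l * (b w - a) by lra.
  rewrite expRD; have := expR_gt0 (l * a); set E := expR (l * a) => E0.
  have := bm w => bmw.
  have ab : `|b w - a| <= 2 by rewrite ler_norml; lra.
  have h : `|l * (b w - a)| <= 4^-1.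
    by rewrite normrM (ger0_norm l0); nra.
  have := expR_le_quad h; rewrite exprMn => {}h.
  have : (b w - a) ^+ 2 <= 4.
    rewrite -real_normK ?num_real//.
    by rewrite (_ : 4 = 2 ^+ 2) ?lerXn2r ?nnegrE// expr2; lra.
  move=> h4; have l2 := sqr_ge0 l.
  have h5 : l ^+ 2 * (b w - a) ^+ 2 <= l ^+ 2 * 4 by rewrite ler_wpM2l.
  have h6 : expR (l * (b w - a)) <= 1 + l * (b w - a) + l ^+ 2 * 4 by lra.
  have := ler_wpM2l (ltW E0) h6; lra.
apply: (@le_trans _ _ (\int[Q]_w (expR (l * a) * (1 + 4 * l ^+ 2 - l * a) +
    (expR (l * a) * l) * b w)%:E)%E).
  apply: ge0_le_integral => //.
  - by apply/measurable_EFinP; apply: measurableT_comp => //; exact: measurable_funM.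
  - apply/measurable_EFinP; apply: measurable_funD => //.
    exact: measurable_funM.
  - by move=> w _; rewrite lee_fin.
set c := (expR (l * a) * (1 + 4 * l ^+ 2 - l * a)).
have ib2 : Q.-integrable setT (EFin \o (fun w => (expR (l * a) * l) * b w)).
  exact: (integrableZl _ _ ib).
have := RintegralD measurableT (prob_integrable_cst Q c) ib2.
rewrite Rintegral_cst1 RintegralZl// -/a => h.
have fin : (\int[Q]_w (c + (expR (l * a) * l) * b w)%:E)%E \is a fin_num.
  apply: integrable_fin_num => //.
  exact: (integrableD measurableT (prob_integrable_cst Q c) ib2).
rewrite -(fineK fin) lee_fin.
rewrite [leLHS]h /c expRD; have := expR_gt0 (l * a); set E := expR (l * a) => E0.
rewrite [leLHS](_ : _ = E * (1 + 4 * l ^+ 2)); last by ring.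
by rewrite ler_pM2l// expR_ge1Dx.
Qed.

End exponential_moment.

Section bounded_differences.
Context d (T : measurableType d) (R : realType) (P : probability T R).
Variables (N n : nat) (blk : 'I_N -> 'I_n) (M : nat) (Phi : N.-tuple T -> R).
Hypothesis bd : forall j D D',
  (forall i, blk i != j -> tnth D i = tnth D' i) -> Phi D <= Phi D' + 1.

Let Q := iid P N.
Let one j (i : 'I_N) := blk i == j.
Let below k (i : 'I_N) := (blk i < k)%N.

(* [m] is the integer part of the essential infimum of [g] over the block [j]:
   some value of the block gives [g < m + 1], so that [Phi <= m + 2] on the
   whole fibre. *)
Lemma clamp (g : N.-tuple T -> R) (j : 'I_n) :
  measurable_fun setT g -> (forall D, Phi D <= g D) ->
  (forall D, 0 <= g D <= M%:R) ->
  exists g1 m : N.-tuple T -> R, [/\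
     measurable_fun setT g1 /\ measurable_fun setT m, forall D, Phi D <= g1 D,
     forall D, [/\ 0 <= m D <= g1 D, g1 D <= m D + 2 & g1 D <= M%:R],
     forall D D', (forall i, blk i != j -> tnth D i = tnth D' i) -> m D = m D' &
     forall D, (\int[Q]_D' (g1 (mix (one j) D' D))%:E <=
                \int[Q]_D' (g (mix (one j) D' D))%:E)%E].
Proof.
move=> mg Hg g0.
pose lo (l : nat) (D D' : N.-tuple T) : R :=
  if g (mix (one j) D' D) < l.+1%:R then 1 else 0.
have lo0 l D D' : 0 <= lo l D D' by rewrite /lo; case: ifP.
have mgm : measurable_fun setT (fun p => g (mix (one j) p.2 p.1)).
  by apply: measurableT_comp => //; exact: measurable_mix.
have mlo l : measurable_fun setT (fun p => (lo l p.1 p.2)%:E).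
  rewrite /lo; apply/measurable_EFinP; apply: measurable_fun_ifT => //.
  by apply: measurable_fun_ltr => //; exact: mgm.
pose a l D := (\int[Q]_D' (lo l D D')%:E)%E.
have ma l : measurable_fun setT (a l).
  apply: (@measurable_partial_integral _ _ _ _ _ Q (fun p => (lo l p.1 p.2)%:E)).
    exact: mlo.
  by move=> p; rewrite lee_fin.
(* [a l D] is the conditional probability of [g < l + 1] given the coordinates outside block [j].
   Its zeros in [l] form an initial segment, so counting them finds the integer part, capped at
   [M]. *)
pose m D : R := \sum_(l < M) (if a l D == 0%E then 1 else 0).
have mm : measurable_fun setT m.
  apply: measurable_sum => l; apply: measurable_fun_ifT => //.
  by apply: measurable_fun_eqe.
have alo l D : a l D != 0%E -> exists D', g (mix (one j) D' D) < l.+1%:R.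
  move=> al; apply: contrapT => /forallNP h; move/eqP: al; apply.
  rewrite /a; under eq_integral.
    move=> D' _; rewrite /lo; have /negP/negbTE -> := h D'.
    over.
  by rewrite integral0.
have amono l l' D : (l <= l')%N -> a l' D = 0%E -> a l D = 0%E.
  move=> ll' a0; apply/eqP; rewrite eq_le; apply/andP; split; last first.
    by apply: integral_ge0 => D' _; rewrite lee_fin.
  rewrite -a0; apply: ge0_le_integral => //.
  - by move=> D' _; rewrite lee_fin.
  - exact: (@measurable_pairl _ _ _ _ _ (fun p => (lo l p.1 p.2)%:E)).
  - exact: (@measurable_pairl _ _ _ _ _ (fun p => (lo l' p.1 p.2)%:E)).
  - move=> D' _; rewrite lee_fin /lo; case: ifP => h; last by case: ifP.
    by rewrite ifT// (lt_le_trans h)// ler_nat.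
have mind D D' : (forall i, blk i != j -> tnth D i = tnth D' i) -> m D = m D'.
  move=> DD'; apply: eq_bigr => l _; rewrite /a.
  suff e D'' : mix (one j) D'' D = mix (one j) D'' D'.
    by rewrite (_ : lo l D = lo l D')//; apply/funext => D''; rewrite /lo e.
  apply: eq_from_tnth => i; rewrite !tnth_mix /one.
  by case: ifPn => // /DD'.
have card D : exists k : nat, [/\ m D = k%:R, (k <= M)%N,
    (k < M)%N -> a k D != 0%E & (0 < k)%N -> a k.-1 D = 0%E].
  pose s := [seq l <- iota 0 M | a l D == 0%E].
  have mE : m D = (size s)%:R.
    rewrite /m -(big_mkord xpredT (fun l => if a l D == 0%E then 1 else 0)).
    rewrite -big_mkcond/= size_filter -sum1_count natr_sum.
    by rewrite /index_iota subn0.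
  exists (size s); rewrite mE; split => //.
  - by rewrite size_filter -[X in (_ <= X)%N](size_iota 0 M) count_size.
  - move=> sM; apply/negP => /eqP ask.
    have : (size (iota 0 (size s).+1) <= size s)%N.
      apply: uniq_leq_size; first exact: iota_uniq.
      move=> l; rewrite mem_iota add0n ltnS /= => ls.
      rewrite mem_filter mem_iota add0n/= (leq_ltn_trans ls)// andbT.
      by apply/eqP; exact: amono ls ask.
    by rewrite size_iota ltnn.
  - move=> s0; apply: contrapT => ask.
    have : (size s <= size (iota 0 (size s).-1))%N.
      apply: uniq_leq_size; first by rewrite filter_uniq// iota_uniq.
      move=> l; rewrite mem_filter !mem_iota !add0n/= => /andP[/eqP al _].
      by rewrite ltnNge; apply/negP => h; apply: ask; exact: amono h al.
    by rewrite size_iota -ltnS prednK// ltnn.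
(* Cutting at [m + 2] keeps a majorant because [Phi] never exceeds that value; raising to [m] does
   not increase the conditional integral because [g >= m] almost surely on the fibre. *)
pose g1 D := Num.max (Num.min (g D) (m D + 2)) (m D).
have mgmD D : measurable_fun setT (fun D' => (g (mix (one j) D' D))%:E).
  apply: (@measurable_pairl _ _ _ _ _ (fun p => (g (mix (one j) p.2 p.1))%:E)).
  exact/measurable_EFinP.
have mg1 : measurable_fun setT g1.
  apply: measurable_maxr => //; apply: measurable_minr => //.
  exact: measurable_funD.
have mmix D D' : m (mix (one j) D' D) = m D.
  by apply: mind => i /negbTE ij; rewrite tnth_mix /one ij.
exists g1, m; split => //.
- move=> D; have [k [mk kM h1 h2]] := card D.
  have : Phi D <= m D + 2.
    have := kM; rewrite leq_eqVlt => /predU1P[kE|{}kM].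
      have /andP[_] := g0 D; have := Hg D; rewrite mk kE.
      by move=> *; lra.
    have [D' gD'] := alo _ _ (h1 kM).
    have : Phi D <= Phi (mix (one j) D' D) + 1.
      apply: (@bd j) => i /negbTE ij; by rewrite tnth_mix /one ij.
    have := Hg (mix (one j) D' D); rewrite mk.
    by move: gD'; rewrite -natr1; lra.
  by rewrite /g1 le_max le_min (Hg D) => ->.
- move=> D; have [k [mk kM _ _]] := card D.
  have m0 : 0 <= m D by rewrite mk.
  have mM : m D <= M%:R by rewrite mk ler_nat.
  have /andP[g0D gM] := g0 D.
  rewrite /g1; split.
  + by rewrite m0 le_max lexx orbT.
  + by rewrite ge_max ge_min lexx orbT/=; lra.
  + by rewrite ge_max mM andbT ge_min gM.
- move=> D; have [k [mk kM _ h2]] := card D.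
  have [k0|k0] := posnP k.
    apply: ge0_le_integral => //.
    + move=> D' _; rewrite lee_fin /g1 mmix mk k0 le_max lexx orbT//.
    + apply/measurable_EFinP; apply: measurableT_comp => //.
      by apply: measurable_mix.
    + move=> D' _; rewrite lee_fin /g1 mmix mk k0.
      have /andP[gg _] := g0 (mix (one j) D' D).
      by rewrite ge_max gg andbT ge_min lexx.
  (* [g1] exceeds [g] only where [g < k]; there [M] pays for the excess, and the indicator of this
     event has integral [a k.-1 D = 0]. *)
  apply: (@le_trans _ _ (\int[Q]_D' ((g (mix (one j) D' D))%:E
       + M%:R%:E * (lo k.-1 D D')%:E))%E).
    apply: ge0_le_integral => //.
    + move=> D' _; rewrite lee_fin /g1 mmix mk le_max ler0n orbT//.
    + apply/measurable_EFinP; apply: measurableT_comp => //.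
      by apply: measurable_mix.
    + apply: emeasurable_funD => //; apply: measurable_funeM.
      exact: (@measurable_pairl _ _ _ _ _ (fun p => (lo k.-1 p.1 p.2)%:E)).
    + move=> D' _; rewrite -EFinM -EFinD lee_fin /g1 mmix mk /lo prednK//.
      have /andP[gg _] := g0 (mix (one j) D' D).
      have kMr : k%:R <= M%:R :> R by rewrite ler_nat.
      case: ltP => h; rewrite ge_max ge_min; first by apply/andP; split; lra.
      by apply/andP; split; lra.
  rewrite ge0_integralD//; last 3 first.
  + by move=> D' _; rewrite lee_fin; have /andP[] := g0 (mix (one j) D' D).
  + by move=> D' _; rewrite -EFinM lee_fin mulr_ge0.
  + apply: measurable_funeM.
    exact: (@measurable_pairl _ _ _ _ _ (fun p => (lo k.-1 p.1 p.2)%:E)).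
  rewrite ge0_integralZl//; last 2 first.
  + exact: (@measurable_pairl _ _ _ _ _ (fun p => (lo k.-1 p.1 p.2)%:E)).
  + by move=> D' _; rewrite lee_fin.
  by rewrite -/(a k.-1 D) h2// mule0 adde0.
Qed.

Lemma bounded_integral (g : N.-tuple T -> R) (f : N.-tuple T -> N.-tuple T) :
  measurable_fun setT g -> measurable_fun setT f ->
  (forall D, 0 <= g D <= M%:R) ->
  (0 <= \int[Q]_D (g (f D))%:E <= M%:R%:E)%E.
Proof.
move=> mg mf g0; apply/andP; split.
  by apply: integral_ge0 => D _; rewrite lee_fin; have /andP[] := g0 (f D).
rewrite -[leRHS](integral_cst1 Q); apply: ge0_le_integral => //.
- by move=> D _; rewrite lee_fin; have /andP[] := g0 (f D).
- by apply/measurable_EFinP; apply: measurableT_comp.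
- by move=> D _; rewrite lee_fin; have /andP[] := g0 (f D).
Qed.

(** McDiarmid's exponential bound, each block costing [4 l^2]. [H] is built as the exponential of
    [g] clamped along all blocks below [k]: [Phi] may not be integrable, and [g] itself may vary too
    much within a block. *)
Lemma exponential_majorant (l : R) (k : nat) (g : N.-tuple T -> R) :
  (k <= n)%N -> 0 <= l <= 8^-1 ->
  measurable_fun setT g -> (forall D, Phi D <= g D) ->
  (forall D, 0 <= g D <= M%:R) ->
  exists H : N.-tuple T -> R, [/\ measurable_fun setT H,
    forall D, expR (l * Phi D) <= H D &
    forall D, (\int[Q]_D' (H (mix (below k) D' D))%:E <=
      (expR (l * (\int[Q]_D' g (mix (below k) D' D))%R
        + 4 * k%:R * l ^+ 2))%:E)%E].
Proof.
move=> + l01; elim: k g => [|k IH] g kn mg Hg g0.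
  exists (fun D => expR (l * g D)); split.
  - by apply: measurableT_comp => //; exact: measurable_funM.
  - by move=> D; rewrite ler_expR ler_wpM2l//; have /andP[] := l01.
  - move=> D; have e D' : mix (below 0) D' D = D.
      by apply: eq_from_tnth => i; rewrite tnth_mix.
    under eq_integral do rewrite e.
    under eq_Rintegral do rewrite e.
    by rewrite integral_cst1 Rintegral_cst1 mulr0 mul0r addr0.
pose j := Ordinal kn.
have [g1 [m [[mg1 mm] Hg1 g1m mind gg1]]] := @clamp g j mg Hg g0.
have g10 D : 0 <= g1 D <= M%:R.
  by have [/andP[m0 mg1D] _ ->] := g1m D; rewrite andbT (le_trans m0).
have [H [mH HPhi HI]] := IH g1 (ltnW kn) mg1 Hg1 g10.
exists H; split => // D.
have H0 E : 0 <= H E by rewrite (le_trans _ (HPhi E))// expR_ge0.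
pose b D := (\int[Q]_D' g1 (mix (below k) D' D))%R.
have mixin mk (D0 : N.-tuple T) : measurable_fun setT (fun E : N.-tuple T => mix mk E D0).
  by apply: measurable_mix.
have bE D0 : (b D0)%:E = (\int[Q]_D' (g1 (mix (below k) D' D0))%:E)%E.
  have /andP[h1 h2] := bounded_integral mg1 (mixin (below k) D0) g10.
  by rewrite /b /Rintegral fineK// ge0_fin_numE// (le_lt_trans h2)// ltry.
have mgp : measurable_fun setT (fun p => (g1 (mix (below k) p.2 p.1))%:E).
  by apply/measurable_EFinP; apply: measurableT_comp => //; exact: measurable_mix.
have mb : measurable_fun setT b.
  apply/measurable_EFinP; rewrite (_ : _ \o _ = fun D0 =>
      (\int[Q]_D' (g1 (mix (below k) D' D0))%:E)%E); last first.
    by apply/funext => D0 /=; rewrite bE.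
  apply: (@measurable_partial_integral _ _ _ _ _ Q
    (fun p => (g1 (mix (below k) p.2 p.1))%:E)) => //.
  by move=> p; rewrite lee_fin; have /andP[] := g10 (mix (below k) p.2 p.1).
pose up := fun i => ~~ below k i.
(* Redrawing the blocks up to [k] means redrawing block [k] from [D2] and the lower ones from [D1].
   The sample doing both at once interleaves [D1] and [D2], so [integral_mix] splits the integral in
   two. *)
have mixup (D2 D1 : N.-tuple T) : mix (below k.+1) (mix up D2 D1) D =
    mix (below k) D1 (mix (one j) D2 D).
  apply: eq_from_tnth => i; rewrite !tnth_mix /up /below /one.
  rewrite ltnS leq_eqVlt -(inj_eq val_inj (blk i) j) /=.
  by case: ltngtP.
have key (f : N.-tuple T -> R) : measurable_fun setT f -> (forall E, 0 <= f E) ->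
    (\int[Q]_D' (f (mix (below k.+1) D' D))%:E =
     \int[Q]_D2 \int[Q]_D1 (f (mix (below k) D1 (mix (one j) D2 D)))%:E)%E.
  move=> mf f0.
  rewrite -(@integral_mix _ _ _ P _ up (fun E => (f (mix (below k.+1) E D))%:E)).
  - apply: eq_integral => D2 _; apply: eq_integral => D1 _.
    by rewrite mixup.
  - by apply/measurable_EFinP; apply: measurableT_comp.
  - by move=> E; rewrite lee_fin.
rewrite key//.
pose M0 := (\int[Q]_D' m (mix (below k) D' D))%R.
have m0M D0 : 0 <= m D0 <= M%:R.
  by have [/andP[m0 mg1D] _ gM] := g1m D0; rewrite m0 (le_trans mg1D).
have intb (f : N.-tuple T -> R) mk D0 : measurable_fun setT f ->
    (forall E, 0 <= f E <= M%:R) ->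
    Q.-integrable setT (EFin \o (fun D' => f (mix mk D' D0))).
  move=> mf f0; apply/integrableP; split.
    by apply/measurable_EFinP; apply: measurableT_comp.
  have /andP[_ h] := bounded_integral mf (mixin mk D0) f0.
  apply: le_lt_trans (ltry M%:R); apply: le_trans h.
  rewrite le_eqVlt; apply/orP; left; apply/eqP; apply: eq_integral => E _ /=.
  by rewrite ger0_norm//; have /andP[] := f0 (mix mk E D0).
have mk_ind D1 D2 : m (mix (below k) D1 (mix (one j) D2 D)) = m (mix (below k) D1 D).
  by apply: mind => i /negbTE ij; rewrite !tnth_mix /one ij.
(* The floor [m] ignores block [j], so its average [M0] is constant in that block; thanks to the
   clamping, the conditional mean of [g1] moves within [[M0, M0 + 2]]. *)
have bM D2 : M0 <= b (mix (one j) D2 D) <= M0 + 2.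
  have -> : M0 = (\int[Q]_D' m (mix (below k) D' (mix (one j) D2 D)))%R.
    by apply: eq_Rintegral => D' _; rewrite mk_ind.
  apply/andP; split.
    apply: le_Rintegral => //; [exact: intb|exact: intb|].
    by move=> D' _; have [/andP[_ ->]] := g1m (mix (below k) D' (mix (one j) D2 D)).
  rewrite -[X in _ + X](Rintegral_cst1 Q) -RintegralD//; last 2 first.
  - exact: intb.
  - exact: prob_integrable_cst.
  apply: le_Rintegral => //; first exact: intb.
    by apply: (integrableD measurableT (intb _ _ _ mm m0M) (prob_integrable_cst Q 2)).
  by move=> D' _; have [_ ->] := g1m (mix (below k) D' (mix (one j) D2 D)).
have mbj : measurable_fun setT (fun D2 => b (mix (one j) D2 D)).
  exact: measurableT_comp.
apply: (@le_trans _ _ (\int[Q]_D2 ((expR (4 * k%:R * l ^+ 2))%:E *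
    (expR (l * b (mix (one j) D2 D)))%:E))%E).
  apply: ge0_le_integral => //.
  - by move=> D2 _; apply: integral_ge0 => D1 _; rewrite lee_fin.
  - apply: (@measurable_partial_integral _ _ _ _ _ Q
      (fun p => (H (mix (below k) p.2 (mix (one j) p.1 D)))%:E)).
      apply/measurable_EFinP; apply: measurableT_comp => //.
      by apply: measurable_mix => //; apply: measurable_mix.
    by move=> p; rewrite lee_fin.
  - apply: measurable_funeM; apply/measurable_EFinP.
    by apply: measurableT_comp => //; apply: measurable_funM.
  - move=> D2 _; apply: (le_trans (HI _)).
    by rewrite -EFinM lee_fin -expRD addrC.
rewrite ge0_integralZl//; last first.
  apply/measurable_EFinP.
  by apply: measurableT_comp => //; apply: measurable_funM.
apply: (@le_trans _ _ ((expR (4 * k%:R * l ^+ 2))%:E *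
  (expR (l * (\int[Q]_D2 b (mix (one j) D2 D))%R + 4 * l ^+ 2))%:E)%E).
  apply: lee_wpmul2l; first by rewrite lee_fin expR_ge0.
  exact: expectation_expR_le mbj bM l01.
rewrite -EFinM lee_fin -expRD ler_expR.
rewrite -natr1.
suff : l * (\int[Q]_D2 b (mix (one j) D2 D))%R <=
    l * (\int[Q]_D' g (mix (below k.+1) D' D))%R by lra.
have /andP[l0 _] := l01.
apply: ler_wpM2l => //.
have fing : (\int[Q]_D' (g (mix (below k.+1) D' D))%:E)%E \is a fin_num.
  exact: integrable_fin_num (intb _ _ _ mg g0).
have b0M E : 0 <= b E <= M%:R.
  by rewrite -!lee_fin bE; exact: bounded_integral (mixin _ _) g10.
have finb : (\int[Q]_D2 (b (mix (one j) D2 D))%:E)%E \is a fin_num.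
  exact: integrable_fin_num (intb _ _ _ mb b0M).
rewrite -lee_fin /Rintegral (fineK finb) (fineK fing).
(* The two redrawings commute, so block [j] can be integrated first, with the lower blocks frozen;
   there clamping is known not to increase the integral. *)
have mixc D1 D2 : mix (below k) D1 (mix (one j) D2 D) = mix (one j) D2 (mix (below k) D1 D).
  apply: eq_from_tnth => i; rewrite !tnth_mix /below /one -(inj_eq val_inj (blk i) j) /=.
  by case: ltngtP.
rewrite key//; last by move=> E; have /andP[] := g0 E.
have mp (f : N.-tuple T -> R) : measurable_fun setT f ->
    measurable_fun setT (fun p : N.-tuple T * N.-tuple T =>
       (f (mix (below k) p.2 (mix (one j) p.1 D)))%:E).
  move=> mf; apply/measurable_EFinP; apply: measurableT_comp => //.
  by apply: measurable_mix => //; apply: measurable_mix.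
under eq_integral do rewrite bE.
rewrite (@integralC _ _ _ _ _ Q Q
   (fun p => (g1 (mix (below k) p.2 (mix (one j) p.1 D)))%:E)) => [||p]; last 2 first.
- exact: mp.
- by rewrite lee_fin; have /andP[] := g10 (mix (below k) p.2 (mix (one j) p.1 D)).
rewrite [leRHS](@integralC _ _ _ _ _ Q Q
   (fun p => (g (mix (below k) p.2 (mix (one j) p.1 D)))%:E)) => [||p]; last 2 first.
- exact: mp.
- by rewrite lee_fin; have /andP[] := g0 (mix (below k) p.2 (mix (one j) p.1 D)).
have sw (f : N.-tuple T -> R) : measurable_fun setT f ->
    measurable_fun setT (fun p : N.-tuple T * N.-tuple T =>
       (f (mix (below k) p.1 (mix (one j) p.2 D)))%:E).
  move=> mf; apply/measurable_EFinP; apply: measurableT_comp => //.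
  by apply: measurable_mix => //; apply: measurable_mix.
apply: ge0_le_integral => //.
- move=> D1 _; apply: integral_ge0 => D2 _; rewrite lee_fin.
  by have /andP[] := g10 (mix (below k) D1 (mix (one j) D2 D)).
- apply: (@measurable_partial_integral _ _ _ _ _ Q
    (fun p => (g1 (mix (below k) p.1 (mix (one j) p.2 D)))%:E)); first exact: sw.
  by move=> p; rewrite lee_fin; have /andP[] := g10 (mix (below k) p.1 (mix (one j) p.2 D)).
- apply: (@measurable_partial_integral _ _ _ _ _ Q
    (fun p => (g (mix (below k) p.1 (mix (one j) p.2 D)))%:E)); first exact: sw.
  by move=> p; rewrite lee_fin; have /andP[] := g0 (mix (below k) p.1 (mix (one j) p.2 D)).
move=> D1 _ /=.
under eq_integral do rewrite mixc.
under [leRHS]eq_integral do rewrite mixc.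
exact: gg1.
Qed.

End bounded_differences.

Section tails.
Context d (W : measurableType d) (R : realType) (Q : probability W R).

Lemma markov_event (H : W -> \bar R) (c h : R) : 0 < c ->
  measurable_fun setT H -> (forall w, 0 <= H w)%E ->
  (\int[Q]_w H w <= h%:E)%E ->
  exists E : set W, [/\ measurable E, ((1 - h / c)%:E <= Q E)%E &
    forall w, E w -> (H w < c%:E)%E].
Proof.
move=> c0 mH H0 Hh; exists [set w | (H w < c%:E)%E].
have mE : measurable [set w | (H w < c%:E)%E].
  by rewrite -[X in measurable X]setTI; apply: measurable_lte.
split => //.
set E := (X in Q X) in mE *.
have h1 : (c%:E * Q (~` E) <= h%:E)%E.
  apply: le_trans Hh; rewrite -integral_cst//; last exact: measurableC.
  apply: (@le_trans _ _ (\int[Q]_(w in ~` E) H w)%E).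
    apply: ge0_le_integral => //.
    - exact: measurableC.
    - by move=> w _; rewrite lee_fin ltW.
    - exact: measurable_funTS.
    - by move=> w; rewrite /E /= => /negP; rewrite -leNgt.
  by apply: ge0_subset_integral => //; exact: measurableC.
have QE : Q E = (fine (Q E))%:E by rewrite fineK// fin_num_measure.
move: h1; rewrite probability_setC// QE -EFinD -EFinM !lee_fin => h1.
have : 1 - fine (Q E) <= h / c by rewrite ler_pdivlMr// mulrC.
by lra.
Qed.

End tails.

Section bounded_differences_tail.
Context d (T : measurableType d) (R : realType) (P : probability T R).

(** At [k = n] every block is redrawn and the conditional bound becomes unconditional. Markov's
    inequality is applied to the measurable [H], so it yields a measurable event inside [Phi < t], a
    set that may fail to be measurable. *)
Lemma bounded_differences_tail N n (blk : 'I_N -> 'I_n) (M : nat)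
    (Phi g : N.-tuple T -> R) (l a t : R) :
  (forall j D D', (forall i, blk i != j -> tnth D i = tnth D' i) ->
     Phi D <= Phi D' + 1) ->
  0 < l <= 8^-1 -> measurable_fun setT g -> (forall D, Phi D <= g D) ->
  (forall D, 0 <= g D <= M%:R) -> (\int[iid P N]_D (g D)%:E <= a%:E)%E ->
  exists E : set (N.-tuple T), [/\ measurable E,
    ((1 - expR (l * (a - t) + 4 * n%:R * l ^+ 2))%:E <= iid P N E)%E &
    forall D, E D -> Phi D < t].
Proof.
move=> bd /andP[l0 l8] mg Hg g0 ga.
have l01 : 0 <= l <= 8^-1 by rewrite ltW.
have [H [mH HP HI]] := @exponential_majorant _ _ _ P N n blk M Phi bd l n g
  (leqnn n) l01 mg Hg g0.
have [D0|/forallNP nD] := pselect (exists D0 : N.-tuple T, True); last first.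
  have := probability_setT (iid P N); rewrite (_ : setT = set0).
    by rewrite measure0 => /eqP; rewrite eqe eq_sym oner_eq0.
  by apply/seteqP; split => D // _; have := nD D.
case: D0 => D0 _.
have mixn D' : mix (fun i => (blk i < n)%N) D' D0 = D'.
  by apply: eq_from_tnth => i; rewrite tnth_mix ltn_ord.
have Hle : (\int[iid P N]_D (H D)%:E <= (expR (l * a + 4 * n%:R * l ^+ 2))%:E)%E.
  have := HI D0.
  under eq_integral do rewrite mixn.
  under eq_Rintegral do rewrite mixn.
  move=> /le_trans; apply; rewrite lee_fin ler_expR.
  suff : (\int[iid P N]_D g D)%R <= a by move=> h; rewrite lerD2r ler_pM2l.
  rewrite -lee_fin /Rintegral fineK//.
  rewrite ge0_fin_numE; first exact: le_lt_trans ga (ltry _).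
  by apply: integral_ge0 => D _; rewrite lee_fin; have /andP[] := g0 D.
have [|D|E [mE EP HE]] := markov_event (expR_gt0 (l * t)) _ _ Hle.
- exact/measurable_EFinP.
- by rewrite lee_fin (le_trans _ (HP D))// expR_ge0.
exists E; split => //.
- apply: le_trans EP; rewrite lee_fin -expRN -expRD.
  by rewrite lerD2l lerN2 ler_expR; lra.
- move=> D /HE; rewrite lte_fin => /(le_lt_trans (HP D)).
  by rewrite ltr_expR ltr_pM2l.
Qed.

End bounded_differences_tail.

(** * Second moments of weighted sums of independent terms *)

Section square_integrable.
Context d (W : measurableType d) (R : realType) (Q : probability W R).
Variables (f : W -> R) (s2 : R).
Hypothesis mf : measurable_fun setT f.
Hypothesis fs : (\int[Q]_w (f w ^+ 2)%:E <= s2%:E)%E.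

Lemma integrable_sqr : Q.-integrable setT (EFin \o (fun w => f w ^+ 2)).
Proof.
apply/integrableP; split.
  by apply/measurable_EFinP; apply: measurable_funX.
apply: (le_lt_trans _ (ltry s2)); apply: le_trans fs.
rewrite le_eqVlt; apply/orP; left; apply/eqP; apply: eq_integral => w _ /=.
by rewrite ger0_norm// sqr_ge0.
Qed.

Lemma integrable_of_sqr : Q.-integrable setT (EFin \o f).
Proof.
apply: (@le_integrable _ _ _ Q setT measurableT _
  (EFin \o (fun w => 1 + f w ^+ 2))) => //.
- exact/measurable_EFinP.
- move=> w _ /=; rewrite lee_fin [leRHS]ger0_norm ?addr_ge0 ?sqr_ge0//.
  rewrite -[X in _ + X]real_normK ?num_real//.
  by have := sqr_ge0 (`|f w| - 1); have := normr_ge0 (f w); rewrite !expr2; nra.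
- exact: (integrableD measurableT (prob_integrable_cst Q 1) integrable_sqr).
Qed.

Lemma Rintegral_sqr_le : \int[Q]_w (f w ^+ 2) <= s2.
Proof.
rewrite -lee_fin /Rintegral fineK//.
exact: integrable_fin_num integrable_sqr.
Qed.

Lemma EFin_Rintegral_sqr :
  (\int[Q]_w (f w ^+ 2)%:E)%E = (\int[Q]_w (f w ^+ 2))%R%:E.
Proof. by rewrite /Rintegral fineK//; exact: integrable_fin_num integrable_sqr. Qed.

Lemma integral_affine_sqr (a c : R) :
  (\int[Q]_w ((a * f w + c) ^+ 2)%:E)%E =
  (a ^+ 2 * \int[Q]_w (f w ^+ 2) + 2 * a * c * \int[Q]_w f w + c ^+ 2)%:E.
Proof.
have i1 : Q.-integrable setT (EFin \o (fun w => a ^+ 2 * f w ^+ 2)).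
  exact: (integrableZl measurableT _ integrable_sqr).
have i2 : Q.-integrable setT (EFin \o (fun w => (2 * a * c) * f w)).
  exact: (integrableZl measurableT _ integrable_of_sqr).
have i12 : Q.-integrable setT (EFin \o
    (fun w => a ^+ 2 * f w ^+ 2 + (2 * a * c) * f w)).
  exact: (integrableD measurableT i1 i2).
have i3 := prob_integrable_cst Q (c ^+ 2).
rewrite -(RintegralZl _ measurableT integrable_sqr).
rewrite -(RintegralZl _ measurableT integrable_of_sqr) -RintegralD//.
rewrite -[c ^+ 2](Rintegral_cst1 Q) -RintegralD//.
rewrite /Rintegral fineK; last first.
  by apply: integrable_fin_num => //; exact: (integrableD measurableT i12 i3).
by apply: eq_integral => w _; congr (_%:E); ring.
Qed.

End square_integrable.

Section iid_moments.
Context d (T : measurableType d) (R : realType) (P : probability T R).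

Lemma integral_tnth n (i : 'I_n) (f : T -> \bar R) :
  measurable_fun setT f -> (forall x, 0 <= f x)%E ->
  (\int[iid P n]_D f (tnth D i) = \int[P]_x f x)%E.
Proof.
move=> mf f0; elim: n i => [[]//|n IH] i.
rewrite integral_iidS//; last by apply: measurableT_comp => //; exact: measurable_tnth.
case: (unliftP ord0 i) => [j ->|->].
  transitivity (\int[P]_x cst (\int[P]_x f x)%E x)%E; last exact: integral_cst1.
  apply: eq_integral => x _; rewrite /= -(IH j).
  by apply: eq_integral => D _; rewrite tnthS.
apply: eq_integral => x _; rewrite -[RHS](integral_cst1 (iid P n)).
by apply: eq_integral => D _; rewrite tnth0.
Qed.

Lemma integrable_tnth n (i : 'I_n) (f : T -> R) :
  P.-integrable setT (EFin \o f) ->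
  (iid P n).-integrable setT (EFin \o (fun D => f (tnth D i))).
Proof.
move=> /integrableP[mf fi]; apply/integrableP; split.
  exact: (measurableT_comp mf (@measurable_tnth _ _ _ i)).
rewrite (@integral_tnth _ _ (fun x => `|(f x)%:E|%E))//.
exact: measurableT_comp.
Qed.

Lemma Rintegral_tnth n (i : 'I_n) (f : T -> R) :
  P.-integrable setT (EFin \o f) ->
  \int[iid P n]_D f (tnth D i) = \int[P]_x f x.
Proof.
move=> fi; have mf := measurable_int P fi.
rewrite /Rintegral integralE [in RHS]integralE; congr fine.
congr (_ - _)%E.
  rewrite -(@integral_tnth _ i ((EFin \o f)^\+)%E)//.
    by apply: eq_integral => D _; rewrite unlock.
  exact: measurable_funepos.
rewrite -(@integral_tnth _ i ((EFin \o f)^\-)%E)//.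
  by apply: eq_integral => D _; rewrite unlock.
exact: measurable_funeneg.
Qed.

(** Centering kills the cross terms: with the tail fixed, the head adds its second moment and a
    multiple of its zero mean. *)
Lemma integral_sqr_sum_le n (a : 'I_n -> R) (y : T -> R) (s2 : R) :
  measurable_fun setT y -> (\int[P]_x (y x ^+ 2)%:E <= s2%:E)%E ->
  \int[P]_x y x = 0 ->
  (\int[iid P n]_D ((\sum_(i < n) a i * y (tnth D i)) ^+ 2)%:E <=
    ((\sum_(i < n) a i ^+ 2) * s2)%:E)%E.
Proof.
move=> my ys y0; have ys' := Rintegral_sqr_le my ys.
have mS k (b : 'I_k -> R) : measurable_fun setT
    (fun D : k.-tuple T => ((\sum_(i < k) b i * y (tnth D i)) ^+ 2)%:E).
  apply/measurable_EFinP; apply: measurable_funX.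
  apply: measurable_sum => i; apply: measurable_funM => //.
  by apply: measurableT_comp => //; exact: measurable_tnth.
elim: n a => [|n IH] a.
  rewrite big_ord0 mul0r.
  by under eq_integral do rewrite big_ord0 expr0n/=; rewrite integral_cst1.
rewrite integral_iidS//; last by move=> D; rewrite lee_fin sqr_ge0.
rewrite (@integralC _ _ _ _ _ (iid P n) P (fun p =>
   ((\sum_(i < n.+1) a i * y (tnth (tcons p) i)) ^+ 2)%:E)); last 2 first.
- by apply: (measurableT_comp (mS n.+1 a)); exact: measurable_tcons.
- by move=> p; rewrite lee_fin sqr_ge0.
pose S (D : n.-tuple T) := \sum_(i < n) a (lift ord0 i) * y (tnth D i).
rewrite (eq_integral (fun D : n.-tuple T =>
    (a ord0 ^+ 2 * \int[P]_x (y x ^+ 2) + S D ^+ 2)%:E)); last first.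
  move=> D _ /=.
  under eq_integral.
    move=> x _; rewrite big_ord_recl tnth0.
    under eq_bigr do rewrite tnthS.
    over.
  by rewrite /= (integral_affine_sqr my ys _ (S D)) y0 mulr0 addr0.
under eq_integral do rewrite EFinD.
rewrite ge0_integralD//; first last.
- exact: mS.
- by move=> D _; rewrite lee_fin sqr_ge0.
- move=> D _; rewrite lee_fin; apply: mulr_ge0; first exact: sqr_ge0.
  by apply: Rintegral_ge0 => x _; exact: sqr_ge0.
rewrite integral_cst1 big_ord_recl mulrDl EFinD; apply: leeD.
  by rewrite lee_fin ler_wpM2l ?sqr_ge0.
exact: IH.
Qed.

End iid_moments.

Lemma bounded_integrable d (W : measurableType d) (R : realType)
    (Q : probability W R) (f : W -> R) (c : R) :
  measurable_fun setT f -> (forall w, `|f w| <= c) ->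
  Q.-integrable setT (EFin \o f).
Proof.
move=> mf fc; apply: (@le_integrable _ _ _ Q setT measurableT _ (EFin \o cst c)).
- exact/measurable_EFinP.
- by move=> w _; rewrite /= lee_fin (le_trans (fc w))// ler_norm.
- exact: prob_integrable_cst.
Qed.

(** * Uniform deviation over blocks *)

Section block_deviation.
Context d (T : measurableType d) (R : realType) (P : probability T R).
Variables (N : nat) (V : Type) (z : V -> T -> R) (B : R).
Variable U : N.-tuple bool -> N.-tuple T -> \bar R.
Hypothesis iz : forall v, P.-integrable setT (EFin \o z v).
Hypothesis mU : forall e, measurable_fun setT (U e).
Hypothesis U0 : forall e D, (0 <= U e D)%E.
Hypothesis HU : forall v D (e : N.-tuple bool),
  (`|\sum_(i < N) (-1) ^+ tnth e i * z v (tnth D i)|%:E <= U e D)%E.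
Hypothesis UB :
  ((2^-1 ^+ N)%:E * \sum_(e : N.-tuple bool) \int[iid P N]_D U e D <= B%:E)%E.

Let Q := iid P N.
Let cz v x := z v x - \int[P]_y z v y.

(** Symmetrization with each observation as its own block. Every pattern [s] is covered, because the
    contraction over blocks feeds in all patterns that are constant on blocks. *)
Lemma centered_majorant (s : N.-tuple bool) :
  exists G : N.-tuple T -> \bar R, [/\ measurable_fun setT G,
    forall D, (0 <= G D)%E,
    forall v D, (`|\sum_(i < N) (-1) ^+ tnth s i * cz v (tnth D i)|%:E
      <= G D)%E &
    (\int[Q]_D G D <= (2 * B)%:E)%E].
Proof.
have [|v i||G [mG G0 HG GB]] := @symmetrization_majorant _ T R P N N id V
  (fun v i D => z v (tnth D i)) U _ _ mU U0 _ s.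
- by move=> v j D D' /(_ j erefl) ->.
- exact: integrable_tnth.
- exact: HU.
exists G; split => //.
- move=> v D; have := HG v D.
  by under eq_bigr do rewrite Rintegral_tnth//.
- apply: (le_trans GB); rewrite EFinM EFinM -muleA.
  by apply: lee_wpmul2l.
Qed.

Lemma one_block_deviation (c : R) : 0 < c ->
  exists E : set (N.-tuple T), [/\ measurable E,
    ((1 - 2 * B / c)%:E <= Q E)%E &
    forall D v, E D -> `|\sum_(i < N) cz v (tnth D i)| < c].
Proof.
move=> c0; have [G [mG G0 HG GB]] := centered_majorant [tuple false | _ < N].
have [E [mE QE HE]] := markov_event c0 mG G0 GB.
exists E; split => // D v /HE GD.
rewrite -lte_fin (le_lt_trans _ GD)//.
have := HG v D; under eq_bigr do rewrite tnth_mktuple expr0 mul1r.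
exact.
Qed.

Section blocks.
Variables (n m : nat) (blk : 'I_N -> 'I_n) (s2 k : R).
Hypothesis mz : forall v, measurable_fun setT (z v).
Hypothesis zs : forall v, (\int[P]_x (z v x ^+ 2)%:E <= s2%:E)%E.
Hypothesis m0 : (0 < m)%N.
Hypothesis k0 : 0 < k.
Hypothesis B0 : 0 < B.
Let sz j := #|[pred i | blk i == j]|.
Hypothesis blkm : forall j, (m <= sz j)%N.
Hypothesis s2m : s2 <= (64^-1) ^+ 2 * k ^+ 2 * m%:R.
Hypothesis Bm : 12 * B / (k * m%:R) <= n%:R / 32.

Let t v D j := \sum_(i | blk i == j) cz v (tnth D i).
Let phi j (x : R) : R := Num.min (`|x| / (k * (sz j)%:R)) 1.

(** The indicator of a deviation is dominated by the Lipschitz function [phi j], whose mean is small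
    by the variance bound and whose fluctuations are small by contraction and symmetrization. The
    supremum of the counts moves by at most one when one block changes, hence it concentrates. *)
Lemma deviating_blocks :
  exists E : set (N.-tuple T), [/\ measurable E,
    ((1 - expR (- (n%:R / 512)))%:E <= Q E)%E &
    forall D v, E D ->
      (#|[pred j | k * (sz j)%:R < `|\sum_(i | blk i == j) cz v (tnth D i)| ]|%:R
        < n%:R / 4 :> R)].
Proof.
have sz0 j : 0 < (sz j)%:R :> R by rewrite ltr0n (leq_trans m0).
have ksz0 j : 0 < k * (sz j)%:R by rewrite mulr_gt0.
have km0 : 0 < k * m%:R by rewrite mulr_gt0 ?ltr0n.
have phi01 j x : 0 <= phi j x <= 1.
  by rewrite /phi le_min ge_min lexx orbT ler01 !andbT divr_ge0// ltW.
have philip j x y : `|phi j x - phi j y| <= (k * m%:R)^-1 * `|x - y|.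
  have h : `| `|x| / (k * (sz j)%:R) - `|y| / (k * (sz j)%:R)| <=
      (k * m%:R)^-1 * `|x - y|.
    rewrite -mulrBl normrM mulrC ler_pM// ?invr_ge0//; last exact: ler_dist_dist.
    rewrite gtr0_norm ?invr_gt0// lef_pV2 ?posrE// ler_pM2l// ler_nat//.
  apply: le_trans h; rewrite /phi.
  set a := `|x| / _; set b := `|y| / _.
  move: a b => a b; rewrite !minEle.
  case: (lerP a 1) => ?; case: (lerP b 1) => ? /=; rewrite ?subrr ?normr0//;
    rewrite ler_norml; case: (lerP 0 (a - b)) => [|] h;
    rewrite ?(ger0_norm h) ?(ltr0_norm h); lra.
have phi0 j : phi j 0 = 0 by rewrite /phi normr0 mul0r min_l.
have mphi j : measurable_fun setT (phi j).
  apply: measurable_minr => //; apply: measurable_funM => //.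
have mcz v : measurable_fun setT (cz v) by exact: measurable_funB.
have mt v j : measurable_fun setT (fun D => t v D j).
  rewrite (_ : (fun D => _) = fun D : N.-tuple T =>
      \sum_i (if blk i == j then cz v (tnth D i) else 0)); last first.
    by apply/funext => D; exact: big_mkcond.
  apply: measurable_sum => i; case: (blk i == j) => //.
  by apply: measurableT_comp => //; exact: measurable_tnth.
(* Block signs are point signs constant on blocks, so the majorants of signed sums over the sample
   also serve for signed block sums. *)
have tE v D (e : n.-tuple bool) :
    \sum_(j < n) (-1) ^+ tnth e j * t v D j =
    \sum_(i < N) (-1) ^+ tnth [tuple tnth e (blk i) | i < N] i * cz v (tnth D i).
  rewrite [RHS](partition_big blk xpredT)//=; apply: eq_bigr => j _.
  rewrite mulr_sumr; apply: eq_bigr => i /eqP ij.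
  by rewrite tnth_mktuple ij.
have /choice[G1 HG1] := centered_majorant.
pose U1 (e : n.-tuple bool) := G1 [tuple tnth e (blk i) | i < N].
have [|||v D e|U2 [mU2 U20 HU2 IU2]] := @contraction_majorant _ _ _ Q V n t phi
  ((k * m%:R)^-1) B U1 _ B0 philip phi0.
- by rewrite invr_gt0.
- by move=> e; have [] := HG1 [tuple tnth e (blk i) | i < N].
- by move=> e w; have [_ + _ _] := HG1 [tuple tnth e (blk i) | i < N]; exact.
- rewrite tE; have [_ _ + _] := HG1 [tuple tnth e (blk i) | i < N]; exact.
have cz0 v : \int[P]_x cz v x = 0.
  by rewrite RintegralB ?Rintegral_cst1 ?subrr//; exact: prob_integrable_cst.
have czs v : (\int[P]_x (cz v x ^+ 2)%:E <= s2%:E)%E.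
  set mu := \int[P]_y z v y.
  rewrite (eq_integral (fun x => ((1 * z v x + - mu) ^+ 2)%:E)); last first.
    by move=> x _; rewrite mul1r.
  rewrite (integral_affine_sqr (mz v) (zs v)) lee_fin -/mu.
  have := Rintegral_sqr_le (mz v) (zs v); have := sqr_ge0 mu.
  by rewrite !expr2; nra.
have ts v j : (\int[Q]_D (t v D j ^+ 2)%:E <= ((sz j)%:R * s2)%:E)%E.
  have := integral_sqr_sum_le (fun i => (blk i == j)%:R) (mcz v) (czs v) (cz0 v).
  rewrite (_ : \sum_(i < N) (blk i == j)%:R ^+ 2 = (sz j)%:R); last first.
    rewrite /sz -sum1_card natr_sum [RHS]big_mkcond /=.
    by apply: eq_bigr => i _; rewrite inE; case: (blk i == j); rewrite ?expr1n ?expr0n.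
  apply: le_trans; rewrite le_eqVlt; apply/orP; left; apply/eqP.
  apply: eq_integral => D _; rewrite /t big_mkcond /=; congr (_ ^+ 2)%:E.
  by apply: eq_bigr => i _; case: (blk i == j); rewrite ?mul1r ?mul0r.
have iphi v j : Q.-integrable setT (EFin \o (fun D => phi j (t v D j))).
  apply: (@bounded_integrable _ _ _ _ _ 1).
    exact: (measurableT_comp (mphi j) (mt v j)).
  by move=> D; have := phi01 j (t v D j); rewrite ler_norml; lra.
have Ephi v j : \int[Q]_D phi j (t v D j) <= 64^-1.
  have it := integrable_sqr (mt v j) (ts v j).
  have it2 : Q.-integrable setT (EFin \o
      (fun D => 32 / (k * (sz j)%:R) ^+ 2 * t v D j ^+ 2)).
    exact: (integrableZl measurableT _ it).
  (* With [y = |t| / (k sz)], expanding [32 (y - 1/64)^2 >= 0] gives [y <= 1/128 + 32 y^2]; the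
     hypothesis [s2m] bounds the mean of [32 y^2] by [1/128]. *)
  apply: (@le_trans _ _ (\int[Q]_D (128^-1 + 32 / (k * (sz j)%:R) ^+ 2 *
      t v D j ^+ 2))).
    apply: le_Rintegral => //.
      exact: (integrableD measurableT (prob_integrable_cst Q _) it2).
    move=> D _; apply: (@le_trans _ _ (`|t v D j| / (k * (sz j)%:R))).
      by rewrite /phi ge_min lexx.
    rewrite -mulrA [_^-1 * (_ ^+ 2)]mulrC -exprVn.
    rewrite -[t v D j ^+ 2]real_normK ?num_real// -exprMn.
    set y := `|t v D j| / _; have := sqr_ge0 (y - 64^-1).
    by rewrite !expr2; lra.
  rewrite RintegralD//; last exact: prob_integrable_cst.
  rewrite Rintegral_cst1 (RintegralZl _ measurableT it).
  have h := Rintegral_sqr_le (mt v j) (ts v j).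
  have h2 : 32 / (k * (sz j)%:R) ^+ 2 * \int[Q]_D (t v D j ^+ 2) <= 128^-1.
    rewrite mulrAC ler_pdivrMr ?exprn_gt0//.
    have mj : m%:R <= (sz j)%:R :> R by rewrite ler_nat.
    have h3 : (sz j)%:R * s2 <= (sz j)%:R * ((64^-1) ^+ 2 * k ^+ 2 * (sz j)%:R).
      rewrite ler_pM2l// (le_trans s2m)// ler_wpM2l//.
      by rewrite mulr_ge0 ?sqr_ge0.
    by move: (le_trans h h3); rewrite !expr2; lra.
  by lra.
have [||v D e|G2 [mG2 G20 HG2 IG2]] := @symmetrization_majorant _ T R P N n blk V
  (fun v j D => phi j (t v D j)) U2 _ _ mU2 U20 _ [tuple false | _ < n].
- move=> v j D D' h; congr (phi j _); apply: eq_bigr => i /eqP ij.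
  by rewrite h.
- by [].
- exact: HU2.
have {}IG2 : (\int[Q]_D G2 D <= (n%:R / 32)%:E)%E.
  apply: (le_trans IG2).
  (* The 12 in [Bm]: 2 from this symmetrization, [2/(k m)] from contraction, and [3 B] from the
     majorant's [2 B] plus the rounding width [dl = B]. *)
  apply: (@le_trans _ _ ((2 * 2^-1 ^+ n)%:E * ((2 * (k * m%:R)^-1)%:E *
      \sum_(e : n.-tuple bool) (3 * B)%:E))%E).
    apply: lee_wpmul2l; first by rewrite lee_fin mulr_ge0// exprn_ge0.
    apply: (le_trans IU2); apply: lee_wpmul2l.
      by rewrite lee_fin mulr_ge0// invr_ge0 ltW.
    apply: lee_sum => e _.
    have [_ _ _ h] := HG1 [tuple tnth e (blk i) | i < N].
    rewrite (_ : 3 * B = 2 * B + B); last by lra.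
    by rewrite EFinD; apply: leeD.
  rewrite sumEFin sumr_const card_tuple card_bool -!EFinM lee_fin.
  apply: le_trans Bm; rewrite -[3 * B *+ _]mulr_natl natrX.
  rewrite [leLHS](_ : _ = (2^-1 ^+ n * 2 ^+ n) * (12 * B / (k * m%:R))); last by ring.
  by rewrite -exprMn mulVf// expr1n mul1r.
have [[v0 _]|/forallNP nV] := pselect (exists v : V, True); last first.
  exists setT; split=> // [|D v]; last by have := nV v.
  by rewrite probability_setT lee_fin gerBl expR_ge0.
pose badp v D := [pred j | k * (sz j)%:R < `|t v D j| ].
pose bad v D : R := #|badp v D|%:R.
have badn v D : bad v D <= n%:R.
  by rewrite ler_nat -[X in (_ <= X)%N]card_ord max_card.
have badphi v D : bad v D <= \sum_(j < n) phi j (t v D j).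
  rewrite /bad -sum1_card natr_sum big_mkcond/=; apply: ler_sum => j _.
  rewrite inE /=; case: ifPn => h; last by have /andP[] := phi01 j (t v D j).
  by rewrite /phi le_min lexx andbT ler_pdivlMr// mul1r ltW.
pose Phi D := sup [set bad v D | v in [set: V]].
have PhiS D : has_sup [set bad v D | v in [set: V]].
  split; first by exists (bad v0 D), v0.
  by exists n%:R => _ [v _ <-].
have badPhi v D : bad v D <= Phi D.
  by apply: ub_le_sup; [exact: (PhiS D).2|exists v].
have Phile D c : (forall v, bad v D <= c) -> Phi D <= c.
  by move=> h; apply: ge_sup; [exact: (PhiS D).1|move=> _ [v _ <-]].
have Phibd j D D' : (forall i, blk i != j -> tnth D i = tnth D' i) ->
    Phi D <= Phi D' + 1.
  move=> DD'; apply: Phile => v.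
  apply: (@le_trans _ _ (bad v D' + 1)); last by rewrite lerD2r.
  rewrite /bad natr1 ler_nat.
  rewrite -(add1n #|_|) -(cards1 j) -cardsE -[#|badp v D'|]cardsE.
  apply: leq_trans (leq_card_setU _ _); apply: subset_leq_card.
  apply/fintype.subsetP => j'; rewrite !inE /=; have [->|jj'] := eqVneq j' j => //.
  rewrite (_ : t v D j' = t v D' j')//; apply: eq_bigr => i /eqP ij.
  by rewrite DD'// ij.
pose g D := fine (mine ((n%:R / 64)%:E + G2 D) n%:R%:E)%E.
have gE D : (g D)%:E = (mine ((n%:R / 64)%:E + G2 D) n%:R%:E)%E.
  rewrite /g fineK// ge0_fin_numE.
    by rewrite gt_min ltry orbT.
  by rewrite le_min adde_ge0 ?lee_fin ?divr_ge0 ?ler0n.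
have mg : measurable_fun setT g.
  apply/measurable_EFinP; rewrite (_ : _ \o _ = fun D =>
    (mine ((n%:R / 64)%:E + G2 D) n%:R%:E)%E).
    by apply: measurable_mine => //; apply: emeasurable_funD.
  by apply/funext => D; exact: gE.
have g0n D : 0 <= g D <= n%:R.
  apply/andP; split; rewrite -lee_fin gE; last by rewrite ge_min lexx orbT.
  by rewrite le_min lee_fin ler0n andbT adde_ge0// lee_fin.
have Phig D : Phi D <= g D.
  apply: Phile => v; rewrite -lee_fin gE le_min lee_fin badn andbT.
  apply: (@le_trans _ _ (n%:R / 64 + `|\sum_(j < n) (phi j (t v D j) -
     \int[Q]_D phi j (t v D j))|)%:E).
    rewrite lee_fin; apply: (le_trans (badphi v D)).
    rewrite -lerBlDl; apply: le_trans (ler_norm _).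
    rewrite sumrB lerD2l lerN2.
    apply: (@le_trans _ _ (\sum_(j < n) 64^-1)); first exact: ler_sum.
    by rewrite sumr_const card_ord mulr_natl.
  rewrite EFinD leeD2l//; have := HG2 v D.
  by under eq_bigr do rewrite tnth_mktuple expr0 mul1r.
have Ig : (\int[Q]_D (g D)%:E <= (n%:R * (3 / 64))%:E)%E.
  apply: (@le_trans _ _ (\int[Q]_D ((n%:R / 64)%:E + G2 D))%E).
    apply: ge0_le_integral => //.
    - by move=> D _; rewrite lee_fin; have /andP[] := g0n D.
    - exact/measurable_EFinP.
    - exact: emeasurable_funD.
    - by move=> D _; rewrite gE ge_min lexx.
  rewrite ge0_integralD//.
  rewrite integral_cst1.
  rewrite (_ : n%:R * (3 / 64) = n%:R / 64 + n%:R / 32); last by lra.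
  by rewrite EFinD; apply: leeD2l.
(* With mean [3n/64], level [n/4] and [l = 1/64] the exponent is [-9n/4096], which is at most
   [-n/512]. *)
have l64 : 0 < (64^-1 : R) <= 8^-1 by lra.
have [E [mE QE HE]] := bounded_differences_tail (n%:R / 4) Phibd l64 mg Phig g0n Ig.
exists E; split => //.
- apply: le_trans QE; rewrite lee_fin lerD2l lerN2 ler_expR.
  have : 0 <= n%:R :> R by exact: ler0n.
  by rewrite !expr2; lra.
- by move=> D v ED; exact: (le_lt_trans (badPhi v D) (HE _ ED)).
Qed.

End blocks.
End block_deviation.

(** * Moments over the class localized at scale [r] *)

Section localized_class.
Context d (Z : measurableType d) (R : realType) (rho : probability Z R).
Variables (L sigma r : R) (C : set (Z -> R)) (xi : Z -> R).
Hypothesis L1 : 1 <= L.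
Hypothesis r0 : 0 < r.
Hypothesis sigma0 : 0 < sigma.
Hypothesis mC : forall u, C u -> measurable_fun setT u.
Hypothesis C2 : forall u, C u -> (\int[rho]_z (u z ^+ 2)%:E < +oo)%E.
Hypothesis C4 : forall u, C u ->
  (\int[rho]_z (u z ^+ 4)%:E <= (L ^+ 4 * (\int[rho]_z (u z ^+ 2)) ^+ 2)%:E)%E.
Hypothesis mxi : measurable_fun setT xi.
Hypothesis xi2 : (\int[rho]_z (xi z ^+ 2)%:E <= (sigma ^+ 2)%:E)%E.
Hypothesis xi4 : (\int[rho]_z (xi z ^+ 4)%:E <= (L ^+ 4 * sigma ^+ 4)%:E)%E.

Definition starC (v : Z -> R) := exists u l, [/\ C u, 0 <= l <= 1,
  v = (fun z => l * u z) & l ^+ 2 * \int[rho]_z (u z ^+ 2) <= r ^+ 2].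

Lemma C2E u : C u ->
  (\int[rho]_z (u z ^+ 2)%:E)%E = (\int[rho]_z (u z ^+ 2))%:E.
Proof.
move=> Cu; rewrite /Rintegral fineK// ge0_fin_numE ?C2//.
by apply: integral_ge0 => z _; rewrite lee_fin sqr_ge0.
Qed.

Lemma starC_measurable v : starC v -> measurable_fun setT v.
Proof. by move=> [u [l [Cu _ -> _]]]; apply: measurable_funM => //; exact: mC. Qed.

Lemma starC_sqr v : starC v -> (\int[rho]_z (v z ^+ 2)%:E <= (r ^+ 2)%:E)%E.
Proof.
move=> [u [l [Cu _ -> h]]]; under eq_integral do rewrite exprMn EFinM.
rewrite ge0_integralZl//.
- by rewrite C2E// -EFinM lee_fin.
- by apply/measurable_EFinP; apply: measurable_funX; exact: mC.
- by move=> z _; rewrite lee_fin sqr_ge0.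
- by rewrite lee_fin sqr_ge0.
Qed.

Lemma starC_pow4 v : starC v ->
  (\int[rho]_z (v z ^+ 4)%:E <= (L ^+ 4 * r ^+ 4)%:E)%E.
Proof.
move=> [u [l [Cu _ -> h]]]; under eq_integral do rewrite exprMn EFinM.
have e4 (x : R) : 0 <= x ^+ 4 by rewrite (exprM x 2 2) sqr_ge0.
rewrite ge0_integralZl//.
- apply: (@le_trans _ _ ((l ^+ 4)%:E *
      (L ^+ 4 * (\int[rho]_z (u z ^+ 2)) ^+ 2)%:E)%E).
    by apply: lee_wpmul2l; [rewrite lee_fin|exact: C4].
  rewrite -EFinM lee_fin mulrCA ler_wpM2l//.
  rewrite (exprM l 2 2) (exprM r 2 2) -exprMn lerXn2r ?nnegrE ?sqr_ge0//.
  apply: mulr_ge0; first exact: sqr_ge0.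
  by apply: Rintegral_ge0 => z _; exact: sqr_ge0.
- by apply/measurable_EFinP; apply: measurable_funX; exact: mC.
- by move=> z _; rewrite lee_fin.
- by rewrite lee_fin.
Qed.

Lemma integrable_mul_xi (v : Z -> R) : measurable_fun setT v ->
  (\int[rho]_z (v z ^+ 2)%:E < +oo)%E ->
  rho.-integrable setT (EFin \o (fun z => v z * xi z)).
Proof.
move=> mv v2.
have v2fin : (\int[rho]_z (v z ^+ 2)%:E)%E = (\int[rho]_z (v z ^+ 2))%:E.
  rewrite /Rintegral fineK// ge0_fin_numE//.
  by apply: integral_ge0 => z _; rewrite lee_fin sqr_ge0.
have v2le : (\int[rho]_z (v z ^+ 2)%:E <= (\int[rho]_z (v z ^+ 2))%R%:E)%E.
  by rewrite v2fin.
have i1 := integrable_sqr mv v2le.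
have i2 := integrable_sqr mxi xi2.
apply: (@le_integrable _ _ _ rho setT measurableT _
  (EFin \o (fun z => v z ^+ 2 + xi z ^+ 2))) => //.
- by apply/measurable_EFinP; exact: measurable_funM.
- move=> z _ /=; rewrite lee_fin [leRHS]ger0_norm ?addr_ge0 ?sqr_ge0//.
  rewrite normrM -[v z ^+ 2]real_normK ?num_real// -[xi z ^+ 2]real_normK ?num_real//.
  by have := sqr_ge0 (`|v z| - `|xi z|); have := sqr_ge0 `|v z|;
    have := sqr_ge0 `|xi z|; rewrite !expr2; lra.
- exact: (integrableD measurableT i1 i2).
Qed.

(* Young's inequality with the weight sigma^2 / r^2 replaces Cauchy-Schwarz. *)
Lemma starC_mul_sqr v : starC v ->
  (\int[rho]_z ((v z * xi z) ^+ 2)%:E <= (L ^+ 4 * sigma ^+ 2 * r ^+ 2)%:E)%E.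
Proof.
move=> Hv; have mv := starC_measurable Hv.
pose w := sigma ^+ 2 / r ^+ 2.
have w0 : 0 < w by rewrite divr_gt0 ?exprn_gt0.
have e4 (x : R) : 0 <= x ^+ 4 by rewrite (exprM x 2 2) sqr_ge0.
apply: (@le_trans _ _ (\int[rho]_z ((w / 2)%:E * (v z ^+ 4)%:E +
    (w^-1 / 2)%:E * (xi z ^+ 4)%:E))%E).
  apply: ge0_le_integral => //.
  - by move=> z _; rewrite lee_fin sqr_ge0.
  - by apply/measurable_EFinP; apply: measurable_funX; exact: measurable_funM.
  - by apply: emeasurable_funD; apply: measurable_funeM; apply/measurable_EFinP;
      exact: measurable_funX.
  - move=> z _; rewrite -!EFinM -EFinD lee_fin.
    have := sqr_ge0 (w * v z ^+ 2 - xi z ^+ 2) => h.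
    rewrite -(ler_pM2l w0).
    have -> : w * (w / 2 * v z ^+ 4 + w^-1 / 2 * xi z ^+ 4) =
      w ^+ 2 / 2 * v z ^+ 4 + (w / w) / 2 * xi z ^+ 4 by field; rewrite gt_eqF.
    rewrite divff ?gt_eqF//; move: h.
    by rewrite !exprS !expr0; lra.
rewrite ge0_integralD//; last 4 first.
- by move=> z _; rewrite -EFinM lee_fin mulr_ge0// divr_ge0// ltW.
- by apply: measurable_funeM; apply/measurable_EFinP; exact: measurable_funX.
- by move=> z _; rewrite -EFinM lee_fin mulr_ge0// divr_ge0// invr_ge0 ltW.
- by apply: measurable_funeM; apply/measurable_EFinP; exact: measurable_funX.
have wi2 : 0 <= w^-1 / 2 by rewrite divr_ge0// invr_ge0 ltW.
have w2 : 0 <= w / 2 by rewrite divr_ge0// ltW.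
rewrite !ge0_integralZl//; try (by move=> z _; rewrite lee_fin);
  try (by apply/measurable_EFinP; exact: measurable_funX).
apply: (@le_trans _ _ ((w / 2)%:E * (L ^+ 4 * r ^+ 4)%:E +
   (w^-1 / 2)%:E * (L ^+ 4 * sigma ^+ 4)%:E)%E).
  by apply: leeD; apply: lee_wpmul2l; rewrite ?lee_fin//; exact: starC_pow4.
rewrite -!EFinM -EFinD lee_fin le_eqVlt; apply/orP; left; apply/eqP.
by rewrite /w; field; rewrite !gt_eqF.
Qed.

End localized_class.

Lemma probability_setI_ge d (W : measurableType d) (R : realType)
    (Q : probability W R) (A B : set W) (a b : R) :
  measurable A -> measurable B -> ((1 - a)%:E <= Q A)%E ->
  ((1 - b)%:E <= Q B)%E -> ((1 - (a + b))%:E <= Q (A `&` B))%E.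
Proof.
move=> mA mB Aa Bb.
have fin X : measurable X -> Q X = (fine (Q X))%:E.
  by move=> mX; rewrite fineK// fin_num_measure.
have pC X : measurable X -> Q (~` X) = (1 - Q X)%E by exact: probability_setC.
have : (Q (~` A `|` ~` B) <= Q (~` A) + Q (~` B))%E.
  by apply: measureU2; exact: measurableC.
rewrite -setCI !pC//; last exact: measurableI.
move: Aa Bb; rewrite (fin A)// (fin B)// (fin (A `&` B)); last exact: measurableI.
by rewrite -!EFinB -EFinD !lee_fin; lra.
Qed.

Section truncation.
Variables (R : realType) (r : R).
Hypothesis r0 : 0 < r.

Definition trunc (x : R) := Num.min (`|x| / r) 1.

Lemma trunc_itv x : 0 <= trunc x <= 1.
Proof. by rewrite /trunc le_min ge_min lexx orbT ler01 !andbT divr_ge0// ltW. Qed.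

Lemma trunc0 : trunc 0 = 0.
Proof. by rewrite /trunc normr0 mul0r min_l. Qed.

Lemma trunc_lip x y : `|trunc x - trunc y| <= r^-1 * `|x - y|.
Proof.
have h : `| `|x| / r - `|y| / r| <= r^-1 * `|x - y|.
  rewrite -mulrBl normrM mulrC gtr0_norm ?invr_gt0//.
  by rewrite ler_pM2l ?invr_gt0// ler_dist_dist.
apply: le_trans h; rewrite /trunc; move: (`|x| / r) (`|y| / r) => a b.
rewrite !minEle.
case: (lerP a 1) => ?; case: (lerP b 1) => ? /=; rewrite ?subrr ?normr0//;
  rewrite ler_norml; case: (lerP 0 (a - b)) => [|] h;
  rewrite ?(ger0_norm h) ?(ltr0_norm h); lra.
Qed.

Lemma measurable_trunc : measurable_fun setT trunc.
Proof. by apply: measurable_minr => //; apply: measurable_funM. Qed.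

Lemma trunc_sqr_le x : r ^+ 2 * trunc x ^+ 2 <= x ^+ 2.
Proof.
rewrite -exprMn -[leRHS]real_normK ?num_real// lerXn2r ?nnegrE//.
  by rewrite mulr_ge0 ?(ltW r0)//; have /andP[] := trunc_itv x.
by rewrite mulrC -ler_pdivlMr// /trunc ge_min lexx.
Qed.

(* Both [1] and [s], for [s <= 1], dominate [a s - a^2 s^2 / 4] when [a <= 1]. *)
Lemma trunc_ge (a x : R) : 0 <= a <= 1 ->
  a / r ^+ 2 * x ^+ 2 - a ^+ 2 / (4 * r ^+ 4) * x ^+ 4 <= trunc x.
Proof.
move=> /andP[a0 a1]; set y := `|x| / r.
have y0 : 0 <= y by rewrite divr_ge0// ltW.
have y2 : x ^+ 2 / r ^+ 2 = y ^+ 2.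
  by rewrite /y expr_div_n real_normK ?num_real.
have -> : a / r ^+ 2 * x ^+ 2 - a ^+ 2 / (4 * r ^+ 4) * x ^+ 4 =
    a * y ^+ 2 - (a * y ^+ 2) ^+ 2 / 4.
  by rewrite -y2; field; rewrite gt_eqF.
rewrite /trunc le_min -/y; set s := a * y ^+ 2.
have s0 : 0 <= s by rewrite mulr_ge0 ?sqr_ge0.
have h1 : s - s ^+ 2 / 4 <= 1 by have := sqr_ge0 (1 - s / 2); rewrite !expr2; lra.
rewrite h1 andbT; have [yge1|ylt1] := leP 1 y; first exact: le_trans h1 yge1.
have : s <= y.
  rewrite /s (le_trans (ler_piMl _ a1)) ?sqr_ge0// expr2.
  by rewrite ler_piMr// ltW.
by have := sqr_ge0 s; lra.
Qed.

End truncation.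

(** * The good event and its probability *)

Section uniform.
Context d (Z : measurableType d) (R : realType) (rho : probability Z R).
Variables (L sigma r : R) (C : set (Z -> R)) (xi : Z -> R).
Hypothesis L1 : 1 <= L.
Hypothesis r0 : 0 < r.
Hypothesis sigma0 : 0 < sigma.
Hypothesis mC : forall u, C u -> measurable_fun setT u.
Hypothesis C2 : forall u, C u -> (\int[rho]_z (u z ^+ 2)%:E < +oo)%E.
Hypothesis C4 : forall u, C u ->
  (\int[rho]_z (u z ^+ 4)%:E <= (L ^+ 4 * (\int[rho]_z (u z ^+ 2)) ^+ 2)%:E)%E.
Hypothesis mxi : measurable_fun setT xi.
Hypothesis xi2 : (\int[rho]_z (xi z ^+ 2)%:E <= (sigma ^+ 2)%:E)%E.
Hypothesis xi4 : (\int[rho]_z (xi z ^+ 4)%:E <= (L ^+ 4 * sigma ^+ 4)%:E)%E.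

Let S := starC rho r C.

(** Integrate [trunc_ge] with [a = L^-4]: the fourth-moment bound limits the subtracted term to
    [a/4], leaving [3a/4 >= a/2]. *)
Lemma starC_trunc_ge v : S v -> \int[rho]_z (v z ^+ 2) = r ^+ 2 ->
  (2 * L ^+ 4)^-1 <= \int[rho]_z trunc r (v z).
Proof.
move=> Sv v2; have mv := starC_measurable mC Sv.
have L4 : 1 <= L ^+ 4 by rewrite exprn_ege1.
pose a := (L ^+ 4)^-1.
have a01 : 0 <= a <= 1.
  by rewrite invr_ge0 invf_le1 ?(lt_le_trans ltr01)// L4 andbT (le_trans ler01).
have i2 := integrable_sqr mv (starC_sqr mC C2 Sv).
have v4 := starC_pow4 mC C4 Sv.
have mv2 : measurable_fun setT (fun z => v z ^+ 2) by exact: measurable_funX.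
have v4' : (\int[rho]_z ((v z ^+ 2) ^+ 2)%:E <= (L ^+ 4 * r ^+ 4)%:E)%E.
  by under eq_integral do rewrite -exprM.
have i4 := integrable_sqr mv2 v4'.
have e4 := Rintegral_sqr_le mv2 v4'.
pose p := a / r ^+ 2; pose q := a ^+ 2 / (4 * r ^+ 4).
have q0 : 0 <= q.
  by rewrite divr_ge0 ?sqr_ge0// mulr_ge0// exprn_ge0// ltW.
have ip : rho.-integrable setT (EFin \o (fun z => p * v z ^+ 2)).
  exact: (integrableZl measurableT _ i2).
have iq : rho.-integrable setT (EFin \o (fun z => q * (v z ^+ 2) ^+ 2)).
  exact: (integrableZl measurableT _ i4).
apply: (@le_trans _ _ (\int[rho]_z (p * v z ^+ 2 - q * (v z ^+ 2) ^+ 2))).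
  rewrite RintegralB// (RintegralZl _ measurableT i2) v2.
  rewrite (RintegralZl _ measurableT i4).
  have : q * \int[rho]_z (v z ^+ 2) ^+ 2 <= q * (L ^+ 4 * r ^+ 4).
    by rewrite ler_wpM2l.
  have -> : q * (L ^+ 4 * r ^+ 4) = a / 4.
    by rewrite /q /a; field; rewrite !gt_eqF// (lt_le_trans ltr01).
  have -> : p * r ^+ 2 = a by rewrite /p; field; rewrite gt_eqF.
  have -> : (2 * L ^+ 4)^-1 = a / 2.
    by rewrite /a; field; rewrite gt_eqF// (lt_le_trans ltr01).
  by have /andP[] := a01; lra.
apply: le_Rintegral => //.
- exact: (integrableB measurableT ip iq).
- apply: (@bounded_integrable _ _ _ _ _ 1).
    exact: (measurableT_comp (measurable_trunc r)).
  by move=> z; have := trunc_itv r0 (v z); rewrite ler_norml; lra.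
- by move=> z _; rewrite -exprM; exact: trunc_ge.
Qed.

Variables (N : nat) (c : R).
Variables (UM UE : N.-tuple bool -> N.-tuple Z -> \bar R).
Hypothesis N0 : (0 < N)%N.
Hypothesis c0 : 0 < c.
Hypothesis cL : 2 ^+ 16 * L ^+ 8 * c <= 1.
Hypothesis mUM : forall e, measurable_fun setT (UM e).
Hypothesis UM0 : forall e D, (0 <= UM e D)%E.
Hypothesis HUM : forall v D (e : N.-tuple bool), S v ->
  (`|\sum_(i < N) (-1) ^+ tnth e i * (v (tnth D i) * xi (tnth D i))|%:E
     <= UM e D)%E.
Hypothesis IUM : ((2^-1 ^+ N)%:E *
  \sum_(e : N.-tuple bool) \int[iid rho N]_D UM e D <= (c * N%:R * r ^+ 2)%:E)%E.
Hypothesis mUE : forall e, measurable_fun setT (UE e).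
Hypothesis UE0 : forall e D, (0 <= UE e D)%E.
Hypothesis HUE : forall v D (e : N.-tuple bool), S v ->
  (`|\sum_(i < N) (-1) ^+ tnth e i * v (tnth D i)|%:E <= UE e D)%E.
Hypothesis IUE : ((2^-1 ^+ N)%:E *
  \sum_(e : N.-tuple bool) \int[iid rho N]_D UE e D <= (c * N%:R * r)%:E)%E.

Definition deviates n (blk : 'I_N -> 'I_n) (g : Z -> R) (k : R)
    (D : N.-tuple Z) : pred 'I_n :=
  [pred j | k * #|[pred i | blk i == j]|%:R <
     `|\sum_(i | blk i == j) (g (tnth D i) - \int[rho]_z g z)| ].

(** With [t = kQ], half of the small-ball bound, this is [r^2 t^2 / 4]: on a block the fluctuation
    of the linear term then uses up at most half of the quadratic term. *)
Definition kM := r ^+ 2 / (64 * L ^+ 8).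
Definition kQ := (4 * L ^+ 4)^-1.

Definition good n (blk : 'I_N -> 'I_n) (D : N.-tuple Z) := forall v, S v ->
  #|deviates blk (fun z => v z * xi z) kM D|%:R < n%:R / 4 :> R /\
  #|deviates blk (fun z => trunc r (v z)) kQ D|%:R < n%:R / 4 :> R.

Let V := {v : Z -> R | S v}.

Let iM (v : V) : rho.-integrable setT (EFin \o (fun z => sval v z * xi z)).
Proof.
apply: (integrable_mul_xi (sigma := sigma)) => //.
  exact: (starC_measurable mC (svalP v)).
exact: le_lt_trans (starC_sqr mC C2 (svalP v)) (ltry _).
Qed.

Let mQ (v : V) : measurable_fun setT (fun z => trunc r (sval v z)).
Proof. exact: (measurableT_comp (measurable_trunc r) (starC_measurable mC (svalP v))). Qed.

Let iQ (v : V) : rho.-integrable setT (EFin \o (fun z => trunc r (sval v z))).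
Proof.
apply: (@bounded_integrable _ _ _ _ _ 1) => // z.
by have := trunc_itv r0 (sval v z); rewrite ler_norml; lra.
Qed.

Lemma trunc_majorant : exists UQ : N.-tuple bool -> N.-tuple Z -> \bar R, [/\
  forall e, measurable_fun setT (UQ e), forall e D, (0 <= UQ e D)%E,
  forall (v : V) D (e : N.-tuple bool),
    (`|\sum_(i < N) (-1) ^+ tnth e i * trunc r (sval v (tnth D i))|%:E
      <= UQ e D)%E &
  ((2^-1 ^+ N)%:E * \sum_(e : N.-tuple bool) \int[iid rho N]_D UQ e D
     <= (4 * c * N%:R)%:E)%E].
Proof.
have B0 : 0 < c * N%:R * r by rewrite !mulr_gt0// ltr0n.
have h0 : (0 : R) <= 2^-1 ^+ N by rewrite exprn_ge0.
have rV0 : 0 < r^-1 by rewrite invr_gt0.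
have [|UQ [mUQ UQ0 HUQ IUQ]] := @contraction_majorant _ _ _ (iid rho N) V N
  (fun v D i => sval v (tnth D i)) (fun=> trunc r) r^-1 (c * N%:R * r) UE
  rV0 B0 (fun _ => trunc_lip r0) (fun=> trunc0 r) mUE UE0.
  by move=> v D e; exact: HUE (svalP v).
exists UQ; split => //.
apply: (@le_trans _ _ ((2^-1 ^+ N)%:E * ((2 * r^-1)%:E *
   \sum_(e : N.-tuple bool) (\int[iid rho N]_D UE e D + (c * N%:R * r)%:E)))%E).
  by apply: lee_wpmul2l => //; rewrite lee_fin.
rewrite big_split/= muleCA ge0_muleDr; last 2 first.
- by apply: sume_ge0 => e _; exact: integral_ge0.
- by apply: sume_ge0 => e _; rewrite lee_fin ltW.
rewrite sumEFin sumr_const card_tuple card_bool -[c * N%:R * r *+ _]mulr_natl natrX.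
apply: (@le_trans _ _ ((2 * r^-1)%:E * ((c * N%:R * r)%:E + (c * N%:R * r)%:E))%E).
  apply: lee_wpmul2l; first by rewrite lee_fin mulr_ge0// ltW.
  apply: leeD => //.
  by rewrite -EFinM lee_fin [leLHS]mulrA -exprMn mulVf// expr1n mul1r.
rewrite -EFinD -EFinM lee_fin le_eqVlt; apply/orP; left; apply/eqP.
by field; rewrite gt_eqF.
Qed.

Let L8 : 1 <= L ^+ 8. Proof. exact: exprn_ege1. Qed.
Let L4 : 1 <= L ^+ 4. Proof. exact: exprn_ege1. Qed.
Let kM0 : 0 < kM.
Proof. by rewrite divr_gt0 ?exprn_gt0// mulr_gt0// (lt_le_trans ltr01). Qed.
Let kQ0 : 0 < kQ.
Proof. by rewrite invr_gt0 mulr_gt0// (lt_le_trans ltr01). Qed.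

Let L0 : 0 < L. Proof. exact: lt_le_trans ltr01 L1. Qed.
Let cL4 : 2 ^+ 16 * L ^+ 4 * c <= 1.
Proof.
apply: le_trans cL; rewrite ler_pM2r// ler_pM2l ?exprn_gt0//.
by rewrite -[L ^+ 4]mul1r (exprD L 4 4) ler_pM2r// (lt_le_trans ltr01).
Qed.

Let NR0 : 0 < N%:R :> R. Proof. by rewrite ltr0n. Qed.
Let BM0 : 0 < c * N%:R * r ^+ 2. Proof. by rewrite !mulr_gt0// exprn_gt0. Qed.
Let BQ0 : 0 < 4 * c * N%:R. Proof. by rewrite !mulr_gt0. Qed.

(** With one block, a count below [1/4] means no deviation at all. Markov's bounds [128 L^8 c] and
    [32 L^4 c] on the two failures add up to at most [1/2]. *)
Lemma good_one (blk : 'I_N -> 'I_1) : exists2 E : set (N.-tuple Z),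
  measurable E /\ ((1 - 2^-1)%:E <= iid rho N E)%E & forall D, E D -> good blk D.
Proof.
have [UQ [mUQ UQ0 HUQ IUQ]] := trunc_majorant.
have kMN : 0 < kM * N%:R by rewrite mulr_gt0.
have kQN : 0 < kQ * N%:R by rewrite mulr_gt0.
have [|E1 [mE1 P1 H1]] := @one_block_deviation _ _ _ rho N V
  (fun v z => sval v z * xi z) _ UM iM mUM UM0 _ IUM _ kMN.
  by move=> v D e; exact: HUM (svalP v).
have [E2 [mE2 P2 H2]] := @one_block_deviation _ _ _ rho N V
  (fun v z => trunc r (sval v z)) _ UQ iQ mUQ UQ0 HUQ IUQ _ kQN.
have szN (j : 'I_1) : #|[pred i | blk i == j]| = N.
  by rewrite -[RHS]card_ord; apply: eq_card => i; rewrite !inE !ord1 eqxx.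
have sumN (j : 'I_1) (f : 'I_N -> R) : \sum_(i | blk i == j) f i = \sum_i f i.
  by apply: eq_bigl => i; rewrite !ord1 eqxx.
have dev0 g k D : `|\sum_(i < N) (g (tnth D i) - \int[rho]_z g z)| < k * N%:R ->
    #|deviates blk g k D|%:R < 1%:R / 4 :> R.
  move=> h; rewrite eq_card0; first by rewrite divr_gt0.
  by move=> j; rewrite !inE szN sumN; apply/negbTE; rewrite -leNgt ltW.
exists (E1 `&` E2).
  split; first exact: measurableI.
  apply: le_trans (probability_setI_ge mE1 mE2 P1 P2); rewrite lee_fin lerD2l lerN2.
  have -> : 2 * (c * N%:R * r ^+ 2) / (kM * N%:R) = 128 * (L ^+ 8 * c).
    by rewrite /kM; field; rewrite !gt_eqF.
  have -> : 2 * (4 * c * N%:R) / (kQ * N%:R) = 32 * (L ^+ 4 * c).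
    by rewrite /kQ; field; rewrite !gt_eqF.
  move: cL cL4; rewrite -!mulrA.
  have : 0 <= L ^+ 8 * c by rewrite mulr_ge0 ?(ltW c0)// (le_trans ler01).
  have : 0 <= L ^+ 4 * c by rewrite mulr_ge0 ?(ltW c0)// (le_trans ler01).
  by move: (L ^+ 8 * c) (L ^+ 4 * c) => x y; lra.
move=> D [D1 D2] v Sv; split; apply: dev0.
  exact: (H1 D (exist _ v Sv) D1).
exact: (H2 D (exist _ v Sv) D2).
Qed.

(** The numerical hypotheses are those of [deviating_blocks] at the thresholds [kM] and [kQ]: the
    second moments [L^4 sigma^2 r^2] and 1 dictate the two lower bounds on [m], and [N <= 2nm] turns
    bounds proportional to [N/m] into a fraction of [n]. *)
Lemma good_blocks n m (blk : 'I_N -> 'I_n) : (0 < m)%N ->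
  (forall j, m <= #|[pred i | blk i == j]|)%N -> (N <= 2 * (n * m))%N ->
  2 ^+ 24 * L ^+ 20 * sigma ^+ 2 <= r ^+ 2 * m%:R -> 2 ^+ 16 * L ^+ 8 <= m%:R ->
  exists2 E : set (N.-tuple Z), measurable E /\
    ((1 - 2 * expR (- (n%:R / 512)))%:E <= iid rho N E)%E &
    forall D, E D -> good blk D.
Proof.
move=> m0 blkm Nnm hM hQ.
have mR0 : 0 < m%:R :> R by rewrite ltr0n.
have NR : N%:R <= 2 * (n%:R * m%:R) :> R by rewrite -natrM -natrM ler_nat.
have Nm : N%:R / m%:R <= 2 * n%:R :> R by rewrite ler_pdivrMr// -mulrA.
have nR0 : 0 <= n%:R :> R by [].
have Nm0 : 0 <= N%:R / m%:R :> R by rewrite divr_ge0// ltW.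
have budget (K x y : R) : 0 <= K -> 0 <= x -> x <= y ->
    K * x * (N%:R / m%:R) <= K * y * (2 * n%:R).
  move=> K0 x0 xy; apply: ler_pM; [exact: mulr_ge0|exact: Nm0|exact: ler_wpM2l|exact: Nm].
have [UQ [mUQ UQ0 HUQ IUQ]] := trunc_majorant.
have [|v|v|||E1 [mE1 P1 H1]] := @deviating_blocks _ _ _ rho N V
  (fun v z => sval v z * xi z) _ UM iM mUM UM0 _ IUM n m blk
  (L ^+ 4 * sigma ^+ 2 * r ^+ 2) kM _ _ m0 kM0 BM0 blkm.
- by move=> v D e; exact: HUM (svalP v).
- by apply: measurable_funM => //; exact: (starC_measurable mC (svalP v)).
- exact: (starC_mul_sqr r0 sigma0 mC C4 mxi xi4 (svalP v)).
- have -> : 64^-1 ^+ 2 * kM ^+ 2 * m%:R = r ^+ 2 * (r ^+ 2 * m%:R) / (2 ^+ 24 * L ^+ 16).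
    by rewrite /kM (exprM L 8 2); field; rewrite !gt_eqF.
  rewrite ler_pdivlMr; last by rewrite mulr_gt0// exprn_gt0// (lt_le_trans ltr01).
  rewrite [leLHS](_ : _ = r ^+ 2 * (2 ^+ 24 * L ^+ 20 * sigma ^+ 2)).
    by rewrite ler_pM2l// exprn_gt0.
  by rewrite (exprD L 4 16); ring.
- have -> : 12 * (c * N%:R * r ^+ 2) / (kM * m%:R) = 768 * (L ^+ 8 * c) * (N%:R / m%:R).
    rewrite /kM; field; rewrite !gt_eqF//.
  have h : 0 <= L ^+ 8 * c by rewrite mulr_ge0 ?(ltW c0)// (le_trans ler01).
  have h1 : L ^+ 8 * c <= 2 ^- 16.
    by rewrite -[leRHS]div1r ler_pdivlMr ?exprn_gt0// mulrC mulrA.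
  apply: le_trans (budget 768 _ _ _ h h1) _; [exact: ler0n|].
  by lra.
have [v|||E2 [mE2 P2 H2]] := @deviating_blocks _ _ _ rho N V
  (fun v z => trunc r (sval v z)) _ UQ iQ mUQ UQ0 HUQ IUQ n m blk 1 kQ mQ _ m0 kQ0 BQ0 blkm.
- rewrite -[leRHS](integral_cst1 rho); apply: ge0_le_integral => //.
  + by move=> z _; rewrite lee_fin sqr_ge0.
  + by apply/measurable_EFinP; apply: measurable_funX; exact: mQ.
  + move=> z _; rewrite lee_fin; have /andP[t0 t1] := trunc_itv r0 (sval v z).
    by rewrite expr_le1.
- have -> : 64^-1 ^+ 2 * kQ ^+ 2 * m%:R = m%:R / (2 ^+ 16 * L ^+ 8).
    by rewrite /kQ (exprM L 4 2); field; rewrite !gt_eqF.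
  by rewrite ler_pdivlMr ?mul1r// mulr_gt0 ?exprn_gt0// (lt_le_trans ltr01).
- have -> : 12 * (4 * c * N%:R) / (kQ * m%:R) = 192 * (L ^+ 4 * c) * (N%:R / m%:R).
    by rewrite /kQ; field; rewrite !gt_eqF.
  have h : 0 <= L ^+ 4 * c by rewrite mulr_ge0 ?(ltW c0)// (le_trans ler01).
  have h1 : L ^+ 4 * c <= 2 ^- 16.
    by rewrite -[leRHS]div1r ler_pdivlMr ?exprn_gt0// mulrC mulrA.
  apply: le_trans (budget 192 _ _ _ h h1) _; [exact: ler0n|].
  by lra.
exists (E1 `&` E2).
  split; first exact: measurableI.
  by apply: le_trans (probability_setI_ge mE1 mE2 P1 P2); rewrite lee_fin; lra.
move=> D [D1 D2] v Sv; split.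
  exact: (H1 D (exist _ v Sv) D1).
exact: (H2 D (exist _ v Sv) D2).
Qed.

End uniform.

(** * Majorities of blocks, and deterministic comparison on a good sample *)

Lemma majority_meet n (A B : pred 'I_n) :
  (n < 2 * #|A|)%N -> (n < 2 * #|B|)%N -> exists2 j, A j & B j.
Proof.
move=> hA hB; have := cardUI A B; have := max_card [predU A & B].
rewrite card_ord => hU hUI.
have pos (a b u i : nat) : (n < 2 * a -> n < 2 * b -> u <= n ->
  u + i = a + b -> 0 < i)%N by lia.
by have /card_gt0P[j /andP[Aj Bj]] := pos _ _ _ _ hA hB hU hUI; exists j.
Qed.

Section majority.
Context d (Z : measurableType d) (R : realType) (rho : probability Z R).
Variables (L r : R) (C : set (Z -> R)) (xi : Z -> R).
Hypothesis L1 : 1 <= L.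
Hypothesis r0 : 0 < r.
Hypothesis mC : forall u, C u -> measurable_fun setT u.
Hypothesis C2 : forall u, C u -> (\int[rho]_z (u z ^+ 2)%:E < +oo)%E.
Hypothesis C4 : forall u, C u ->
  (\int[rho]_z (u z ^+ 4)%:E <= (L ^+ 4 * (\int[rho]_z (u z ^+ 2)) ^+ 2)%:E)%E.
Hypothesis Cxi : forall u, C u -> 0 <= \int[rho]_z (u z * xi z).
Hypothesis iC : forall u, C u ->
  rho.-integrable setT (EFin \o (fun z => u z * xi z)).
Variables (N n : nat) (blk : 'I_N -> 'I_n) (D : N.-tuple Z).
Hypothesis blk0 : forall j, (0 < #|[pred i | blk i == j]|)%N.
Hypothesis gD : good rho L r C xi blk D.

Let sz j : R := #|[pred i | blk i == j]|%:R.
Let q := L ^+ 4.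

Definition block_excess (u : Z -> R) (j : 'I_n) : R :=
  \sum_(i | blk i == j) (u (tnth D i) ^+ 2 + 2 * (u (tnth D i) * xi (tnth D i))).

Let q1 : 1 <= q. Proof. exact: exprn_ege1. Qed.
Let q0 : 0 < q. Proof. exact: lt_le_trans ltr01 q1. Qed.
Let L8q : L ^+ 8 = q ^+ 2. Proof. by rewrite /q -exprM. Qed.
Let sz0 j : 0 < sz j. Proof. by rewrite ltr0n. Qed.

Let sum_szB (j : 'I_n) (f : 'I_N -> R) (a : R) :
  \sum_(i | blk i == j) (f i - a) = \sum_(i | blk i == j) f i - sz j * a.
Proof. by rewrite sumrB sumr_const -mulr_natl. Qed.

Lemma not_deviates_ge (g : Z -> R) k j : ~~ deviates rho blk g k D j ->
  sz j * (\int[rho]_z g z - k) <= \sum_(i | blk i == j) g (tnth D i).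
Proof.
rewrite /= -leNgt sum_szB ler_norml -/(sz j) => /andP[+ _].
by rewrite mulrBr; lra.
Qed.

(** The witness is [u] itself, or [u] shrunk to norm [r]. If [u] is small, a large excess risk must
    come from the linear term; otherwise the quadratic term grows like [al^2] and the fluctuation of
    the linear term only like [al], where [al > 1]. *)
Lemma block_excess_ge u : C u -> exists2 v, starC rho r C v &
  forall j, ~~ deviates rho blk (fun z => v z * xi z) (kM L r) D j ->
    ~~ deviates rho blk (fun z => trunc r (v z)) (kQ L) D j ->
    - r ^+ 2 * sz j <= block_excess u j /\
    ((8 * L ^+ 4 * r) ^+ 2 <
       \int[rho]_z (u z ^+ 2) + 2 * \int[rho]_z (u z * xi z) ->
     r ^+ 2 * sz j < block_excess u j).
Proof.
move=> Cu; set a := \int[rho]_z (u z ^+ 2); set b := \int[rho]_z (u z * xi z).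
have a0 : 0 <= a by apply: Rintegral_ge0 => z _; exact: sqr_ge0.
have b0 : 0 <= b by exact: Cxi.
have r20 : 0 < r ^+ 2 by rewrite exprn_gt0.
have q21 : 1 <= q ^+ 2 by rewrite exprn_ege1.
have cE : (8 * L ^+ 4 * r) ^+ 2 = 64 * q ^+ 2 * r ^+ 2 by rewrite -/q; ring.
rewrite cE.
have kME : kM L r = r ^+ 2 / (64 * q ^+ 2) by rewrite /kM L8q.
have kM1 : kM L r <= r ^+ 2 / 64.
  rewrite kME ler_pdivrMr; last by rewrite mulr_gt0// exprn_gt0.
  by rewrite mulrA divfK// ler_peMr// ltW.
have [ar|ra] := lerP a (r ^+ 2).
  exists u.
    exists u, 1; split=> //; first by rewrite ler01 lexx.
      by apply/funext => z; rewrite mul1r.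
    by rewrite expr1n mul1r.
  move=> j /not_deviates_ge h _.
  have hD : 2 * (sz j * (b - kM L r)) <= block_excess u j.
    rewrite /block_excess big_split/= -mulr_sumr.
    have : 0 <= \sum_(i | blk i == j) u (tnth D i) ^+ 2.
      by apply: sumr_ge0 => i _; exact: sqr_ge0.
    by move: h; rewrite -/b; lra.
  have sb : 0 <= sz j * b by rewrite mulr_ge0// ltW.
  have sk : sz j * kM L r <= sz j * (r ^+ 2 / 64) by rewrite ler_pM2l.
  have sr : 0 < sz j * r ^+ 2 by rewrite mulr_gt0.
  split; first by move: hD; rewrite mulrBr; lra.
  move=> hab.
  have b63 : 63 * r ^+ 2 < 2 * b.
    have : r ^+ 2 <= q ^+ 2 * r ^+ 2 by rewrite ler_peMl// ltW.
    by lra.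
  have : sz j * (63 * r ^+ 2) < sz j * (2 * b) by rewrite ltr_pM2l.
  by move: hD; rewrite mulrBr; lra.
pose al := Num.sqrt a / r.
have al1 : 1 < al.
  rewrite ltr_pdivlMr// mul1r -(@ltr_pXn2r _ 2)// ?nnegrE ?sqrtr_ge0 ?(ltW r0)//.
  by rewrite sqr_sqrtr.
have al0 : 0 < al by exact: lt_trans ltr01 al1.
have al2 : al ^+ 2 * r ^+ 2 = a.
  by rewrite /al expr_div_n sqr_sqrtr// divfK// gt_eqF.
pose v z := al^-1 * u z.
have uv z : u z = al * v z by rewrite /v mulrA divff ?mul1r// gt_eqF.
have Sv : starC rho r C v.
  exists u, al^-1; split=> //.
    by rewrite invr_ge0 ltW//= invf_le1// ltW.
  by rewrite -/a -al2 exprVn mulrA mulVf ?mul1r// expf_neq0// gt_eqF.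
have v2 : \int[rho]_z (v z ^+ 2) = r ^+ 2.
  rewrite /v; under eq_Rintegral do rewrite exprMn.
  have C2u : (\int[rho]_z (u z ^+ 2)%:E <= a%:E)%E by rewrite (C2E C2 Cu).
  rewrite (RintegralZl _ measurableT (integrable_sqr (mC Cu) C2u)) -/a -al2.
  by rewrite exprVn mulrA mulVf ?mul1r// expf_neq0// gt_eqF.
have vxi : al * \int[rho]_z (v z * xi z) = b.
  rewrite /v; under eq_Rintegral do rewrite -mulrA.
  rewrite (RintegralZl _ measurableT (iC Cu)) -/b mulrA divff ?mul1r//.
  by rewrite gt_eqF.
exists v => // j /not_deviates_ge hM /not_deviates_ge hQ.
pose t := (4 * q)^-1.
have t0 : 0 < t by rewrite invr_gt0 mulr_gt0.
have hphi : sz j * t <= \sum_(i | blk i == j) trunc r (v (tnth D i)).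
  apply: le_trans hQ; rewrite ler_pM2l// /kQ -/q.
  have := starC_trunc_ge L1 r0 mC C2 C4 Sv v2; rewrite -/q.
  have -> : (2 * q)^-1 = 2 * t by rewrite /t; field; rewrite gt_eqF.
  by rewrite -/t; lra.
(* The tangent line [x^2 >= 2 t x - t^2], with [x] the truncated value, turns the lower bound [t] on
   the block mean of [x] into [t^2] for that of [x^2]. *)
have hv2 : sz j * (r ^+ 2 * t ^+ 2) <= \sum_(i | blk i == j) v (tnth D i) ^+ 2.
  apply: (@le_trans _ _ (\sum_(i | blk i == j)
      (r ^+ 2 * (2 * t) * trunc r (v (tnth D i)) - r ^+ 2 * t ^+ 2))).
    rewrite sum_szB -mulr_sumr.
    have : (r ^+ 2 * (2 * t)) * (sz j * t) <=
        (r ^+ 2 * (2 * t)) * \sum_(i | blk i == j) trunc r (v (tnth D i)).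
      by rewrite ler_pM2l// !mulr_gt0.
    by rewrite !expr2; lra.
  apply: ler_sum => i _; apply: le_trans (trunc_sqr_le r0 _).
  have := mulr_ge0 (ltW r20) (sqr_ge0 (trunc r (v (tnth D i)) - t)).
  by move: (trunc r _) => x; rewrite sqrrB; lra.
have hE : block_excess u j = al ^+ 2 * \sum_(i | blk i == j) v (tnth D i) ^+ 2 +
    2 * al * \sum_(i | blk i == j) (v (tnth D i) * xi (tnth D i)).
  rewrite /block_excess big_split/= !mulr_sumr; congr (_ + _);
    by apply: eq_bigr => i _; rewrite !uv; ring.
have t2 : t ^+ 2 = (16 * q ^+ 2)^-1 by rewrite /t; field; rewrite gt_eqF.
have kMt : kM L r = r ^+ 2 * t ^+ 2 / 4.
  by rewrite kME t2; field; rewrite gt_eqF.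
(* Here [2 al kM = al r^2 t^2 / 2] is at most half of [al^2 r^2 t^2 = a t^2], as [al > 1]. *)
have low : sz j * (a * t ^+ 2 / 2 + 2 * b) <= block_excess u j.
  rewrite hE.
  have h1 : al ^+ 2 * (sz j * (r ^+ 2 * t ^+ 2)) <=
      al ^+ 2 * \sum_(i | blk i == j) v (tnth D i) ^+ 2.
    by rewrite ler_pM2l// exprn_gt0.
  have h2 : (2 * al) * (sz j * (\int[rho]_z (v z * xi z) - kM L r)) <=
      (2 * al) * \sum_(i | blk i == j) (v (tnth D i) * xi (tnth D i)).
    by rewrite ler_pM2l// mulr_gt0.
  apply: (le_trans _ (lerD h1 h2)).
  have -> : 2 * al * (sz j * (\int[rho]_z (v z * xi z) - kM L r)) =
      sz j * (2 * (al * \int[rho]_z (v z * xi z)) - 2 * al * kM L r) by ring.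
  rewrite vxi.
  have -> : al ^+ 2 * (sz j * (r ^+ 2 * t ^+ 2)) = sz j * (a * t ^+ 2).
    by rewrite -al2; ring.
  rewrite -mulrDr ler_pM2l// kMt.
  have : al * (r ^+ 2 * t ^+ 2) <= al ^+ 2 * (r ^+ 2 * t ^+ 2).
    by rewrite ler_pM2r ?mulr_gt0 ?exprn_gt0// expr2 ler_peMl// ltW.
  by rewrite [al ^+ 2 * _]mulrA al2; lra.
have at0 : 0 <= a * t ^+ 2 / 2 + 2 * b.
  apply: addr_ge0; last by rewrite mulr_ge0.
  by rewrite divr_ge0// mulr_ge0// sqr_ge0.
split.
  apply: le_trans low; apply: (@le_trans _ _ 0); last by rewrite mulr_ge0// ltW.
  by rewrite mulNr oppr_le0 mulr_ge0// ltW.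
(* The threshold is chosen so that [t^2 / 2] times it equals [2 r^2], leaving a margin over the
   required [r^2]. *)
move=> hab; apply: lt_le_trans low; rewrite mulrC ltr_pM2l//.
have t21 : t ^+ 2 <= 1.
  rewrite t2 invf_le1; last by rewrite mulr_gt0// exprn_gt0.
  by apply: (le_trans q21); rewrite ler_peMl ?sqr_ge0// ler1n.
have : (t ^+ 2 / 2) * (64 * q ^+ 2 * r ^+ 2) <= (t ^+ 2 / 2) * (a + 2 * b).
  by apply: ler_wpM2l (ltW hab); rewrite divr_ge0// sqr_ge0.
have -> : (t ^+ 2 / 2) * (64 * q ^+ 2 * r ^+ 2) = 2 * r ^+ 2.
  by rewrite t2; field; rewrite gt_eqF.
have : t ^+ 2 * b <= b by rewrite ler_piMl.
by lra.
Qed.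

(** Each of the two kinds of deviation spoils fewer than a quarter of the blocks, so a strict
    majority is free of both. *)
Lemma good_majority u : C u ->
  (n < 2 * #|[pred j | (- r ^+ 2 * sz j <= block_excess u j)%R]|)%N /\
  ((8 * L ^+ 4 * r) ^+ 2 <
     \int[rho]_z (u z ^+ 2) + 2 * \int[rho]_z (u z * xi z) ->
   (n < 2 * #|[pred j | (r ^+ 2 * sz j < block_excess u j)%R]|)%N).
Proof.
move=> Cu; have [v Sv Hv] := block_excess_ge Cu.
have [dM dQ] := gD Sv.
set A := deviates _ _ _ _ _ in dM; set B := deviates _ _ _ _ _ in dQ.
have {dM}dM : (4 * #|A| < n)%N.
  by rewrite -(ltr_nat R) natrM; lra.
have {dQ}dQ : (4 * #|B| < n)%N.
  by rewrite -(ltr_nat R) natrM; lra.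
have cnt (X : pred 'I_n) : (forall j, ~~ A j -> ~~ B j -> X j) -> (n < 2 * #|X|)%N.
  move=> h; have hC := cardC [predU A & B]; rewrite card_ord in hC.
  have hUI := cardUI A B.
  have hX : (#|[predC [predU A & B]]| <= #|X|)%N.
    apply: subset_leq_card; apply/fintype.subsetP => j.
    by rewrite !inE negb_or => /andP[]; exact: h.
  have maj (a b w i c x : nat) : (4 * a < n -> 4 * b < n -> w + i = a + b ->
    w + c = n -> c <= x -> n < 2 * x)%N by lia.
  exact: maj dM dQ hUI hC hX.
split=> [|hab]; apply: cnt => j Aj Bj; rewrite inE.
  by have [] := Hv j Aj Bj.
by have [_] := Hv j Aj Bj; exact.
Qed.

End majority.

(** * Norms, risk and complexity *)

Lemma Lqnorm_leE d (T : measurableType d) (R : realType)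
    (mu : {measure set T -> \bar R}) (k : nat) (f : T -> R) (c : R) :
  (0 < k)%N -> 0 <= c ->
  (Lqnorm mu k%:R f <= c%:E)%E = (\int[mu]_x (`|f x| ^+ k)%:E <= (c ^+ k)%:E)%E.
Proof.
move=> k0 c0; rewrite /Lqnorm unlock.
rewrite (eq_integral (fun x => (`|f x| ^+ k)%:E)); last first.
  by move=> x _ /=; rewrite powR_mulrn.
have kR : k%:R != 0 :> R by rewrite pnatr_eq0 -lt0n.
have : (0 <= \int[mu]_x (`|f x| ^+ k)%:E)%E.
  by apply: integral_ge0 => x _; rewrite lee_fin exprn_ge0.
case: (\int[mu]_x _)%E => [i||//]; last first.
  by move=> _; rewrite poweRyr ?invr_eq0// !leye_eq.
rewrite lee_fin => i0; rewrite poweR_EFin !lee_fin.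
rewrite -(@ler_pXn2r _ k)// ?nnegrE ?powR_ge0//.
by rewrite -[X in X <= _]powR_mulrn ?powR_ge0// -powRrM mulVf// powRr1.
Qed.

Lemma Lqnorm2_leE d (T : measurableType d) (R : realType)
    (mu : {measure set T -> \bar R}) (f : T -> R) (c : R) : 0 <= c ->
  (Lqnorm mu 2 f <= c%:E)%E = (\int[mu]_x (f x ^+ 2)%:E <= (c ^+ 2)%:E)%E.
Proof.
move=> c0; rewrite (Lqnorm_leE mu f (ltn0Sn 1) c0).
by under eq_integral do rewrite real_normK ?num_real//.
Qed.

Lemma Lqnorm4_leE d (T : measurableType d) (R : realType)
    (mu : {measure set T -> \bar R}) (f : T -> R) (c : R) : 0 <= c ->
  (Lqnorm mu 4 f <= c%:E)%E = (\int[mu]_x (f x ^+ 4)%:E <= (c ^+ 4)%:E)%E.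
Proof.
move=> c0; rewrite (Lqnorm_leE mu f (ltn0Sn 3) c0).
by under eq_integral do rewrite (exprM _ 2 2) real_normK ?num_real// -exprM.
Qed.

Lemma Lqnorm4_hypercontractive d (T : measurableType d) (R : realType)
    (mu : {measure set T -> \bar R}) (f : T -> R) (L a : R) :
  0 <= L -> 0 <= a ->
  (Lqnorm mu 4 f <= L%:E * Lqnorm mu 2 f)%E ->
  (\int[mu]_x (f x ^+ 2)%:E <= a%:E)%E ->
  (\int[mu]_x (f x ^+ 4)%:E <= (L ^+ 4 * a ^+ 2)%:E)%E.
Proof.
move=> L0 a0 h fa; have s0 := sqrtr_ge0 a.
have h2 : (Lqnorm mu 2 f <= (Num.sqrt a)%:E)%E by rewrite Lqnorm2_leE// sqr_sqrtr.
have : (Lqnorm mu 4 f <= (L * Num.sqrt a)%:E)%E.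
  by rewrite EFinM; apply: (le_trans h); apply: lee_wpmul2l.
rewrite Lqnorm4_leE ?mulr_ge0// exprMn.
by rewrite [Num.sqrt a ^+ 4](exprM _ 2 2) sqr_sqrtr.
Qed.

Lemma integral_lawX d (T : measurableType d) (R : realType)
    (rho : probability (T * R)%type R) (f : T -> R) :
  measurable_fun setT f -> (forall x, 0 <= f x) ->
  (\int[lawX rho]_x (f x)%:E = \int[rho]_z (f z.1)%:E)%E.
Proof.
move=> mf f0; rewrite /lawX ge0_integral_pushforward//.
- exact/measurable_EFinP.
- by move=> x; rewrite lee_fin.
Qed.

(** The infimum in the outer expectation need not be attained, so a majorant is taken at level
    [2 A], strictly higher since [A > 0]. As [H] is nonempty, this majorant is nonnegative and
    Tonelli applies. *)
Lemma rademacher_majorant d (T : measurableType d) (R : realType)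
    (rho : probability (T * R)%type R) (N : nat) (H : set (T -> R))
    (w : T * R -> R) (A : R) : H !=set0 -> 0 < A ->
  (rademacher rho N H w <= A%:E)%E ->
  exists g : N.-tuple (T * R)%type -> N.-tuple bool -> \bar R, [/\
    forall e, measurable_fun setT (g ^~ e),
    forall D e, (0 <= g D e)%E,
    forall u D (e : N.-tuple bool), H u -> (`| (Num.sqrt N%:R)^-1 *
      \sum_(i < N) (-1) ^+ tnth e i * (u (tnth D i).1 * w (tnth D i)) |%:E
        <= g D e)%E &
    ((2^-1 ^+ N)%:E * \sum_(e : N.-tuple bool) \int[iid rho N]_D g D e
      <= (2 * A)%:E)%E].
Proof.
move=> [u0 Hu0] A0 hA.
have : (rademacher rho N H w < (2 * A)%:E)%E.
  by apply: (le_lt_trans hA); rewrite lte_fin; lra.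
move=> /ereal_inf_lt[_ [g [mg Hg] <-]] Ig.
have g0 s : (0 <= g s)%E.
  apply: le_trans (Hg s); apply: le_trans; last first.
    by apply: ereal_sup_ubound; exists u0; [exact: Hu0|reflexivity].
  by rewrite lee_fin.
exists (fun D e => g (zsign D e)); split => //.
- by move=> e; apply: measurableT_comp => //; exact: measurable_zsign.
- move=> u D e Hu; apply: le_trans (Hg _); apply: ereal_sup_ubound.
  exists u => //; congr (`| _ * _ |%:E); apply: eq_bigr => i _.
  by rewrite tnth_mktuple mulrA.
- by rewrite -integral_signed// ltW.
Qed.

Lemma convex_class_conv d (T : measurableType d) (R : realType)
    (F : set (T -> R)) (f g : T -> R) (l : R) :
  convex_class F -> F f -> F g -> 0 <= l <= 1 ->
  F (fun x => l * f x + (1 - l) * g x).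
Proof.
move=> cF Ff Fg /andP[l0 l1].
by have := cF f g (Itv01 l0 l1) (mem_set Ff) (mem_set Fg) => /set_mem.
Qed.

Section law.
Context d (T : measurableType d) (R : realType).
Variables (rho : probability (T * R)%type R) (F : set (T -> R)) (h : T -> R).
Variables (L sigma : R).
Hypothesis L1 : 1 <= L.
Hypothesis s0 : 0 < sigma.
Hypothesis cF : convex_class F.
Hypothesis F2 : forall f, F f -> f \in Lfun (lawX rho) 2%:E.
Hypothesis Fh : F h.
Hypothesis hmin : forall f, F f -> (risk rho h <= risk rho f)%E.
Hypothesis F4 : forall f g, F f -> F g ->
  (Lqnorm (lawX rho) 4 (f \- g)%R <= L%:E * Lqnorm (lawX rho) 2 (f \- g)%R)%E.
Hypothesis res4 : forall f, F f ->
  (Lqnorm rho 4 (residual f) <= L%:E * Lqnorm rho 2 (residual f))%E.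
Hypothesis hs : (Lqnorm rho 2 (residual h) <= sigma%:E)%E.

(** Functions of the first coordinate, viewed on [T * R] so that they can be multiplied by the
    residual. *)
Definition diff_class : set (T * R -> R) :=
  [set u | exists2 f, F f & u = fun z => f z.1 - h z.1].

Lemma measurable_class f : F f -> measurable_fun setT f.
Proof. by move=> /F2; rewrite inE => /andP[/[!inE]]. Qed.

Lemma measurable_residual f : F f -> measurable_fun setT (residual f).
Proof.
move=> /measurable_class mf; apply: measurable_funB => //.
exact: (measurableT_comp mf measurable_fst).
Qed.

Let mxi := measurable_residual Fh.

Lemma diff_class_measurable u : diff_class u -> measurable_fun setT u.
Proof.
move=> [f /measurable_class mf ->]; have mh := measurable_class Fh.
by apply: measurable_funB; apply: measurableT_comp.
Qed.

Lemma residual_sqr : (\int[rho]_z (residual h z ^+ 2)%:E <= (sigma ^+ 2)%:E)%E.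
Proof. by rewrite -Lqnorm2_leE// ltW. Qed.

Lemma residual_pow4 :
  (\int[rho]_z (residual h z ^+ 4)%:E <= (L ^+ 4 * sigma ^+ 4)%:E)%E.
Proof.
have := Lqnorm4_hypercontractive (le_trans ler01 L1) (sqr_ge0 sigma) (res4 Fh)
  residual_sqr.
by rewrite -exprM.
Qed.

Lemma integral_diff f k : F f -> (0 < k)%N ->
  (\int[lawX rho]_x (`|(f \- h) x| ^+ k)%:E =
   \int[rho]_z (`|f z.1 - h z.1| ^+ k)%:E)%E.
Proof.
move=> Ff k0; rewrite integral_lawX//.
apply: measurable_funX; apply: measurableT_comp => //.
by apply: measurable_funB; exact: measurable_class.
Qed.

Lemma integral_diff2 f : F f ->
  (\int[lawX rho]_x ((f \- h) x ^+ 2)%:E = \int[rho]_z ((f z.1 - h z.1) ^+ 2)%:E)%E.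
Proof.
move=> Ff; rewrite (integral_lawX rho (f := fun x => (f \- h) x ^+ 2))//.
- by apply: measurable_funX; apply: measurable_funB; exact: measurable_class.
- by move=> x; exact: sqr_ge0.
Qed.

Lemma diff_class_lty u : diff_class u -> (\int[rho]_z (u z ^+ 2)%:E < +oo)%E.
Proof.
move=> [f Ff ->]; rewrite -integral_diff2//.
have /integrableP[_ i1] := Lfun2_integrable_sqr (F2 Ff).
have /integrableP[_ i2] := Lfun2_integrable_sqr (F2 Fh).
have mf := measurable_class Ff; have mh := measurable_class Fh.
have mX (g : T -> R) : measurable_fun setT g ->
    measurable_fun setT (fun x => `|(EFin \o (fun x => (g x ^+ 2)%R)) x|)%E.
  by move=> mg; apply: measurableT_comp => //; apply/measurable_EFinP; exact: measurable_funX.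
apply: (@le_lt_trans _ _ (\int[lawX rho]_x (2%:E * `|(EFin \o (fun x => (f x ^+ 2)%R)) x|
   + 2%:E * `|(EFin \o (fun x => (h x ^+ 2)%R)) x|))%E).
  apply: ge0_le_integral => //.
  - by move=> x _; rewrite lee_fin sqr_ge0.
  - apply/measurable_EFinP; apply: measurable_funX; exact: measurable_funB.
  - by apply: emeasurable_funD; apply: measurable_funeM; exact: mX.
  - move=> x _ /=; rewrite !ger0_norm ?sqr_ge0// -!EFinM -EFinD lee_fin.
    by have := sqr_ge0 (f x + h x); rewrite !expr2; lra.
rewrite ge0_integralD//; last 2 first.
- by apply: measurable_funeM; exact: mX.
- by apply: measurable_funeM; exact: mX.
rewrite !ge0_integralZl//; try exact: mX.
by rewrite lte_add_pinfty// lte_mul_pinfty.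
Qed.

Lemma diff_class_pow4 u : diff_class u ->
  (\int[rho]_z (u z ^+ 4)%:E <= (L ^+ 4 * (\int[rho]_z (u z ^+ 2)) ^+ 2)%:E)%E.
Proof.
move=> Cu; have [f Ff uE] := Cu.
have e := C2E diff_class_lty Cu.
have := @Lqnorm4_hypercontractive _ _ _ (lawX rho) (f \- h) L
  (\int[rho]_z (u z ^+ 2)) (le_trans ler01 L1) _ (F4 Ff Fh) _.
rewrite integral_diff2// uE in e *; rewrite e => H.
have e4 (x : R) : x ^+ 4 = `|x| ^+ 4.
  by rewrite [RHS](exprM _ 2 2) real_normK ?num_real// -exprM.
under eq_integral do rewrite e4.
rewrite -integral_diff//.
under eq_integral do rewrite -e4.
apply: H => //; apply: Rintegral_ge0 => z _; exact: sqr_ge0.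
Qed.

Lemma diff_class_mul_integrable u : diff_class u ->
  rho.-integrable setT (EFin \o (fun z => u z * residual h z)).
Proof.
move=> Cu; apply: (integrable_mul_xi mxi residual_sqr).
  exact: diff_class_measurable.
exact: diff_class_lty.
Qed.

Lemma integral_affine_residual (u : T * R -> R) (l : R) : diff_class u ->
  (\int[rho]_z ((residual h z + l * u z) ^+ 2)%:E =
   (\int[rho]_z (residual h z ^+ 2) + (l ^+ 2 * \int[rho]_z (u z ^+ 2) +
    2 * l * \int[rho]_z (u z * residual h z)))%:E)%E.
Proof.
move=> Cu; have mu := diff_class_measurable Cu.
have i1 := integrable_sqr mxi residual_sqr.
have u2 : (\int[rho]_z (u z ^+ 2)%:E <= (\int[rho]_z (u z ^+ 2))%:E)%E.
  by rewrite (C2E diff_class_lty Cu).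
have i2 := integrable_sqr mu u2.
have i3 := diff_class_mul_integrable Cu.
have j2 : rho.-integrable setT (EFin \o (fun z => l ^+ 2 * u z ^+ 2)).
  exact: (integrableZl measurableT _ i2).
have j3 : rho.-integrable setT (EFin \o (fun z => (2 * l) * (u z * residual h z))).
  exact: (integrableZl measurableT _ i3).
have j23 := integrableD measurableT j2 j3.
rewrite -(RintegralZl _ measurableT i2) -(RintegralZl _ measurableT i3).
rewrite -RintegralD// -RintegralD// /Rintegral fineK; last first.
  by apply: integrable_fin_num => //; exact: (integrableD measurableT i1 j23).
by apply: eq_integral => z _; congr (_%:E); ring.
Qed.

Lemma risk_diff f : F f -> let u := fun z : T * R => f z.1 - h z.1 in
  risk rho f = (risk rho h + (\int[rho]_z (u z ^+ 2) +
     2 * \int[rho]_z (u z * residual h z))%:E)%E.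
Proof.
move=> Ff u; have Cu : diff_class u by exists f.
have := integral_affine_residual 1 Cu; rewrite expr1n mul1r mulr1 => H.
rewrite /risk unlock (EFin_Rintegral_sqr mxi residual_sqr) -EFinD -H.
by apply: eq_integral => z _; congr (_ ^+ 2)%:E; rewrite /u /residual; ring.
Qed.

(** First-order optimality: moving from [h] towards [f] inside the convex class cannot lower the
    risk, so the directional derivative [2b] is nonnegative. *)
Lemma diff_class_mul_ge0 u : diff_class u -> 0 <= \int[rho]_z (u z * residual h z).
Proof.
move=> Cu; have [f Ff uE] := Cu.
set b := \int[rho]_z _; set a := \int[rho]_z (u z ^+ 2).
have a0 : 0 <= a by apply: Rintegral_ge0 => z _; exact: sqr_ge0.
have key l : 0 <= l <= 1 -> 0 <= l ^+ 2 * a + 2 * l * b.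
  move=> l01; have Fl := convex_class_conv cF Ff Fh l01.
  have := hmin Fl; rewrite /risk unlock (EFin_Rintegral_sqr mxi residual_sqr).
  rewrite [leRHS](_ : _ = \int[rho]_z ((residual h z + l * u z) ^+ 2)%:E)%E; last first.
    by apply: eq_integral => z _; congr (_ ^+ 2)%:E; rewrite uE /residual; ring.
  by rewrite integral_affine_residual// lee_fin -/a -/b; lra.
rewrite leNgt; apply/negP => b0.
(* A step in [(0, 1]] short enough for the first-order term to win: [l (1 + a - b) = -b] gives
   [l a + 2 b = b - l (1 - b) < 0]. *)
pose l := - b / (1 + a - b).
have D0 : 0 < 1 + a - b by lra.
have l0 : 0 < l by rewrite divr_gt0// oppr_gt0.
have l1 : l <= 1 by rewrite ler_pdivrMr// mul1r; lra.
have lD : l * (1 + a - b) = - b by rewrite divfK// gt_eqF.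
have := key l; rewrite (ltW l0) l1 => /(_ isT).
have -> : l ^+ 2 * a + 2 * l * b = l * (l * a + 2 * b) by ring.
rewrite pmulr_rge0//.
have : 0 <= l * (1 - b) by rewrite mulr_ge0 ?(ltW l0)//; lra.
by lra.
Qed.

End law.

Section complexity.
Context d (T : measurableType d) (R : realType).
Variables (rho : probability (T * R)%type R) (F : set (T -> R)) (h : T -> R).
Variables (N : nat).
Hypothesis F2 : forall f, F f -> f \in Lfun (lawX rho) 2%:E.
Hypothesis Fh : F h.
Hypothesis N0 : (0 < N)%N.

(* The fixed points are infima, so the bound is available at some [r1 < r]
   only; star-shapedness transports it to the scale [r]. *)
Lemma localized_majorant (w : T * R -> R) (r1 r A : R) :
  0 < r1 -> r1 <= r -> 0 < A ->
  (rademacher rho N (localized (lawX rho) F h r1) w <= A%:E)%E ->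
  exists U : N.-tuple bool -> N.-tuple (T * R)%type -> \bar R, [/\
    forall e, measurable_fun setT (U e), forall e D, (0 <= U e D)%E,
    forall v D (e : N.-tuple bool), starC rho r (diff_class F h) v ->
      (`|\sum_(i < N) (-1) ^+ tnth e i * (v (tnth D i) * w (tnth D i))|%:E
         <= U e D)%E &
    ((2^-1 ^+ N)%:E * \sum_(e : N.-tuple bool) \int[iid rho N]_D U e D
      <= (Num.sqrt N%:R * (r / r1) * (2 * A))%:E)%E].
Proof.
move=> r10 r1r A0 hA.
have r0 : 0 < r by exact: lt_le_trans r1r.
have sN0 : 0 < Num.sqrt N%:R :> R by rewrite sqrtr_gt0 ltr0n.
have mh := measurable_class F2 Fh.
have H0 : localized (lawX rho) F h r1 !=set0.
  exists (fun x => 0 * (h \- h) x + (1 - 0) * cst 0 x); split.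
    exists (h \- h); first by exists h.
    by exists 0 => //; rewrite lexx ler01.
  rewrite /= Lqnorm2_leE ?(ltW r10)//.
  under eq_integral do rewrite mul0r mulr0 addr0 expr0n/=.
  by rewrite integral_cst1 lee_fin exprn_ge0// ltW.
have [g [mg g0 Hg Ig]] := rademacher_majorant H0 A0 hA.
pose c := Num.sqrt N%:R * (r / r1).
have c0 : 0 < c by rewrite mulr_gt0// divr_gt0.
exists (fun e D => c%:E * g D e)%E; split.
- by move=> e; apply: measurable_funeM; exact: mg.
- by move=> e D; rewrite mule_ge0// lee_fin ltW.
- move=> v D e [u [l [[f Ff uE] /andP[l0 l1] vE lu]]].
  (* Shrinking a function of norm at most [r] by [r1 / r] lands in the class at [r1]; the factor
     [r / r1] in the majorant undoes this. *)
  pose l' := l * (r1 / r).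
  have l'0 : 0 <= l' by rewrite mulr_ge0// divr_ge0// ltW.
  pose x' x := l' * (f \- h) x + (1 - l') * cst 0 x.
  have Hx : localized (lawX rho) F h r1 x'.
    split.
      exists (f \- h); first by exists f.
      exists l' => //; rewrite l'0 /=; apply: mulr_ile1 => //.
        by rewrite divr_ge0// ltW.
      by rewrite ler_pdivrMr// mul1r.
    rewrite /= Lqnorm2_leE ?(ltW r10)// /x'.
    under eq_integral do rewrite mulr0 addr0 exprMn EFinM.
    have mfh : measurable_fun setT (f \- h).
      by apply: measurable_funB => //; exact: (measurable_class F2 Ff).
    rewrite ge0_integralZl//; last 3 first.
    - by apply/measurable_EFinP; exact: measurable_funX.
    - by move=> x _; rewrite lee_fin sqr_ge0.
    - by rewrite lee_fin sqr_ge0.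
    rewrite (integral_diff2 F2 Fh Ff).
    have -> : (\int[rho]_z ((f z.1 - h z.1) ^+ 2)%:E = \int[rho]_z (u z ^+ 2)%:E)%E.
      by rewrite uE.
    rewrite (C2E (diff_class_lty F2 Fh)); last by exists f.
    rewrite -EFinM lee_fin; set I := \int[rho]_z _ in lu *.
    have -> : l' ^+ 2 * I = (l ^+ 2 * I) * (r1 / r) ^+ 2 by rewrite /l'; ring.
    apply: le_trans (ler_wpM2r (sqr_ge0 _) lu) _.
    by rewrite -exprMn mulrC divfK// gt_eqF.
  have := Hg _ D e Hx.
  set S := \sum_(i < N) _; set S' := \sum_(i < N) _ => hS.
  have -> : `|S'|%:E = (c%:E * `|(Num.sqrt N%:R)^-1 * S|%:E)%E.
    have -> : S = r1 / r * S'.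
      rewrite /S mulr_sumr; apply: eq_bigr => i _.
      by rewrite /x' mulr0 addr0 vE uE /l' /=; ring.
    rewrite -EFinM -[X in X * _]gtr0_norm// -normrM; congr `| _ |%:E.
    by rewrite /c; field; rewrite !gt_eqF.
  by apply: lee_wpmul2l => //; rewrite lee_fin ltW.
- apply: (@le_trans _ _ (c%:E * ((2^-1 ^+ N)%:E *
     \sum_(e : N.-tuple bool) \int[iid rho N]_D g D e))%E).
    rewrite muleCA; apply: lee_wpmul2l; first by rewrite lee_fin exprn_ge0.
    rewrite ge0_sume_distrr; last by move=> e _; exact: integral_ge0.
    apply: lee_sum => e _; rewrite ge0_integralZl//.
    by rewrite lee_fin ltW.
  by rewrite [leRHS]EFinM; apply: lee_wpmul2l => //; rewrite lee_fin ltW.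
Qed.

End complexity.

(** * The tournament *)

(** Residue classes use every observation and are balanced even if the number of blocks does not
    divide [N]. The remainder is below [n.+1], so [inord] never takes its default value. *)
Definition residue_block N n (i : 'I_N) : 'I_n.+1 := inord (i %% n.+1).

Lemma residue_block_size N n (j : 'I_n.+1) :
  (N %/ n.+1 <= #|[pred i : 'I_N | residue_block n i == j]|)%N.
Proof.
have lN (l : 'I_(N %/ n.+1)) : (l * n.+1 + j < N)%N.
  apply: (@leq_trans (l.+1 * n.+1)); first by rewrite mulSn addnC ltn_add2r.
  by apply: leq_trans (leq_divM N n.+1); rewrite leq_mul2r ltn_ord orbT.
pose f l := Ordinal (lN l).
have f_inj : injective f.
  move=> l l' /(congr1 val) /= /eqP; rewrite eqn_add2r eqn_mul2r /=.
  by move=> /eqP h; exact: val_inj.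
rewrite -[X in (X <= _)%N]card_ord -(card_codom f_inj).
apply: subset_leq_card; apply/fintype.subsetP => _ /codomP[l ->].
rewrite inE /residue_block -val_eqE /= inordK ?ltn_pmod//.
by rewrite modnMDl modn_small.
Qed.

Section tournament.
Context d (T : measurableType d) (R : realType).
Variables (F : set (T -> R)) (N n : nat) (blk : 'I_N -> 'I_n) (r : R).

(* [f] beats every [g] in [F]: on a strict majority of the blocks its empirical
   squared loss exceeds that of [g] by at most [r ^+ 2]. *)
Definition champion (D : N.-tuple (T * R)%type) (f : T -> R) := forall g, F g ->
  (n < 2 * #|[pred j | (\sum_(i | blk i == j)
     (residual f (tnth D i) ^+ 2 - residual g (tnth D i) ^+ 2)
       <= r ^+ 2 * #|[pred i | blk i == j]|%:R)%R]|)%N.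

(** The procedure is obtained by choice from [F], the blocks and [r], before any law is introduced.
    Without a champion it returns an arbitrary member of [F]. *)
Lemma exists_procedure : F !=set0 ->
  exists fhat : N.-tuple (T * R)%type -> T -> R, forall D,
    F (fhat D) /\ ((exists2 f, F f & champion D f) -> champion D (fhat D)).
Proof.
move=> [f0 Ff0].
suff /choice[fhat Hfhat] : forall D, exists f, F f /\
    ((exists2 f, F f & champion D f) -> champion D f) by exists fhat.
move=> D; have [[f Ff cf]|nc] := pselect (exists2 f, F f & champion D f).
  by exists f.
by exists f0.
Qed.

Variables (rho : probability (T * R)%type R) (h : T -> R) (L sigma : R).
Hypothesis L1 : 1 <= L.
Hypothesis s0 : 0 < sigma.
Hypothesis r0 : 0 < r.
Hypothesis cF : convex_class F.
Hypothesis F2 : forall f, F f -> f \in Lfun (lawX rho) 2%:E.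
Hypothesis Fh : F h.
Hypothesis hmin : forall f, F f -> (risk rho h <= risk rho f)%E.
Hypothesis F4 : forall f g, F f -> F g ->
  (Lqnorm (lawX rho) 4 (f \- g)%R <= L%:E * Lqnorm (lawX rho) 2 (f \- g)%R)%E.
Hypothesis hs : (Lqnorm rho 2 (residual h) <= sigma%:E)%E.
Hypothesis blk0 : forall j, (0 < #|[pred i | blk i == j]|)%N.

(** Since [h] is a champion, the selected [f] is one too and must beat [h]; a large excess would
    make it lose to [h] on a strict majority, and two strict majorities share a block. The distance
    bound follows from the excess bound because [b >= 0]. *)
Lemma champion_good (D : N.-tuple (T * R)%type) (f : T -> R) :
  good rho L r (diff_class F h) (residual h) blk D -> F f ->
  ((exists2 f, F f & champion D f) -> champion D f) ->
  (Lqnorm (lawX rho) 2 (f \- h)%R <= (8 * L ^+ 4 * r)%:E)%E /\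
  (risk rho f <= risk rho h + ((8 * L ^+ 4 * r) ^+ 2)%:E)%E.
Proof.
move=> gD Ff cf.
have maj u (Cu : diff_class F h u) := good_majority L1 r0
  (diff_class_measurable F2 Fh) (diff_class_lty F2 Fh)
  (diff_class_pow4 L1 F2 Fh F4)
  (diff_class_mul_ge0 s0 cF F2 Fh hmin hs)
  (diff_class_mul_integrable s0 F2 Fh hs) blk0 gD Cu.
have {cf}cf : champion D f.
  apply: cf; exists h => // g Fg.
  have [+ _] := maj _ (ex_intro2 _ _ g Fg erefl).
  move=> /leq_trans; apply; rewrite leq_mul2l /=; apply: subset_leq_card.
  apply/fintype.subsetP => j; rewrite !inE mulNr lerNl /block_excess => hj.
  apply: le_trans hj; rewrite -sumrN le_eqVlt; apply/orP; left; apply/eqP.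
  by apply: eq_bigr => i _; rewrite /residual; ring.
pose u (z : T * R) := f z.1 - h z.1.
have Cu : diff_class F h u by exists f.
pose a := \int[rho]_z (u z ^+ 2).
pose b := \int[rho]_z (u z * residual h z).
have b0 : 0 <= b := diff_class_mul_ge0 s0 cF F2 Fh hmin hs Cu.
have K0 : 0 <= 8 * L ^+ 4 * r.
  by rewrite !mulr_ge0 ?exprn_ge0 ?(ltW r0)// (le_trans ler01).
have ab : a + 2 * b <= (8 * L ^+ 4 * r) ^+ 2.
  rewrite leNgt; apply/negP => hab.
  have [_ /(_ hab) h1] := maj _ Cu.
  have [j jA jB] := majority_meet h1 (cf _ Fh).
  move: jA jB; rewrite /= => jA; apply/negP; rewrite -ltNge.
  apply: (lt_le_trans jA); rewrite /block_excess le_eqVlt; apply/orP; left.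
  by apply/eqP; apply: eq_bigr => i _; rewrite /u /residual; ring.
split.
  rewrite Lqnorm2_leE// (integral_diff2 F2 Fh Ff).
  rewrite (C2E (diff_class_lty F2 Fh) Cu) lee_fin -/a.
  by apply: le_trans ab; rewrite lerDl mulr_ge0.
rewrite (risk_diff s0 F2 Fh hs Ff); apply: leeD2l.
by rewrite lee_fin.
Qed.

End tournament.

Lemma rstar_ge0 d (T : measurableType d) (R : realType)
    (rho : probability (T * R)%type R) (F : set (T -> R)) N (c1 c2 s : R) h :
  (0 <= rstar rho F N c1 c2 s h)%E.
Proof.
rewrite /rstar le_max; apply/orP; left.
by apply: le_ereal_inf_tmp => _ [x [x0 _] <-]; rewrite lee_fin ltW.
Qed.

(** The factor 2 makes [rstar < r] strict, so each infimum leaves an admissible radius below [r]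
    even if it is not attained. *)
Lemma lt_of_rstar d (T : measurableType d) (R : realType)
    (rho : probability (T * R)%type R) (F : set (T -> R)) N (c1 c2 s r : R) h :
  0 < r -> (2%:E * rstar rho F N c1 c2 s h <= r%:E)%E ->
  (rE rho F N c1 h < r%:E)%E /\ (rM rho F N c1 h < r%:E)%E.
Proof.
move=> r0 hr.
have lt : (rstar rho F N c1 c2 s h < r%:E)%E.
  rewrite ltNge; apply/negP => hr'.
  have h2 : (2%:E * r%:E <= r%:E)%E.
    by apply: le_trans hr; apply: lee_wpmul2l; rewrite ?lee_fin.
  by move: h2; rewrite -EFinM lee_fin; lra.
split; apply: le_lt_trans lt; rewrite /rstar !le_max lexx ?orbT//.
Qed.

Lemma leq_double_divn N n : (0 < N %/ n)%N -> (N <= 2 * (n * (N %/ n)))%N.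
Proof.
case: n => [|n]; first by rewrite divn0.
move=> q0; rewrite {1}(divn_eq N n.+1) mulnC mul2n -addnn leq_add2l.
by rewrite (leq_trans (ltnW (ltn_pmod _ _)))// leq_pmulr.
Qed.

(** Half of the exponent absorbs the factor 2 of the union bound over the two failure events. *)
Lemma double_expRN_le (R : realType) (y : R) :
  1 <= y -> 2 * expR (- (y + y)) <= expR (- y).
Proof.
move=> y1; rewrite opprD expRD mulrA; apply: ler_piMl; first exact: expR_ge0.
rewrite expRN ler_pdivrMr ?expR_gt0// mul1r.
by apply: le_trans (expR_ge1Dx _); lra.
Qed.

(** * Length and number of the blocks, and the exponent *)

Section block_count.
Variables (R : realType) (L sigma r : R) (N : nat).
Hypothesis L1 : 1 <= L.
Hypothesis s0 : 0 < sigma.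
Hypothesis r0 : 0 < r.

(** Dictated by the condition of [good_blocks] on the variance of [v xi]; it also covers the weaker
    requirement [2^16 L^8 <= m]. *)
Definition block_const : R := 2 ^+ 24 * L ^+ 20.

Definition block_length : nat :=
  (Num.truncn (block_const * Num.max 1 (sigma ^+ 2 / r ^+ 2))).+1.

(* The number of blocks minus one; a single block is used for samples too small
   for the blocks to pay off. *)
Definition block_count : nat :=
  if (1024 * block_length <= N)%N then (N %/ block_length).-1 else 0.

Let w := Num.max 1 (sigma ^+ 2 / r ^+ 2).

Lemma block_const_ge1 : 1 <= block_const.
Proof.
rewrite /block_const -[leLHS]mulr1; apply: ler_pM => //.
  by rewrite exprn_ege1// ler1n.
exact: exprn_ege1.
Qed.

Let w1 : 1 <= w. Proof. by rewrite le_max lexx. Qed.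
Let K0 : 0 < block_const. Proof. exact: lt_le_trans ltr01 block_const_ge1. Qed.
Let Kw1 : 1 <= block_const * w.
Proof. by rewrite -[leLHS]mulr1 ler_pM// block_const_ge1. Qed.

Lemma exponent_denom_gt0 : 0 < 4096 * block_const.
Proof. by rewrite pmulr_lgt0 ?ltr0n. Qed.

(** Hence [N min{1, r^2 / sigma^2}] is, up to constants, [N] divided by the block length. *)
Lemma min_inv_max : Num.min 1 (sigma ^- 2 * r ^+ 2) * w = 1.
Proof.
have s20 : 0 < sigma ^+ 2 by rewrite exprn_gt0.
have r20 : 0 < r ^+ 2 by rewrite exprn_gt0.
have e : sigma ^- 2 * r ^+ 2 * (sigma ^+ 2 / r ^+ 2) = 1.
  by field; rewrite !gt_eqF.
rewrite /w; have [h|h] := lerP (sigma ^+ 2) (r ^+ 2).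
  rewrite max_l ?min_l ?mulr1//; last by rewrite ler_pdivrMr// mul1r.
  by rewrite mulrC ler_pdivlMr// mul1r.
rewrite max_r ?min_r//; first by rewrite mulrC ler_pdivrMr// mul1r ltW.
by rewrite ler_pdivlMr// mul1r ltW.
Qed.

Lemma block_length_ge : block_const * w <= block_length%:R.
Proof. by rewrite ltW// truncnS_gt. Qed.

Lemma block_length_le : block_length%:R <= 2 * (block_const * w).
Proof.
rewrite /block_length -natr1.
have := truncn_le (block_const * w); rewrite (le_trans ler01 Kw1) => h.
by have := Kw1; rewrite -/w; lra.
Qed.

Lemma block_length_le_div : (1024 * block_length <= N)%N ->
  [/\ (block_count.+1 = N %/ block_length)%N, (1024 <= block_count.+1)%N &
      (block_length <= N %/ block_count.+1)%N].
Proof.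
move=> h; have h1 : (1024 <= N %/ block_length)%N by rewrite leq_divRL.
have e : (block_count.+1 = N %/ block_length)%N.
  by rewrite /block_count h prednK// (leq_trans _ h1).
split; rewrite ?e// leq_divRL ?(leq_trans _ h1)// mulnC.
exact: leq_divM.
Qed.

Lemma few_blocks : (N < 1024 * block_length)%N ->
  N%:R * Num.min 1 (sigma ^- 2 * r ^+ 2) <= 2048 * block_const.
Proof.
move=> h; have w0 : 0 < w by exact: lt_le_trans ltr01 w1.
rewrite -(ler_pM2r w0) -[leLHS]mulrA min_inv_max mulr1.
have : N%:R <= 1024 * block_length%:R :> R by rewrite -natrM ler_nat ltnW.
by have := block_length_le; lra.
Qed.

Lemma many_blocks : (1024 * block_length <= N)%N ->
  N%:R * Num.min 1 (sigma ^- 2 * r ^+ 2) <= 4 * block_const * block_count.+1%:R.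
Proof.
move=> h; have w0 : 0 < w by exact: lt_le_trans ltr01 w1.
have [e h1 _] := block_length_le_div h.
rewrite -(ler_pM2r w0) -[leLHS]mulrA min_inv_max mulr1.
have hN : (N <= 2 * (block_count.+1 * block_length))%N.
  by rewrite e [(_ %/ _ * _)%N]mulnC; apply: leq_double_divn; rewrite -e.
have : N%:R <= 2 * (block_count.+1%:R * block_length%:R) :> R.
  by rewrite -!natrM ler_nat.
move=> /le_trans; apply.
have := block_length_le; have : 0 <= block_count.+1%:R :> R by [].
by nra.
Qed.

Let t := (4096 * block_const)^-1 * N%:R * Num.min 1 (sigma ^- 2 * r ^+ 2).

Let le_t (a : R) :
  N%:R * Num.min 1 (sigma ^- 2 * r ^+ 2) <= 4096 * block_const * a -> t <= a.
Proof.
by move=> h; rewrite /t -mulrA ler_pdivrMl; [exact: h|exact: exponent_denom_gt0].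
Qed.

(** At least 1024 blocks make [n/1024 >= 1], as needed for half of the exponent [n/512] to absorb
    the factor 2; the 4096 in [t] is 4, from [many_blocks], times 1024. *)
Lemma many_blocks_exponent : (1024 * block_length <= N)%N ->
  1 - expR (- t) <= 1 - 2 * expR (- (block_count.+1%:R / 512)).
Proof.
move=> h; have [_ n1024 _] := block_length_le_div h.
have : t <= block_count.+1%:R / 1024.
  apply: le_t; apply: le_trans (many_blocks h) _.
  by move: block_const => K; lra.
rewrite lerD2l lerN2 => le_tn.
apply: (@le_trans _ _ (expR (- (block_count.+1%:R / 1024)))).
  rewrite (_ : _ / 512 = block_count.+1%:R / 1024 + block_count.+1%:R / 1024).
    apply: double_expRN_le; rewrite ler_pdivlMr; last exact: ltr0n.
    by rewrite mul1r ler_nat.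
  by move: (block_count.+1%:R : R) => x; lra.
by rewrite ler_expR lerN2.
Qed.

(** For a short sample [t <= 1/2], and [expR (- t) >= 1 - t] makes the claimed probability at most
    one half, which a single block achieves. *)
Lemma few_blocks_exponent : (N < 1024 * block_length)%N ->
  1 - expR (- t) <= 1 - 2^-1.
Proof.
move=> h; have : t <= 2^-1.
  apply: le_t; apply: le_trans (few_blocks h) _.
  by move: block_const => K; lra.
rewrite lerD2l lerN2 => th.
by apply: le_trans (expR_ge1Dx _); lra.
Qed.

End block_count.

Theorem theorem2p10 (R : realType) (L : R) (hL : 1 <= L) :
  exists c c0 c1 c2 : R, [/\ 0 < c, 0 < c0, 0 < c1 & 0 < c2] /\
  forall (d : measure_display) (T : measurableType d) (F : set (T -> R))
    (N : nat) (sigma r : R),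
    (0 < N)%N -> 0 < sigma -> F !=set0 -> convex_class F ->
  exists fhat : N.-tuple (T * R)%type -> T -> R,
    (forall D, F (fhat D)) /\
    forall (rho : probability (T * R)%type R) (fstar : T -> R),
      (forall f, F f -> f \in Lfun (lawX rho) 2%:E) ->
      snd \in Lfun rho 2%:E ->
      L2_locally_compact (lawX rho) F ->
      unique_minimizer rho F fstar ->
      (forall f h, F f -> F h ->
        (Lqnorm (lawX rho) 4 (f \- h)%R
          <= L%:E * Lqnorm (lawX rho) 2 (f \- h)%R)%E) ->
      (forall f, F f ->
        (Lqnorm rho 4 (residual f)
          <= L%:E * Lqnorm rho 2 (residual f))%E) ->
      (Lqnorm rho 2 (residual fstar) <= sigma%:E)%E ->
      (2%:E * rstar rho F N c1 c2 sigma fstar <= r%:E)%E ->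
      exists2 E : set (N.-tuple (T * R)%type),
        measurable E /\
        ((1 - expR (- (c0 * N%:R * Num.min 1 (sigma ^- 2 * r ^+ 2))))%:E
          <= iid rho N E)%E &
        forall D, E D ->
          (Lqnorm (lawX rho) 2 (fhat D \- fstar)%R <= (c * r)%:E)%E /\
          (risk rho (fhat D) <= risk rho fstar + ((c * r) ^+ 2)%:E)%E.
Proof.
have L0 : 0 < L by exact: lt_le_trans ltr01 hL.
have K1 := block_const_ge1 hL.
have K0 : 0 < block_const L by exact: lt_le_trans ltr01 K1.
pose cm : R := (2 ^+ 16 * L ^+ 8)^-1.
have cm0 : 0 < cm by rewrite invr_gt0 mulr_gt0 ?exprn_gt0.
have cmL : 2 ^+ 16 * L ^+ 8 * cm <= 1.
  by rewrite divff// gt_eqF// mulr_gt0 ?exprn_gt0.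
(* [cm] is the largest constant that [good_one] and [good_blocks] accept; halving it compensates the
   doubling in [rademacher_majorant]. *)
exists (8 * L ^+ 4), (4096 * block_const L)^-1, (cm / 2), 1.
split.
  split; last exact: ltr01.
  - by rewrite mulr_gt0// exprn_gt0.
  - by rewrite invr_gt0; exact: exponent_denom_gt0 hL.
  - by rewrite divr_gt0// ltr0n.
move=> d T F N sigma r N0 s0 F0 cF.
pose n := block_count L sigma r N.
pose blk := @residue_block N n.
have [fhat Hfhat] := exists_procedure blk r F0.
exists fhat; split=> [D|rho h F2 _ _ [Fh hmin _] F4 res4 hs hr].
  by have [] := Hfhat D.
(* As [rstar >= 0] excludes [r < 0], only [r = 0] remains: the claimed probability is then 0 and the
   empty event suffices. *)
have [r0|rle0] := ltrP 0 r; last first.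
  have : 0 <= r.
    by rewrite -lee_fin (le_trans _ hr)// mule_ge0// rstar_ge0.
  move=> rge0; have -> : r = 0 by apply/eqP; rewrite eq_le rle0.
  exists set0 => //; split=> //.
  have -> : Num.min 1 (sigma ^- 2 * 0 ^+ 2) = 0 :> R.
    by rewrite expr0n mulr0 min_r.
  by rewrite measure0 lee_fin mulr0 oppr0 expR0 subrr lexx.
have sN0 : 0 < Num.sqrt N%:R :> R by rewrite sqrtr_gt0 ltr0n.
have sN2 : Num.sqrt N%:R * Num.sqrt N%:R = N%:R :> R by rewrite -expr2 sqr_sqrtr.
have [ltE ltM] := lt_of_rstar r0 hr.
have [_ [rE1 [rE10 hE] <-]] := ereal_inf_lt ltE; rewrite lte_fin => rE1r.
have [_ [rM1 [rM10 hM] <-]] := ereal_inf_lt ltM; rewrite lte_fin => rM1r.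
have AE0 : 0 < cm / 2 * Num.sqrt N%:R * rE1 by rewrite !mulr_gt0.
have AM0 : 0 < cm / 2 * Num.sqrt N%:R * rM1 ^+ 2.
  by rewrite !mulr_gt0// exprn_gt0.
have [UE [mUE UE0 HUE IUE]] := localized_majorant F2 Fh N0 rE10 (ltW rE1r) AE0 hE.
have [UM [mUM UM0 HUM IUM]] := localized_majorant F2 Fh N0 rM10 (ltW rM1r) AM0 hM.
(* Passing from the admissible radius to [r] is exact for the bound linear in the radius; the
   quadratic one below even gains the factor [rM1 / r < 1]. *)
have {}IUE : ((2^-1 ^+ N)%:E * \sum_(e : N.-tuple bool) \int[iid rho N]_D UE e D
    <= (cm * N%:R * r)%:E)%E.
  apply: (le_trans IUE); rewrite lee_fin -[in leRHS]sN2 le_eqVlt; apply/orP; left; apply/eqP.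
  by field; rewrite gt_eqF.
have {}IUM : ((2^-1 ^+ N)%:E * \sum_(e : N.-tuple bool) \int[iid rho N]_D UM e D
    <= (cm * N%:R * r ^+ 2)%:E)%E.
  apply: (le_trans IUM); rewrite lee_fin.
  have -> : Num.sqrt N%:R * (r / rM1) * (2 * (cm / 2 * Num.sqrt N%:R * rM1 ^+ 2)) =
      cm * N%:R * r * rM1 by rewrite -[in RHS]sN2; field; rewrite gt_eqF.
  rewrite [r ^+ 2]expr2 mulrA ler_pM2l ?(ltW rM1r)// !mulr_gt0// ltr0n//.
have {}HUE v D (e : N.-tuple bool) : starC rho r (diff_class F h) v ->
    (`|\sum_(i < N) (-1) ^+ tnth e i * v (tnth D i)|%:E <= UE e D)%E.
  move=> Sv; have := HUE v D e Sv.
  by under eq_bigr do rewrite mulr1.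
have mC := diff_class_measurable F2 Fh.
have C2 := diff_class_lty F2 Fh.
have C4 := diff_class_pow4 hL F2 Fh F4.
have mxi := measurable_residual F2 Fh.
have xi2 := residual_sqr s0 hs.
have xi4 := residual_pow4 hL s0 Fh res4 hs.
have concl E : measurable E ->
    ((1 - expR (- ((4096 * block_const L)^-1 * N%:R *
       Num.min 1 (sigma ^- 2 * r ^+ 2))))%:E <= iid rho N E)%E ->
    (forall D, E D -> good rho L r (diff_class F h) (residual h) blk D) ->
    (forall j, (0 < #|[pred i | blk i == j]|)%N) ->
    exists2 E : set (N.-tuple (T * R)%type),
        measurable E /\
        ((1 - expR (- ((4096 * block_const L)^-1 * N%:R *
            Num.min 1 (sigma ^- 2 * r ^+ 2))))%:E
          <= iid rho N E)%E &
        forall D, E D ->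
          (Lqnorm (lawX rho) 2 (fhat D \- h)%R <= (8 * L ^+ 4 * r)%:E)%E /\
          (risk rho (fhat D) <= risk rho h + ((8 * L ^+ 4 * r) ^+ 2)%:E)%E.
  move=> mE PE gE blk0; exists E => // D ED; have [FD cD] := Hfhat D.
  exact: (champion_good hL s0 r0 cF F2 Fh hmin F4 hs blk0 (gE _ ED) FD cD).
have [many|few] := leqP (1024 * block_length L sigma r) N.
  have [_ n1024 lenN] := block_length_le_div many.
  have m0 : (0 < N %/ n.+1)%N by exact: leq_trans lenN.
  have blkm j : (N %/ n.+1 <= #|[pred i | blk i == j]|)%N.
    exact: residue_block_size.
  have lenR : block_const L * Num.max 1 (sigma ^+ 2 / r ^+ 2) <= (N %/ n.+1)%:R.
    by apply: (le_trans (block_length_ge L sigma r)); rewrite ler_nat.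
  have Nle := leq_double_divn m0.
  have [||E [mE PE] gE] := good_blocks hL r0 s0 mC C2 C4 mxi xi2 xi4 N0 cm0 cmL
    mUM UM0 HUM IUM mUE UE0 HUE IUE m0 blkm Nle.
  - have r20 : 0 < r ^+ 2 by rewrite exprn_gt0.
    rewrite -/(block_const L) -ler_pdivrMl//; apply: le_trans lenR.
    rewrite [leLHS]mulrC -[leLHS]mulrA; apply: ler_wpM2l (ltW K0) _ _ _.
    by rewrite le_max lexx orbT.
  - apply: le_trans lenR; rewrite -[leLHS]mulr1; apply: ler_pM => //.
    + by rewrite mulr_ge0 ?exprn_ge0// ltW.
    + rewrite /block_const; apply: ler_pM; rewrite ?exprn_ge0 ?(ltW L0)//.
        by rewrite ler_eXn2l// ltr1n.
      by rewrite ler_weXn2l.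
    + by rewrite le_max lexx.
  apply: (concl E mE) => //; last by move=> j; exact: leq_trans (blkm j).
  apply: le_trans PE; rewrite lee_fin.
  exact: many_blocks_exponent hL s0 r0 many.
have n0 : n = 0 by rewrite /n /block_count leqNgt few.
move: (concl); rewrite /blk n0 => {}concl.
have [E [mE PE] gE] := good_one hL r0 mC C2 mxi xi2 N0 cm0 cmL
    mUM UM0 HUM IUM mUE UE0 HUE IUE (@residue_block N 0).
apply: (concl E mE) => //.
  apply: le_trans PE; rewrite lee_fin.
  exact: few_blocks_exponent hL s0 r0 few.
move=> j; apply: leq_trans (residue_block_size N j).
by rewrite divn1.
Qed.
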